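(* Let $G=(V,E)$ be the lattice $\mathbb Z^d$ (nearest-neighbour graph) with graph distance $d(\cdot,\cdot)$, so that for some $\alpha\ge 1$ and $c_1,c_2>0$ one has $c_1r^\alpha\le\sharp B(x,r)\le c_2r^\alpha$ for all $x\in V$, $r\ge1$. Let $\omega=\{\omega(e)\}_{e\in E}$ be non-negative random conductances on the probability space $(\Omega,\mathcal F,\mathbb P)$, where $\Omega=[0,\infty)^E$ with $\mathcal F$ the $\sigma$-algebra generated by the coordinate maps, and fix a base point $x_0\in V$. Assume (A): there exist $\Omega_0\in\mathcal F$ with $\mathbb P(\Omega_0)=1$, positive constants $c_{1.1},\dots,c_{1.6},\beta,\epsilon$ with $\epsilon+1<\beta$, and random variables $N_{x,\epsilon}(\omega)$ ($x\in V$, $\omega\in\Omega_0$) such that the following hold. (A1) For all $\omega\in\Omega_0$, $x\in V(G^\omega)$ and $r\ge N_{x,\epsilon}(\omega)$: $c_{1.1}r^{\alpha}\le V^\omega(x,r)\le c_{1.2}r^{\alpha}$. (A2) For all $\omega\in\Omega_0$ and $x,y\in V(G^\omega)$, $$p_n^\omega(x,y)\le \frac{c_{1.3}}{n^{\alpha/\beta}}\exp\Big[-c_{1.4}\Big(\frac{d(x,y)}{n^{1/\beta}}\Big)^{\beta/(\beta-1)}\Big]\quad\text{whenever } \max\{d(x,y),N_{x,\epsilon}(\omega)\}\le n,$$ and $$p_n^\omega(x,y)+p_{n+1}^\omega(x,y)\ge \frac{c_{1.5}}{n^{\alpha/\beta}}\exp\Big[-c_{1.6}\Big(\frac{d(x,y)}{n^{1/\beta}}\Big)^{\beta/(\beta-1)}\Big]\quad\text{whenever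 } \max\{d(x,y)^{1+\epsilon},N_{x,\epsilon}(\omega)\}\le n.$$ (A3) There is a non-increasing function $f_\epsilon(n)$ such that $\mathbb P(N_{x,\epsilon}\ge n)\le f_\epsilon(n)$ for all $x\in V$ and $n\ge1$, and $\sum_{n\ge1}n^{\alpha\beta}f_\epsilon(n)<\infty$. Assume also (B): (B1) $\mathbb P$ is ergodic with respect to the translations $\tau_x$, $x\in\mathbb Z^d$: $\mathbb P\circ\tau_x=\mathbb P$ for all $x$, and every $A\in\mathcal F$ with $\tau_x(A)=A$ for all $x\in\mathbb Z^d$ satisfies $\mathbb P(A)\in\{0,1\}$. (B2) For $\mathbb P$-almost every $\omega$, $\mathcal C(\omega)$ contains a unique infinite connected component. Then there exist deterministic constants $C_1,C_2>0$ (not depending on $\omega$) such that for $\mathbb P$-almost every $\omega$, $$\limsup_{n\to\infty}\frac{d(X_0^\omega,X_n^\omega)}{n^{1/\beta}(\log\log n)^{1-1/\beta}}=C_1,\qquad P_x^\omega\text{-a.s. for all }x\in V(G^\omega),$$ $$\liminf_{n\to\infty}\frac{\max_{0\le\ell\le n}d(X_0^\omega,X_\ell^\omega)}{n^{1/\beta}(\log\log n)^{-1/\beta}}=C_2,\qquad P_x^\omega\text{-a.s. for all }x\in V(G^\omega).$$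
   Context: $d(x,y)$ is the length of a shortest path in $G$ (not depending on $\omega$), and $B(x,r)=\{y\in V: d(x,y)\le r\}$; $\sharp$ denotes cardinality. Write $\omega_{xy}=\omega(e)$ for $e=xy\in E$. $V(G^\omega)$ is the set of vertices $v$ that can be joined to $x_0$ by a path of edges $e$ all with $\omega(e)>0$. $\mathcal C(\omega)$ is the set of vertices $x$ from which there starts an infinite self-avoiding path all of whose edges $e$ satisfy $\omega(e)>0$; connectedness in $\mathcal C(\omega)$ is via edges of positive conductance. The shift $\tau_x:\Omega\to\Omega$ is $(\tau_x\omega)_{yz}=\omega_{y+x,z+x}$. The weight of $x$ is $\mu^\omega(x)=\sum_{y: y\sim x}\omega_{xy}$, and $V^\omega(x,r)=\sum_{y\in B(x,r)\cap V(G^\omega)}\mu^\omega(y)$. $\{X_n^\omega\}_{n\ge0}$ is the discrete-time Markov chain on $V(G^\omega)$ with transition probability $P^\omega(x,y)=\omega_{xy}/\mu^\omega(x)$; $P_x^\omega$ is its law started from $X_0^\omega=x$. The heat kernel is $p_n^\omega(x,y)=P_x^\omega(X_n^\omega=y)/\mu^\omega(y)$. *)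

(* Defs.v *)
From HB Require Import structures.
From mathcomp Require Import all_boot all_order all_algebra.
From mathcomp Require Import finmap.
From mathcomp Require Import all_classical all_reals all_analysis.

Set Implicit Arguments.
Unset Strict Implicit.
Unset Printing Implicit Defensive.
Import Order.TTheory GRing.Theory Num.Theory.
Local Open Scope classical_set_scope.
Local Open Scope ring_scope.

Section Graph.
Context {T : choiceType} (e : rel T).

Definition walk (x y : T) (p : seq T) : Prop := path e x p /\ last x p = y.

Definition joined (x y : T) : Prop := exists p, walk x y p.

(* The length of a shortest walk; junk value 0 if [x] and [y] are not joined. *)
Definition gdist (x y : T) : nat :=
  xget 0%N [set n | (exists2 p, walk x y p & size p = n) /\
                    (forall p, walk x y p -> (n <= size p)%N)].

Definition gball (R : realType) (x : T) (r : R) : set T :=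
  [set y | (gdist x y)%:R <= r].

Definition has_ray (x : T) : Prop :=
  exists g : nat -> T,
    [/\ g 0%N = x, injective g & forall n, e (g n) (g n.+1)].

(* The walk has to stay in [S]; its vertices are those of [x :: p]. *)
Definition joined_in (S : set T) (x y : T) : Prop :=
  exists2 p, walk x y p & forall z, z \in x :: p -> S z.

Definition is_component (S K : set T) : Prop :=
  exists2 x, S x & K = [set y | joined_in S x y].

End Graph.

Notation lattice d := 'rV[int]_d.

Definition adj (d : nat) : rel (lattice d) :=
  fun x y => \sum_(i < d) `|x ord0 i - y ord0 i| == 1.

Definition Zdist (d : nat) (x y : lattice d) : nat := gdist (@adj d) x y.

Definition Zball (R : realType) (d : nat) (x : lattice d) (r : R) :
  set (lattice d) := gball (@adj d) x r.

Definition edges (d : nat) : set (set (lattice d)) :=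
  [set e | exists x y, adj x y /\ e = [set x; y]].
Arguments edges d : clear implicits.

Lemma translate_edge (d : nat) (z : lattice d) (e : edges d) :
  [set y + z | y in val e] \in edges d.
Proof.
case: e => e /= /[!inE] -[x [y [xy ->]]].
exists (x + z), (y + z); split; last by rewrite image_setU !image_set1.
rewrite /adj; move: xy; congr (_ == _); apply: eq_bigr => i _.
by rewrite !mxE opprD addrACA subrr addr0.
Qed.

Definition edge_translate (d : nat) (z : lattice d) (e : edges d) : edges d :=
  exist (fun u => u \in edges d) _ (translate_edge z e).

Section Environment.
Variables (R : realType) (d : nat).

Definition conductances := edges d -> {nonneg R}.
HB.instance Definition _ := gen_eqMixin conductances.
HB.instance Definition _ := gen_choiceMixin conductances.
HB.instance Definition _ := isPointed.Build conductances (fun=> 0%:nng).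

Definition coordinate_events : set (set conductances) :=
  [set A | exists (e : edges d) (B : set R),
             measurable B /\ A = [set w | B (w e)%:num]].

Definition env : measurableType coordinate_events.-sigma :=
  g_sigma_algebraType coordinate_events.

Implicit Types (w : env) (x y z : lattice d).

(* [insub] yields the edge [{x, y}] if [x] and [y] are adjacent; otherwise the
   conductance is 0. *)
Definition conductance w x y : R :=
  if insub [set x; y] is Some e then (w (e : edges d))%:num else 0.

Definition env_shift z w : env := fun e => w (edge_translate z e).

Definition open_edge w : rel (lattice d) := fun x y => 0 < conductance w x y.

Definition cluster_of w x0 : set (lattice d) :=
  [set x | joined (open_edge w) x0 x].

Definition ray_set w : set (lattice d) := [set x | has_ray (open_edge w) x].

Definition vertex_weight w x : R :=
  \sum_(y \in [set y | adj x y]) conductance w x y.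

Definition cluster_vol w x0 x (r : R) : R :=
  \sum_(y \in Zball x r `&` cluster_of w x0) vertex_weight w y.

Definition transition w x y : R := conductance w x y / vertex_weight w x.

End Environment.

Section Chain.
Variables (R : realType) (d : nat).

Definition lattice_seq := nat -> lattice d.
HB.instance Definition _ := gen_eqMixin lattice_seq.
HB.instance Definition _ := gen_choiceMixin lattice_seq.
HB.instance Definition _ := isPointed.Build lattice_seq (fun=> 0).

(* As [lattice d] is countable, these events generate the product of the
   discrete sigma-algebras. *)
Definition trajectory_events : set (set lattice_seq) :=
  [set A | exists n x, A = [set X | X n = x]].

Definition trajectory : measurableType trajectory_events.-sigma :=
  g_sigma_algebraType trajectory_events.

(* [Q] is the law of the Markov chain with transition probability [P] started
   from [x]: P(X_0 = s_0, .., X_(n+1) = s_(n+1)) is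
   P(X_0 = s_0, .., X_n = s_n) times [P s_n s_(n+1)]. *)
Definition chain_law (P : lattice d -> lattice d -> R) (x : lattice d)
    (Q : probability trajectory R) : Prop :=
  Q [set X | X 0%N = x] = 1%E /\
  forall (n : nat) (s : nat -> lattice d),
    Q [set X | forall i, (i <= n.+1)%N -> X i = s i] =
    (Q [set X | forall i, (i <= n)%N -> X i = s i] * (P (s n) (s n.+1))%:E)%E.

(* [PX w x] stands for the law of the walk in [w] started from [x]. *)
Definition heat_kernel (PX : env R d -> lattice d -> probability trajectory R)
    (n : nat) (w : env R d) (x y : lattice d) : R :=
  fine (PX w x [set X | X n = y]) / vertex_weight w y.

End Chain.

(* Main.v *)
Require Import Defs.
From HB Require Import structures.
From mathcomp Require Import all_boot all_order all_algebra.
From mathcomp Require Import finmap.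
From mathcomp Require Import all_classical all_reals all_analysis.
From mathcomp Require Import measurable_realfun.
From mathcomp Require Import zify ring lra.

(** The environment may be taken homogeneous. The lower volume bound makes the cluster of [x0]
infinite; by stationarity all clusters are then infinite almost surely, and since there is only one
infinite component the whole lattice is a single cluster ([good_environments]). The summability
of the tails of [N] and the Borel-Cantelli lemma give [N y <= r] for all [y] within distance
[r ^ beta] of [x0], for all large [r] ([N_small_ae]). As [beta > 1], around [x0] the heat kernel
bounds are therefore available at all large scales, in each fixed environment from a set of full
measure.

The limits are constant. For a functional [Y] of the trajectory and a scale [s], the event
[eventually_le Y s a] says that [Y n / s n] has limit superior at most [a]. For the displacement,
and for the opposite of its running maximum, it does not change when a step is added at the start
of the trajectory, so its probability is a bounded harmonic function of the starting point. The
lower heat kernel bound makes two walks share a fixed mass at large times, whence bounded harmonic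
functions are constant ([bounded_harmonic_constant]); an invariant event of constant probability is
independent of itself, hence has probability 0 or 1 ([zero_one_of_constant]). The environments
where it has probability 1 form a translation invariant set, of probability 0 or 1 by ergodicity
([full_zero_one]), and the infimum of the levels [a] for which this is 1 is the limit superior
([limsup_constant]).

It remains to see that the constants are finite and positive, which takes four estimates in a fixed
environment. Summing the upper heat kernel bound over dyadic shells, and a reflection argument,
bound the probability of leaving a ball of radius [r] before time [n] by a stretched exponential in
[r / n ^ (1 / beta)] of exponent [gamma = beta / (beta - 1)] ([exit_bound]). At distances of order
[phi n = n ^ (1 / beta) * LL n ^ (1 - 1 / beta)] the exponent is of order [LL n], where [LL] is the
iterated logarithm, and along [n = 2 ^ j] the number [exp (- LL n)] is of order [1 / j]: above the
critical constant these probabilities are summable ([disp_limsup_le]). Below it, the matching lower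
bound ([far_lower_bound]) gives a conditional probability of order at least [1 / j] in each dyadic
block, so the event occurs infinitely often by a conditional form of the second Borel-Cantelli
lemma ([block_borel_cantelli], [disp_limsup_ge]). For the maximum, staying in a ball of radius [r]
for [n] steps has a probability exponential in [n / r ^ beta], from above because the walk has left
the ball after a multiple of [r ^ beta] steps with probability one half ([return_half]) and from
below because it returns near [x0] without leaving a larger ball with probability bounded below
([stay_return]). At [r] of order [psi n = n ^ (1 / beta) * LL n ^ (- 1 / beta)] the exponent is
again of order [LL n], and both Borel-Cantelli lemmas apply ([max_disp_liminf_ge],
[max_disp_liminf_le]). *)

Set Implicit Arguments.
Unset Strict Implicit.
Unset Printing Implicit Defensive.
Import Order.TTheory GRing.Theory Num.Theory.
Import numFieldNormedType.Exports.
Local Open Scope classical_set_scope.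
Local Open Scope ring_scope.


(** * Graph distance and rays *)

Section GraphDistance.
Context {T : choiceType} (e : rel T).
Implicit Types x y z : T.

Lemma joined_refl x : joined e x x.
Proof. by exists [::]. Qed.

Lemma joined_trans y x z : joined e x y -> joined e y z -> joined e x z.
Proof.
move=> [p [pp <-]] [q [qp <-]]; exists (p ++ q); split; last by rewrite last_cat.
by rewrite cat_path pp.
Qed.

Lemma joined_step x y z : joined e x y -> e y z -> joined e x z.
Proof.
by move=> xy yz; apply: joined_trans xy _; exists [:: z]; rewrite /walk /= yz.
Qed.

Lemma joined_sym x y : symmetric e -> joined e x y -> joined e y x.
Proof.
move=> se [p]; elim: p x => [|z p IH] x [/= pp yE].
  by rewrite -yE; exact: joined_refl.
case/andP: pp => xz pp; apply: (joined_step (IH z (conj pp yE))).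
by rewrite se.
Qed.

Lemma gdist_spec x y : joined e x y ->
  (exists2 p, walk e x y p & size p = gdist e x y) /\
  (forall p, walk e x y p -> (gdist e x y <= size p)%N).
Proof.
move=> [p0 p0P].
pose Q n := `[<exists2 p, walk e x y p & size p = n>].
have exQ : exists n, Q n by exists (size p0); apply/asboolP; exists p0.
rewrite /gdist; case: xgetP => [n _|none]; first exact.
exfalso; apply: (none (ex_minn exQ)); case: ex_minnP => n /asboolP nQ nmin; split=> // p pP.
by apply: nmin; apply/asboolP; exists p.
Qed.

Lemma gdist_le x y p : walk e x y p -> (gdist e x y <= size p)%N.
Proof. by move=> pP; have [_] := gdist_spec (ex_intro _ p pP); apply. Qed.

Lemma gdistxx x : gdist e x x = 0%N.
Proof. by apply/eqP; rewrite -leqn0; exact: (@gdist_le x x [::]). Qed.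

Lemma gdist_adj x y : e x y -> (gdist e x y <= 1)%N.
Proof. by move=> xy; apply: (@gdist_le x y [:: y]); rewrite /walk /= xy. Qed.

Lemma gdist_triangle y x z : joined e x y -> joined e y z ->
  (gdist e x z <= gdist e x y + gdist e y z)%N.
Proof.
move=> /gdist_spec[[p [pp <-] <-] _] /gdist_spec[[q [qp <-] <-] _].
by rewrite -size_cat; apply: gdist_le; rewrite /walk cat_path pp last_cat.
Qed.

Lemma gdist_sym x y : symmetric e -> joined e x y -> gdist e x y = gdist e y x.
Proof.
move=> se xy; have rw u v p : walk e u v p -> exists2 q, walk e v u q & size q = size p.
  elim: p u => [|z p IH] u [/= pp vE]; first by exists [::]; rewrite // -vE.
  case/andP: pp => uz /(fun H => conj H vE)/IH[q [qp qE] sq].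
  exists (rcons q u); last by rewrite size_rcons sq.
  by rewrite /walk rcons_path last_rcons qp qE se uz.
have yx := joined_sym se xy.
apply/eqP; rewrite eqn_leq; apply/andP; split.
  case: (gdist_spec yx) => -[p /rw[q qP sq] <-] _.
  by rewrite -sq; exact: gdist_le.
case: (gdist_spec xy) => -[p /rw[q qP sq] <-] _.
by rewrite -sq; exact: gdist_le.
Qed.

(** König's lemma along geodesics: a vertex is kept when infinitely many vertices
have a geodesic from [x] through it, and local finiteness always leaves a next
vertex, one step further from [x]. *)
Lemma ray_of_infinite x : (forall y, finite_set [set z | e y z]) ->
  infinite_set [set y | joined e x y] -> has_ray e x.
Proof.
move=> fin_nbr inf.
pose through v := [set y | joined e x v /\ joined e v y /\
  gdist e x y = (gdist e x v + gdist e v y)%N].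
pose good v := joined e x v /\ infinite_set (through v).
have next (v : T) : exists w, good v ->
    [/\ e v w, good w & gdist e x w = (gdist e x v).+1].
  have [gv|] := pselect (good v); last by exists v.
  case: gv => xv infv.
  pose nb := [set w | e v w /\ joined e x w /\ gdist e x w = (gdist e x v).+1].
  have fnb : finite_set nb by apply: sub_finite_set (fin_nbr v) => w [].
  have cover : through v `<=` [set v] `|` \bigcup_(w in nb) through w.
    move=> y [_ [vy dy]].
    case: (gdist_spec vy) => -[[|w p] [/= pp yE] sp] _; first by left.
    right; case/andP: pp => vw pp.
    have wy : joined e w y by exists p.
    have xw := joined_step xv vw.
    have lw : (gdist e x w <= gdist e x v + 1)%N.
      apply: leq_trans (gdist_triangle xv _) _; first by exists [:: w]; rewrite /walk /= vw.
      by rewrite leq_add2l gdist_adj.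
    have lp : (gdist e w y <= size p)%N by exact: gdist_le.
    have tr := gdist_triangle xw wy.
    by exists w; split=> //; [split=> //|split=> //]; lia.
  have : exists2 w, nb w & infinite_set (through w).
    apply: contrapT => /forall2NP nw; apply: infv.
    apply: sub_finite_set cover _; rewrite finite_setU; split=> //.
    apply: bigcup_finite => // w nbw.
    by case: (nw w) => // /contrapT.
  by case=> w [vw [xw dw]] infw; exists w.
have [f fP] := choice next.
pose g n := iter n f x.
have g0 : good x.
  split; first exact: joined_refl.
  move=> fx; apply: inf; apply: sub_finite_set fx => y xy.
  by split; [exact: joined_refl|rewrite gdistxx].
have gg n : good (g n) /\ gdist e x (g n) = n.
  elim: n => [|n [gn dn]]; first by rewrite gdistxx.
  by case: (fP _ gn) => _ ? ->; rewrite dn.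
exists g; split=> // [m n gmn|n].
  by rewrite -(gg m).2 gmn (gg n).2.
by case: (fP _ (gg n).1).
Qed.

End GraphDistance.

(** * Probabilities as real numbers *)

Section RealProbability.
Context {d0 : measure_display} {T : measurableType d0} {R : realType}.
Variable mu : probability T R.
Implicit Types A B : set T.

Definition pr A : R := fine (mu A).

Lemma prE A : measurable A -> mu A = (pr A)%:E.
Proof. by move=> mA; rewrite /pr fineK// fin_num_measure. Qed.

Lemma pr_ge0 A : 0 <= pr A.
Proof. by rewrite fine_ge0. Qed.

Lemma pr_le1 A : measurable A -> pr A <= 1.
Proof. by move=> mA; rewrite -lee_fin -prE// probability_le1. Qed.

Lemma prT : pr setT = 1.
Proof. by rewrite /pr probability_setT. Qed.

Lemma pr0 : pr set0 = 0.
Proof. by rewrite /pr measure0. Qed.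

Lemma pr_mono A B : measurable A -> measurable B -> A `<=` B -> pr A <= pr B.
Proof.
by move=> mA mB AB; rewrite -lee_fin -!prE// le_measure// inE.
Qed.

Lemma prC A : measurable A -> pr (~` A) = 1 - pr A.
Proof.
by move=> mA; rewrite /pr probability_setC// prE//.
Qed.

Lemma prU_le A B : measurable A -> measurable B -> pr (A `|` B) <= pr A + pr B.
Proof.
move=> mA mB; rewrite -lee_fin EFinD -!prE//; last exact: measurableU.
exact: measureU2.
Qed.

Lemma prU A B : measurable A -> measurable B -> A `&` B = set0 ->
  pr (A `|` B) = pr A + pr B.
Proof.
move=> mA mB AB; apply: EFin_inj; rewrite EFinD -!prE ?measureU//.
exact: measurableU.
Qed.

Lemma pr_split A B : measurable A -> measurable B ->
  pr A = pr (A `&` B) + pr (A `&` ~` B).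
Proof.
move=> mA mB; rewrite -prU; [|exact: measurableI|by apply: measurableI => //; exact: measurableC|].
  by rewrite -setIUr setUv setIT.
by rewrite setIACA setICr setI0.
Qed.

Lemma pr_eq1_ae A : measurable A -> pr A = 1 -> mu.-negligible (~` A).
Proof.
move=> mA A1; exists (~` A); split=> //; first exact: measurableC.
by rewrite prE ?prC ?A1 ?subrr//; exact: measurableC.
Qed.

Lemma pr_eq0_sub A B : measurable A -> measurable B -> A `<=` B -> pr B = 0 -> pr A = 0.
Proof.
by move=> mA mB AB B0; apply/eqP; rewrite eq_le pr_ge0 andbT -B0 pr_mono.
Qed.

Lemma pr_bigcap1 (F : nat -> set T) : (forall n, measurable (F n)) ->
  (forall n, pr (F n) = 1) -> pr (\bigcap_n F n) = 1.
Proof.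
move=> mF F1; have mI : measurable (\bigcap_n F n) by exact: bigcapT_measurable.
have /eqP : mu (~` \bigcap_n F n) = 0%E.
  rewrite setC_bigcap; apply/eqP; rewrite eq_le measure_ge0 andbT.
  apply: (@le_trans _ _ (\sum_(n <oo) mu (~` F n))%E).
    apply: (measure_sigma_subadditive _ _ _ (@subset_refl _ _)).
  - by move=> n; exact: measurableC.
  - by apply: bigcupT_measurable => n; exact: measurableC.
  rewrite eseries0// => n _ _; rewrite prE; last exact: measurableC.
  by rewrite prC// F1 subrr.
by rewrite prE ?prC//; [rewrite eqe subr_eq0 => /eqP <-|exact: measurableC].
Qed.

Lemma pr_bigcup0 (F : nat -> set T) : (forall n, measurable (F n)) ->
  (forall n, pr (F n) = 0) -> pr (\bigcup_n F n) = 0.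
Proof.
move=> mF F0; have := @pr_bigcap1 (fun n => ~` F n).
rewrite -setC_bigcup prC; last exact: bigcupT_measurable.
move=> H; suff : 1 - pr (\bigcup_n F n) = 1 by lra.
apply: H => n; first exact: measurableC.
by rewrite prC// F0 subr0.
Qed.

Lemma pr_setI1 A B : measurable A -> measurable B -> pr A = 1 -> pr B = 1 ->
  pr (A `&` B) = 1.
Proof.
move=> mA mB A1 B1; have := pr_split mA mB.
have : pr (A `&` ~` B) <= pr (~` B).
  by apply: pr_mono => //; [apply: measurableI => //|]; exact: measurableC.
have := pr_ge0 (A `&` ~` B).
by rewrite prC// B1; lra.
Qed.

Lemma pr_bigcup (F : nat -> set T) : (forall n, measurable (F n)) ->
  trivIset setT F -> (pr (\bigcup_n F n))%:E = (\sum_(n <oo) (pr (F n))%:E)%E.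
Proof.
move=> mF tF; rewrite -prE; last exact: bigcupT_measurable.
transitivity (\sum_(n <oo) mu (F n))%E; last by apply: eq_eseriesr => n _; exact: prE.
by apply: measure_semi_bigcup => //; exact: bigcupT_measurable.
Qed.

(** First Borel-Cantelli lemma, with a real majorant. *)
Lemma pr_borel_cantelli (F : nat -> set T) (u : nat -> R) :
  (forall n, measurable (F n)) -> (exists n0, forall n, (n0 <= n)%N -> pr (F n) <= u n) ->
  (forall n, 0 <= u n) -> cvgn (series u) ->
  pr [set x | exists n0, forall n, (n0 <= n)%N -> ~ F n x] = 1.
Proof.
move=> mF [n0 Fu] u0 cu.
pose F' n := if (n0 <= n)%N then F n else set0.
have mF' n : measurable (F' n) by rewrite /F'; case: ifP.
have mL : measurable (lim_sup_set F').
  by apply: bigcapT_measurable => n; exact: bigcup_measurable.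
have L0 : mu (lim_sup_set F') = 0%E.
  apply: lim_sup_set_cvg0 => //.
  apply: (@le_lt_trans _ _ (\sum_(n <oo) (u n)%:E)%E).
    have le_u n : (mu (F' n) <= (u n)%:E)%E.
      rewrite prE// lee_fin /F'.
      by case: ifP => [/Fu//|_]; rewrite pr0.
    by apply: lee_nneseries => n // _; exact: le_u.
  have -> : (\sum_(n <oo) (u n)%:E)%E = (limn (series u))%:E.
    rewrite -EFin_lim//; congr (limn _); apply/funext => n /=.
    by rewrite sumEFin.
  by rewrite ltry.
have <- : pr (~` lim_sup_set F') = 1 by rewrite prC// /pr L0 /= subr0.
congr pr; apply/seteqP; split => x /=.
  move=> [m mP]; apply/existsNP; exists (maxn n0 m); apply: contrapT.
  move=> /contrapT /(_ I) [k /=]; rewrite geq_max => /andP[n0k mk].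
  by rewrite /F' n0k => /(mP _ mk).
move=> /existsNP[m]; rewrite not_implyE => -[_ nex].
exists (maxn n0 m) => n; rewrite geq_max => /andP[n0n mn] Fn.
by apply: nex; exists n => //=; rewrite /F' n0n.
Qed.

End RealProbability.

(** * Events of trajectories *)

Section Trajectories.
Variable d : nat.
Local Notation L := (lattice d).
Local Notation Tr := (trajectory d).
Implicit Types (A B : set Tr) (X Y : Tr) (s : nat -> L).

Definition cylinder s n : set Tr := [set X | forall i, (i <= n)%N -> X i = s i].

Definition depends n A := forall X Y, (forall i, (i <= n)%N -> X i = Y i) -> A X -> A Y.

Lemma measurable_coord n (x : L) : measurable [set X : Tr | X n = x].
Proof. by apply: sub_sigma_algebra; exists n, x. Qed.

Lemma measurable_cylinder s n : measurable (cylinder s n).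
Proof.
have -> : cylinder s n = \bigcap_i (if (i <= n)%N then [set X : Tr | X i = s i] else setT).
  apply/seteqP; split => X /= H i.
    by move=> _; case: ifP => // /H.
  by move=> ilen; have := H i I; rewrite ilen.
apply: bigcapT_measurable => i; case: ifP => // _; exact: measurable_coord.
Qed.

(** The lattice is countable, so an event seen by time [n] is a countable union of
cylinders. *)
Lemma measurable_depends n A : depends n A -> measurable A.
Proof.
move=> dA.
pose f (s : seq L) : set Tr :=
  if `[< A (nth 0 s) >] then cylinder (nth 0 s) n else set0.
have -> : A = \bigcup_s f s.
  apply/seteqP; split => X.
    move=> AX; exists (mkseq X n.+1) => //.
    have E i : (i <= n)%N -> nth 0 (mkseq X n.+1) i = X i.
      by move=> ilen; rewrite nth_mkseq.
    rewrite /f; case: asboolP => [_|[]]; first by move=> i /E ->.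
    by apply: dA AX => i /E ->.
  move=> [s _]; rewrite /f; case: asboolP => // As Xs.
  by apply: dA As => i /Xs ->.
apply: countable_bigcupT_measurable => [|s]; first exact: countableP.
by rewrite /f; case: ifP => // _; exact: measurable_cylinder.
Qed.

Lemma dependsW m n A : (m <= n)%N -> depends m A -> depends n A.
Proof.
by move=> mn dA X Y XY; apply: dA => i im; apply: XY; exact: leq_trans im mn.
Qed.

Lemma depends_pred n (p : L -> Prop) : depends n [set X | p (X n)].
Proof. by move=> X Y XY /=; rewrite XY. Qed.

Lemma dependsI n A B : depends n A -> depends n B -> depends n (A `&` B).
Proof. by move=> dA dB X Y XY [AX BX]; split; [exact: dA AX|exact: dB BX]. Qed.

Lemma dependsC n A : depends n A -> depends n (~` A).
Proof.
by move=> dA X Y XY nA AY; apply: nA; apply: dA AY => i /XY ->.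
Qed.

(** The cylinders form a generating pi-system, so properties of laws which pass to complements
and to disjoint unions have to be checked on cylinders only. *)
Lemma trajectory_induction (P : set Tr -> Prop) :
  P setT -> P set0 -> (forall s n, P (cylinder s n)) ->
  (forall A, measurable A -> P A -> P (~` A)) ->
  (forall F : (set Tr)^nat, (forall n, measurable (F n)) -> trivIset [set: nat] F ->
     (forall n, P (F n)) -> P (\bigcup_k F k)) ->
  forall A, measurable A -> P A.
Proof.
move=> PT P0 Pcyl PC PU A mA.
pose G := [set B : set Tr | B = set0 \/ exists s n, B = cylinder s n].
have GE : @measurable _ Tr = <<s G >>.
  apply/seteqP; split.
    apply: smallest_sub; first exact: smallest_sigma_algebra.
    move=> _ [n [x ->]].
    pose f (s : seq L) : set Tr :=
      if nth 0 s n == x then cylinder (nth 0 s) n else set0.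
    have -> : [set X | X n = x] = \bigcup_s f s.
      apply/seteqP; split => X /=.
        move=> Xn; exists (mkseq X n.+1) => //; rewrite /f nth_mkseq// Xn eqxx.
        by move=> i ilen; rewrite nth_mkseq.
      by move=> [s _]; rewrite /f; case: eqP => // <-; apply.
    apply: (@countable_bigcupT_measurable _ (g_sigma_algebraType G)) => [|s].
      exact: countableP.
    apply: sub_sigma_algebra; rewrite /f; case: ifP => _; last by left.
    by right; exists (nth 0 s), n.
  apply: smallest_sub; first exact: (@sigma_algebra_measurable _ Tr).
  by move=> _ [->|[s [n ->]]]; [exact: measurable0|exact: measurable_cylinder].
have GI : setI_closed G.
  suff W s m t n : (m <= n)%N -> G (cylinder s m `&` cylinder t n).
    move=> U V [->|[s [m ->]]]; first by rewrite set0I; left.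
    move=> [->|[t [n ->]]]; first by rewrite setI0; left.
    by case: (leqP m n) => [/W//|/ltnW/W]; rewrite setIC.
  move=> mn; have [st|nst] := pselect (forall i, (i <= m)%N -> s i = t i).
    right; exists t, n; apply/seteqP; split => X /=; first by case.
    by move=> Xt; split=> // i im; rewrite st// Xt// (leq_trans im).
  left; apply/seteqP; split => X //= -[Xs Xt]; apply: nst => i im.
  by rewrite -Xs// Xt// (leq_trans im).
rewrite GE in mA.
apply: (dynkin_induction GE GI PT _ PC PU mA).
by move=> _ [->|[s [n ->]]].
Qed.

Definition tcons (x : L) X : Tr := fun n => if n is m.+1 then X m else x.

Definition tshift X : Tr := fun n => X n.+1.

Definition tmove (z : L) X : Tr := fun n => X n + z.

Lemma measurable_preimage_trajectory (T : Tr -> Tr) A :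
  (forall s n, measurable (T @^-1` cylinder s n)) -> measurable A -> measurable (T @^-1` A).
Proof.
move=> mT; move: A; apply: (trajectory_induction (P := fun A => measurable (T @^-1` A))) => //.
- by rewrite preimage_setT.
- by rewrite preimage_set0.
- by move=> A _ mA; rewrite preimage_setC; exact: measurableC.
- by move=> F _ _ mF; rewrite preimage_bigcup; exact: bigcupT_measurable.
Qed.

Lemma measurable_tcons x A : measurable A -> measurable (tcons x @^-1` A).
Proof.
apply: measurable_preimage_trajectory => s n; apply: (@measurable_depends n) => X Y XY /= H.
by case=> [|i] ilen /=; [exact: (H 0%N)|rewrite -XY ?(ltnW ilen)//; exact: (H i.+1)].
Qed.

Lemma measurable_tshift A : measurable A -> measurable (tshift @^-1` A).
Proof.
apply: measurable_preimage_trajectory => s n; apply: (@measurable_depends n.+1) => X Y XY /= H i.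
by move=> ilen; rewrite /tshift -XY//; exact: H.
Qed.

Lemma measurable_tmove z A : measurable A -> measurable (tmove z @^-1` A).
Proof.
apply: measurable_preimage_trajectory => s n; apply: (@measurable_depends n) => X Y XY /= H i.
by move=> ilen; rewrite /tmove -XY//; exact: H.
Qed.

Lemma measurable_iter_tshift m A : measurable A -> measurable (iter m tshift @^-1` A).
Proof.
elim: m => [//|m IH] in A *; move=> mA.
by apply: (IH (tshift @^-1` A)); exact: measurable_tshift.
Qed.

Lemma iter_tshiftE m X n : iter m tshift X n = X (n + m)%N.
Proof. by elim: m n => [|m IH] n; rewrite ?addn0//= /tshift IH addSnnS. Qed.

End Trajectories.

(** * Markov chains on the lattice *)

Section MarkovChain.
Context {R : realType} {d : nat}.
Local Notation L := (lattice d).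
Local Notation Tr := (trajectory d).
Variables (p : L -> L -> R) (Q : L -> probability Tr R) (nb : L -> {fset L}).
Hypothesis Q_law : forall x, chain_law p x (Q x).
Hypothesis p_ge0 : forall x y, 0 <= p x y.
Hypothesis p_out : forall x y, y \notin nb x -> p x y = 0.
Hypothesis p_sum : forall x, \sum_(y <- nb x) p x y = 1.
Implicit Types (x y z : L) (A B C : set Tr) (f g : L -> R) (S : set L).

Lemma pr_start x y : pr (Q x) [set X | X 0%N = y] = (x == y)%:R.
Proof.
have [xE _] := Q_law x; have mx z := measurable_coord (d := d) 0 z.
have x1 : pr (Q x) [set X | X 0%N = x] = 1 by rewrite /pr xE.
case: eqP => [<-//|xy]; apply: (@pr_eq0_sub _ _ _ _ _ (~` [set X : Tr | X 0%N = x])) => //.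
- exact: measurableC.
- by move=> X /= -> yx; apply: xy.
- by rewrite prC// x1 subrr.
Qed.

Lemma pr_start1 x : pr (Q x) [set X | X 0%N = x] = 1.
Proof. by rewrite pr_start eqxx. Qed.

Lemma pr_cylinder x s n :
  pr (Q x) (cylinder s n) = (x == s 0%N)%:R * \prod_(i < n) p (s i) (s i.+1).
Proof.
elim: n => [|n IH].
  rewrite big_ord0 mulr1 -pr_start; congr pr; apply/seteqP; split => X /=.
    by apply.
  by move=> X0 [|].
have [_ rec] := Q_law x; have := rec n s.
rewrite -/(cylinder s n.+1) -/(cylinder s n) big_ord_recr /= mulrA -IH.
rewrite [X in (_ = X * _)%E]prE; last exact: measurable_cylinder.
by rewrite -EFinM /pr => ->.
Qed.

(** On cylinders this is the product formula; both sides are probabilities in [A], so it extends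
to all events. *)
Lemma pr_first_step x A : measurable A ->
  pr (Q x) A = \sum_(y <- nb x) p x y * pr (Q y) (tcons x @^-1` A).
Proof.
move: A; apply: (trajectory_induction
  (P := fun A => pr (Q x) A = \sum_(y <- nb x) p x y * pr (Q y) (tcons x @^-1` A))).
- by rewrite prT preimage_setT -(p_sum x); apply: eq_bigr => y _; rewrite prT mulr1.
- by rewrite pr0 preimage_set0 big1 // => y _; rewrite [X in _ * X]pr0 mulr0.
- move=> s [|n].
    rewrite pr_cylinder big_ord0 mulr1; case: eqP => [xs|xs].
      rewrite -(p_sum x); apply: eq_bigr => y _.
      rewrite (_ : _ @^-1` _ = setT) ?prT ?mulr1//.
      by apply/seteqP; split => X //= _ [|].
    rewrite big1// => y _; rewrite (_ : _ @^-1` _ = set0) ?pr0 ?mulr0//.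
    by apply/seteqP; split => X //= /(_ 0%N isT).
  rewrite pr_cylinder; case: eqP => [xs|xs]; last first.
    rewrite mul0r big1// => y _; rewrite (_ : _ @^-1` _ = set0) ?pr0 ?mulr0//.
    by apply/seteqP; split => X //= /(_ 0%N isT).
  pose c := \prod_(i < n) p (s i.+1) (s i.+2).
  have E y : pr (Q y) (tcons x @^-1` cylinder s n.+1) = (y == s 1%N)%:R * c.
    rewrite -(pr_cylinder y (fun i => s i.+1)); congr pr; apply/seteqP; split => X /=.
      by move=> H i ilen; exact: (H i.+1).
    by move=> H [|i] ilen; [|exact: H].
  under [RHS]eq_bigr do rewrite E; rewrite mul1r.
  have -> : \prod_(i < n.+1) p (s i) (s i.+1) = p x (s 1%N) * c.
    by rewrite big_ord_recl xs.
  clearbody c.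
  have [sn|sn] := boolP (s 1%N \in nb x).
    rewrite (big_fsetD1 _ sn)/= eqxx mul1r big1_seq ?addr0// => y /=.
    by rewrite !inE => /andP[/negPf-> _]; rewrite mul0r mulr0.
  rewrite (p_out sn) mul0r big1_seq// => y /= yn; case: eqP => [ys|_].
    by rewrite -ys yn in sn.
  by rewrite mul0r mulr0.
- move=> A mA AE; rewrite prC// AE -[X in X - _](p_sum x) -sumrB.
  apply: eq_bigr => y _; rewrite preimage_setC prC ?mulrBr ?mulr1//.
  exact: measurable_tcons.
- move=> F mF tF FE; apply: EFin_inj; rewrite pr_bigcup//.
  have mF' n := measurable_tcons x (mF n).
  rewrite preimage_bigcup -sumEFin.
  transitivity (\sum_(y <- nb x) \sum_(n <oo)
      ((p x y)%:E * (pr (Q y) (tcons x @^-1` F n))%:E))%E; last first.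
    apply: eq_bigr => y _; rewrite EFinM pr_bigcup//.
      by rewrite nneseriesZl// => n _; rewrite lee_fin pr_ge0.
    by move=> i j _ _ [X [Fi Fj]]; apply: (tF i j) => //; exists (tcons x X).
  rewrite -nneseries_sum; last by move=> y n _; rewrite -EFinM lee_fin mulr_ge0 ?p_ge0 ?pr_ge0.
  apply: eq_eseriesr => n _; rewrite FE -sumEFin.
  by apply: eq_bigr => y _; rewrite EFinM.
Qed.

Definition step f x : R := \sum_(y <- nb x) p x y * f y.

Lemma le_step f g x : (forall y, y \in nb x -> f y <= g y) -> step f x <= step g x.
Proof.
move=> fg; rewrite /step !big_seq; apply: ler_sum => y /fg; exact: ler_wpM2l.
Qed.

Lemma eq_step f g x : f =1 g -> step f x = step g x.
Proof. by move=> fg; apply: eq_bigr => y _; rewrite fg. Qed.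

Lemma step_cst (c : R) x : step (fun=> c) x = c.
Proof. by rewrite /step -mulr_suml p_sum mul1r. Qed.

Lemma stepD f g x : step (fun y => f y + g y) x = step f x + step g x.
Proof. by rewrite /step -big_split; apply: eq_bigr => y _; rewrite mulrDr. Qed.

Lemma stepZ (c : R) f x : step (fun y => c * f y) x = c * step f x.
Proof. by rewrite /step mulr_sumr; apply: eq_bigr => y _; rewrite mulrCA. Qed.

Lemma step_sum (I : Type) (r : seq I) (F : I -> L -> R) x :
  step (fun y => \sum_(i <- r) F i y) x = \sum_(i <- r) step (F i) x.
Proof.
rewrite /step exchange_big; apply: eq_bigr => y _; by rewrite mulr_sumr.
Qed.

Lemma le_iter_step n f g : (forall y, f y <= g y) ->
  forall x, iter n step f x <= iter n step g x.
Proof. by move=> fg; elim: n => [//|n IH] x /=; apply: le_step => y _. Qed.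

Lemma eq_iter_step n f g : f =1 g -> iter n step f =1 iter n step g.
Proof. by move=> fg; elim: n => [//|n IH] x /=; apply: eq_step. Qed.

Lemma iter_step_sum n (I : Type) (r : seq I) (c : I -> R) (F : I -> L -> R) x :
  iter n step (fun y => \sum_(i <- r) c i * F i y) x =
  \sum_(i <- r) c i * iter n step (F i) x.
Proof.
elim: n x => [//|n IH] x /=; rewrite (eq_step _ IH) step_sum.
by apply: eq_bigr => i _; rewrite stepZ.
Qed.

Lemma iter_step_fix n f : (forall x, step f x = f x) ->
  forall x, iter n step f x = f x.
Proof.
by move=> ff; elim: n => [//|n IH] x /=; rewrite (eq_step _ IH) ff.
Qed.

Definition ind S x : R := `[< S x >]%:R.

Lemma ind_ge0 S x : 0 <= ind S x.
Proof. by rewrite /ind ler0n. Qed.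

Lemma ind_le1 S x : ind S x <= 1.
Proof. by rewrite /ind lern1 leq_b1. Qed.

Lemma indT S x : S x -> ind S x = 1.
Proof. by rewrite /ind => /asboolT ->. Qed.

Lemma indF S x : ~ S x -> ind S x = 0.
Proof. by rewrite /ind => /asboolF ->. Qed.

Definition at_time n S : set Tr := [set X | S (X n)].

Lemma depends_at_time n S : depends n (at_time n S).
Proof. exact: depends_pred. Qed.

Lemma measurable_at_time n S : measurable (at_time n S).
Proof. by apply: measurable_depends (@depends_at_time n S). Qed.

Lemma pr_at_time n S x : pr (Q x) (at_time n S) = iter n step (ind S) x.
Proof.
elim: n x => [|n IH] x /=.
  have [Sx|nSx] := pselect (S x).
    rewrite indT//; apply/eqP; rewrite eq_le pr_le1 /=; last exact: measurable_at_time.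
    rewrite -[X in X <= _](pr_start1 x).
    by apply: pr_mono; [exact: measurable_coord|exact: measurable_at_time|move=> X /= X0; rewrite /at_time /= X0].
  rewrite indF//; apply: (@pr_eq0_sub _ _ _ _ _ (~` [set X : Tr | X 0%N = x])).
  - exact: measurable_at_time.
  - by apply: measurableC; exact: measurable_coord.
  - by move=> X /= SX X0; apply: nSx; rewrite -X0.
  - by rewrite prC ?pr_start ?eqxx ?subrr//; exact: measurable_coord.
rewrite pr_first_step; last exact: measurable_at_time.
by apply: eq_bigr => y _; rewrite -IH.
Qed.

(** Markov property at time [m], as a bound over the states reached: no conditional probability
is needed, and the proof is an induction on [m] by the first step. *)
Lemma markov_le m S C A (M : R) x : 0 <= M -> depends m C -> C `<=` at_time m S ->
  measurable A -> (forall y, S y -> pr (Q y) A <= M) ->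
  pr (Q x) (C `&` iter m (@tshift d) @^-1` A) <= pr (Q x) C * M.
Proof.
move=> M0 dC CS mA AM; elim: m => [|m IH] in C x dC CS *.
  have mC := measurable_depends dC.
  have [[X [CX X0]]|nC] := pselect (exists X, C X /\ X 0%N = x).
    have C1 : pr (Q x) C = 1.
      apply/eqP; rewrite eq_le pr_le1//= -[X in X <= _](pr_start1 x).
      apply: pr_mono => //; first exact: measurable_coord.
      by move=> Y /= Y0; apply: dC CX => -[|//] _; rewrite X0.
    rewrite C1 mul1r; apply: le_trans (AM x _); last by rewrite -X0; exact: CS.
    by apply: pr_mono => //; exact: measurableI.
  rewrite (@pr_eq0_sub _ _ _ _ _ (~` [set X : Tr | X 0%N = x])) ?mulr_ge0 ?pr_ge0//.
  - exact: measurableI.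
  - by apply: measurableC; exact: measurable_coord.
  - by move=> X [CX _] X0; apply: nC; exists X.
  - by rewrite prC ?pr_start ?eqxx ?subrr//; exact: measurable_coord.
have mC := measurable_depends dC.
have mT := measurable_iter_tshift m.+1 mA.
rewrite !pr_first_step//; last exact: measurableI.
rewrite mulr_suml; apply: ler_sum => y _; rewrite -mulrA ler_wpM2l//.
have := IH (tcons x @^-1` C) y; rewrite preimage_setI.
have -> : tcons x @^-1` (iter m.+1 (@tshift d) @^-1` A) = iter m (@tshift d) @^-1` A.
  by apply/seteqP; split => X /=; rewrite -iterS iterSr.
apply; last by move=> X /CS.
move=> X Y XY; apply: dC => -[//|i] im; exact: XY.
Qed.

Lemma markov_ge m S C A (M : R) x : M <= 1 -> depends m C -> C `<=` at_time m S ->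
  measurable A -> (forall y, S y -> M <= pr (Q y) A) ->
  pr (Q x) C * M <= pr (Q x) (C `&` iter m (@tshift d) @^-1` A).
Proof.
move=> M1 dC CS mA AM; have mC := measurable_depends dC.
have mT := measurable_iter_tshift m mA.
have := @markov_le m S C (~` A) (1 - M) x.
rewrite (pr_split (Q x) mC mT) preimage_setC => H.
suff : pr (Q x) (C `&` ~` (iter m (tshift (d:=d)) @^-1` A)) <=
  (pr (Q x) (C `&` iter m (tshift (d:=d)) @^-1` A) +
   pr (Q x) (C `&` ~` (iter m (tshift (d:=d)) @^-1` A))) * (1 - M).
  have := pr_ge0 (Q x) (C `&` iter m (tshift (d:=d)) @^-1` A).
  have := pr_ge0 (Q x) (C `&` ~` (iter m (tshift (d:=d)) @^-1` A)).
  move: M1; clear; nra.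
apply: H => //; first by lra.
  exact: measurableC.
by move=> y /AM My; rewrite prC//; lra.
Qed.

(** An invariant event whose probability does not depend on the starting point is independent of
the first steps of the walk, hence of every event, hence of itself. *)
Lemma zero_one_of_constant A (c : R) : measurable A ->
  (forall x X, A (tcons x X) <-> A X) -> (forall x, pr (Q x) A = c) -> c = 0 \/ c = 1.
Proof.
move=> mA invA cA.
have indep_dep n B : depends n B -> forall x, pr (Q x) (A `&` B) = c * pr (Q x) B.
  elim: n B => [|n IH] B dB x; have mB := measurable_depends dB.
    rewrite !pr_first_step//; last exact: measurableI.
    rewrite mulr_sumr; apply: eq_bigr => y _; rewrite mulrCA; congr (_ * _).
    rewrite preimage_setI (_ : tcons x @^-1` A = A); last first.
      by apply/seteqP; split => X /=; rewrite invA.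
    have [[X BX]|nB] := pselect (exists X, B (tcons x X)).
      rewrite (_ : tcons x @^-1` B = setT) ?setIT ?prT ?mulr1//.
      by apply/seteqP; split => Y //= _; apply: dB BX => -[|].
    rewrite (_ : tcons x @^-1` B = set0) ?setI0 ?pr0 ?mulr0//.
    by apply/seteqP; split => Y //= BY; apply: nB; exists Y.
  rewrite !pr_first_step//; last exact: measurableI.
  rewrite mulr_sumr; apply: eq_bigr => y _; rewrite mulrCA; congr (_ * _).
  rewrite preimage_setI (_ : tcons x @^-1` A = A); last first.
    by apply/seteqP; split => X /=; rewrite invA.
  by apply: IH => X Y XY; apply: dB => -[//|i]; exact: XY.
have indep B : measurable B -> pr (Q 0) (A `&` B) = c * pr (Q 0) B.
  move: B; apply: (trajectory_induction
    (P := fun B => pr (Q 0) (A `&` B) = c * pr (Q 0) B)).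
  - by rewrite setIT prT mulr1 cA.
  - by rewrite setI0 pr0 mulr0.
  - move=> s n; apply: (indep_dep n) => X Y XY H i ilen.
    by rewrite -XY//; exact: H.
  - move=> B mB BE; have := pr_split (Q 0) mA mB.
    by rewrite [in X in _ -> X]prC// cA BE; lra.
  - move=> F mF tF FE; have mU : measurable (\bigcup_k F k) by exact: bigcupT_measurable.
    apply: EFin_inj; rewrite EFinM setI_bigcupr !pr_bigcup//.
    + rewrite -nneseriesZl; last by move=> n _; rewrite lee_fin pr_ge0.
      by apply: eq_eseriesr => n _; rewrite FE EFinM.
    + by move=> n; exact: measurableI.
    + by move=> i j _ _ [X [[_ Fi] [_ Fj]]]; apply: (tF i j) => //; exists X.
have := indep A mA; rewrite setIid cA => cc.
have /eqP : c * (c - 1) = 0 by rewrite mulrBr -cc mulr1 subrr.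
by rewrite mulf_eq0 subr_eq0 => /orP[/eqP|/eqP]; [left|right].
Qed.

End MarkovChain.

(** * Real analysis *)

Section RealLemmas.
Context {R : realType}.
Implicit Types a b x y r : R.

Lemma le_powR r a b : 0 <= r -> 0 <= a -> a <= b -> a `^ r <= b `^ r.
Proof.
by move=> r0 a0 ab; apply: ge0_ler_powR => //; rewrite nnegrE// (le_trans a0).
Qed.

Lemma powRVK r a : 0 < r -> 0 <= a -> (a `^ r) `^ r^-1 = a.
Proof. by move=> r0 a0; rewrite -powRrM divff ?powRr1// gt_eqF. Qed.

Lemma powRKV r a : 0 < r -> 0 <= a -> (a `^ r^-1) `^ r = a.
Proof. by move=> r0 a0; rewrite -powRrM mulVf ?powRr1// gt_eqF. Qed.

Lemma powR_large a (M : R) : 0 < a -> exists n0 : nat, forall x, n0%:R <= x -> M <= x `^ a.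
Proof.
move=> a0; exists (Num.truncn (`|M| `^ a^-1)).+1 => x nx.
have M0 : 0 <= `|M| `^ a^-1 by exact: powR_ge0.
apply: le_trans (ler_norm M) _; rewrite -[leLHS](powRKV a0)//.
apply: le_powR => //; first exact: ltW.
by apply: le_trans nx; rewrite ltW// truncnS_gt.
Qed.

Lemma le_expRN_powR (c g a b : R) : 0 <= c -> 0 <= g -> 0 <= a -> a <= b ->
  expR (- c * b `^ g) <= expR (- c * a `^ g).
Proof.
by move=> c0 g0 a0 ab; rewrite ler_expR !mulNr lerN2 ler_wpM2l// le_powR.
Qed.

Lemma ln_le_sub1 x : 0 < x -> ln x <= x - 1.
Proof.
move=> x0; have := expR_ge1Dx (ln x); rewrite lnK ?posrE//; lra.
Qed.

(** Exponentials beat powers, with an explicit constant: take logarithms and apply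
[ln v <= v - 1] to [v = c * u / a]. *)
Lemma powR_le_expR a (c : R) : 0 < a -> 0 < c ->
  exists2 K : R, 0 < K & forall u, 1 <= u -> u `^ a <= K * expR (c * u).
Proof.
move=> a0 c0; exists (expR (- (a * ln (c / a)))); first exact: expR_gt0.
move=> u u1; have u0 : 0 < u by lra.
rewrite -expRD /powR gt_eqF// ler_expR.
have ca0 : 0 < c / a by rewrite divr_gt0.
have := ln_le_sub1 (mulr_gt0 ca0 u0); rewrite (lnM (_ : c / a \is Num.pos) (_ : u \is Num.pos)) ?posrE// => H.
have {}H : a * ln u <= a * (c / a * u - 1 - ln (c / a)).
  by rewrite ler_wpM2l//; [exact: ltW|lra].
apply: le_trans H _; rewrite !mulrBr mulr1.
have -> : a * (c / a * u) = c * u by field; rewrite gt_eqF.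
by lra.
Qed.

Lemma exists_inv_le x : 0 < x -> exists k : nat, k.+1%:R^-1 <= x.
Proof.
move=> x0; exists (Num.truncn x^-1); rewrite -[leRHS]invrK lef_pV2 ?posrE ?invr_gt0 ?ltr0n//.
by rewrite ltW// truncnS_gt.
Qed.

Lemma sum_geometric_le x J : 0 <= x -> x < 1 ->
  \sum_(0 <= j < J) x ^+ j <= (1 - x)^-1.
Proof.
move=> x0 x1; rewrite -[leRHS]mul1r ler_pdivlMr ?subr_gt0//.
elim: J => [|J IH]; first by rewrite big_geq// mul0r.
have E K : (\sum_(0 <= j < K) x ^+ j) * (1 - x) = 1 - x ^+ K.
  elim: K => [|K IHK]; first by rewrite big_geq// mul0r expr0 subrr.
  by rewrite big_nat_recr//= mulrDl IHK exprS; ring.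
by rewrite E gerBl exprn_ge0.
Qed.

End RealLemmas.


Section IteratedLogarithm.
Context {R : realType}.
Implicit Types a c x y : R.

Lemma ln2_ge : 2^-1 <= ln 2 :> R.
Proof.
have := ln_le_sub1 (x := 2^-1 : R); rewrite lnV ?posrE// => H.
have {}H := H ltac:(by []); lra.
Qed.

Lemma ln2_le1 : ln 2 <= 1 :> R.
Proof. by have := ln_le_sub1 (x := 2 : R) ltac:(by []); lra. Qed.

Lemma ln_le_id x : 0 < x -> ln x <= x.
Proof. by move=> /ln_le_sub1; lra. Qed.

Definition LL n : R := ln (ln n%:R).

Lemma near_comp (P : nat -> Prop) (f : nat -> nat) : (forall j, (j <= f j)%N) ->
  (\forall n \near \oo, P n) -> \forall j \near \oo, P (f j).
Proof. by move=> fj [n0 _ H]; exists n0 => // j /= n0j; apply: H; exact: leq_trans (fj j). Qed.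

Lemma near_ler_nat x : \forall n \near \oo, x <= n%:R :> R.
Proof. exact: nbhs_infty_ger. Qed.

Lemma near_powR_ge a x : 0 < a -> \forall n \near \oo, x <= n%:R `^ a.
Proof.
move=> a0; have [n0 H] := powR_large x a0; exists n0 => // n /= n0n.
by apply: H; rewrite ler_nat.
Qed.

Lemma near_ln_ge x : \forall n \near \oo, x <= ln n%:R.
Proof.
near=> n; rewrite -[leLHS]expRK ler_ln ?posrE ?expR_gt0//; last first.
  by apply: lt_le_trans (expR_gt0 x) _; near: n; exact: near_ler_nat.
by near: n; exact: near_ler_nat.
Unshelve. all: by end_near. Qed.

Lemma near_LL_ge x : \forall n \near \oo, x <= LL n.
Proof.
near=> n; have : expR x <= ln n%:R by near: n; exact: near_ln_ge.
move=> H; rewrite /LL -[leLHS]expRK ler_ln ?posrE ?expR_gt0//.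
by apply: lt_le_trans H; exact: expR_gt0.
Unshelve. all: by end_near. Qed.

Lemma LL_mono m n : (2 <= m)%N -> (m <= n)%N -> LL m <= LL n.
Proof.
move=> m2 mn; have m0 : 0 < m%:R :> R by rewrite ltr0n; exact: leq_trans m2.
have lm : 0 < ln m%:R :> R by rewrite ln_gt0// ltr1n.
have lmn : ln m%:R <= ln n%:R :> R.
  by rewrite ler_ln ?posrE ?ler_nat// (lt_le_trans m0) ?ler_nat.
by rewrite /LL ler_ln ?posrE// (lt_le_trans lm).
Qed.

Lemma near_powR_le_expR a c x : 0 < a -> 0 < c -> 0 < x ->
  exists n0 : nat, forall u, n0%:R <= u -> u `^ a <= x * expR (c * u).
Proof.
move=> a0 c0 x0; have a1 : 0 < a + 1 by lra.
have [K K0 KP] := powR_le_expR a1 c0.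
exists (Num.truncn (K / x)).+2 => u nu.
have Kx : 0 <= K / x by rewrite divr_ge0 // ltW.
have Ku : K / x <= u.
  apply: le_trans nu; apply: ltW; apply: lt_trans (truncnS_gt _) _.
  by rewrite ltr_nat.
have u1 : 1 <= u by apply: le_trans nu; rewrite ler1n.
have u0 : 0 < u by lra.
have := KP _ u1; rewrite powRD ?(gt_eqF u0) ?implybT// powRr1 ?(ltW u0)// => H.
suff : u `^ a * u <= x * expR (c * u) * u by rewrite ler_pM2r.
apply: le_trans H _; rewrite mulrAC ler_wpM2r ?expR_ge0//.
by rewrite mulrC -ler_pdivrMr.
Qed.

Lemma near_LL_le_powR (M a : R) : 0 < M -> 0 < a -> \forall n \near \oo, M * LL n <= n%:R `^ a.
Proof.
move=> M0 a0; have MV : 0 < M^-1 by rewrite invr_gt0.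
have [n0 H] := near_powR_le_expR ltr01 a0 MV.
near=> n; have n1 : 0 < n%:R :> R by near: n; exact: nbhs_infty_gtr.
have ln0 : n0%:R <= ln n%:R :> R by near: n; exact: near_ln_ge.
have ln1 : 1 <= ln n%:R :> R by near: n; exact: near_ln_ge.
have := H _ ln0; rewrite powRr1; last by lra.
rewrite ler_pdivlMl// /powR gt_eqF//; apply: le_trans.
by rewrite ler_wpM2l ?(ltW M0)// /LL ln_le_id//; lra.
Unshelve. all: by end_near. Qed.

Lemma ln_exp2 j : ln (2 ^ j)%:R = j%:R * ln 2 :> R.
Proof. by rewrite natrX lnXn// mulr_natl. Qed.

(** Of the order of [1 / j ^ 2], but with a telescoping series. *)
Definition inv_sq (j : nat) : R := (j.+1%:R * j.+2%:R)^-1.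

Lemma inv_sq_ge0 j : 0 <= inv_sq j.
Proof. by rewrite invr_ge0 mulr_ge0. Qed.

Lemma cvg_series_inv_sq (M : R) : 0 <= M -> cvgn (series (fun j => M * inv_sq j)).
Proof.
move=> M0; apply: nondecreasing_is_cvgn.
  apply/nondecreasing_seqP => n; rewrite /series /= big_nat_recr//= lerDl.
  by rewrite mulr_ge0 ?inv_sq_ge0.
exists M => _ [n _ <-]; rewrite /series /= -mulr_sumr ler_piMr//.
have -> : \sum_(0 <= j < n) inv_sq j = 1 - n.+1%:R^-1.
  elim: n => [|n IH]; first by rewrite big_geq// invr1 subrr.
  rewrite big_nat_recr//= IH /inv_sq -!natr1; field.
  have : 0 <= n%:R :> R by [].
  by move=> n0; rewrite !gt_eqF//; lra.
by rewrite gerBl invr_ge0.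
Qed.

Lemma expRN_LL n : 1 < n%:R :> R -> expR (- LL n) = (ln n%:R)^-1.
Proof. by move=> n1; rewrite /LL expRN lnK// posrE ln_gt0. Qed.

(** Along the powers of two, [exp (- LL)] is of order [1 / j], so that twice the exponent is
summable; this is where the iterated logarithm comes from. *)
Lemma expR_LL_exp2 j : (0 < j)%N -> expR (- (2 * LL (2 ^ j))) <= 24 * inv_sq j.
Proof.
move=> j0; have j1 : 1 <= j%:R :> R by rewrite ler1n.
have -> : - (2 * LL (2 ^ j)) = - LL (2 ^ j) + - LL (2 ^ j) by ring.
have n1 : 1 < (2 ^ j)%:R :> R by rewrite ltr1n -{1}(expn0 2) ltn_exp2l.
rewrite expRD expRN_LL// ln_exp2.
have H : 0 < j%:R * 2^-1 :> R by lra.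
have H2 : (j%:R * ln 2)^-1 <= (j%:R * 2^-1)^-1 :> R.
  rewrite lef_pV2 ?posrE ?mulr_gt0 ?ln_gt0 ?ltr1n//; try lra.
  by rewrite ler_wpM2l// ln2_ge.
have H3 : 0 <= (j%:R * ln 2)^-1 :> R.
  by rewrite invr_ge0 mulr_ge0// ltW// ln_gt0// ltr1n.
apply: le_trans (ler_pM H3 H3 H2 H2) _.
rewrite /inv_sq -invfM -[24]invrK -invfM lef_pV2 ?posrE; last 2 first.
- by rewrite mulr_gt0.
- by rewrite mulr_gt0// invr_gt0.
rewrite -[j.+2%:R]natr1 -[j.+1%:R]natr1; move: j1; clear; set x := j%:R => x1.
have : 1 * x <= x * x by rewrite ler_wpM2r//; lra.
lra.
Qed.

End IteratedLogarithm.

(** * Borel-Cantelli along blocks of a Markov chain *)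

Section BlockBorelCantelli.
Context {R : realType} {d : nat}.
Local Notation L := (lattice d).
Local Notation Tr := (trajectory d).
Variables (p : L -> L -> R) (Q : L -> probability Tr R) (nb : L -> {fset L}).
Hypothesis Q_law : forall x, chain_law p x (Q x).
Hypothesis p_ge0 : forall x y, 0 <= p x y.
Hypothesis p_out : forall x y, y \notin nb x -> p x y = 0.
Hypothesis p_sum : forall x, \sum_(y <- nb x) p x y = 1.
Implicit Types (x y : L) (A B : set Tr) (S : set L).

Lemma measurable_eventually (d0 : measure_display) (T : measurableType d0)
    (F : nat -> set T) : (forall n, measurable (F n)) ->
  measurable [set x | exists n0, forall n, (n0 <= n)%N -> F n x].
Proof.
move=> mF; rewrite (_ : [set _ | _] = \bigcup_n0 \bigcap_(n in [set n | (n0 <= n)%N]) F n).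
  by apply: bigcupT_measurable => n0; apply: bigcap_measurable => //; exists n0 => /=.
by apply/seteqP; split => x /= [n0]; [move=> H; exists n0|move=> _ H; exists n0].
Qed.

Lemma pr_eq_start x A B : measurable A -> measurable B ->
  (forall X : Tr, X 0%N = x -> A X <-> B X) -> pr (Q x) A = pr (Q x) B.
Proof.
move=> mA mB AB.
have le U V : measurable U -> measurable V -> (forall X : Tr, X 0%N = x -> U X -> V X) ->
    pr (Q x) U <= pr (Q x) V.
  move=> mU mV UV; have ms := @measurable_coord d 0 x.
  have s1 : pr (Q x) (~` [set X | X 0%N = x]) = 0.
    by rewrite prC// (pr_start1 Q_law) subrr.
  have z : pr (Q x) (U `&` ~` [set X | X 0%N = x]) = 0.
    apply: pr_eq0_sub s1; last exact: subIsetr.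
      by apply: measurableI => //; exact: measurableC.
    exact: measurableC.
  rewrite (pr_split _ mU ms) z addr0; apply: pr_mono => //.
    exact: measurableI.
  by move=> X [/= UX X0]; exact: UV.
by apply/eqP; rewrite eq_le !le// => X X0; have [] := AB X X0.
Qed.

Lemma pr_tshift_le m A (M : R) x : 0 <= M -> measurable A ->
  (forall y, pr (Q y) A <= M) -> pr (Q x) (iter m (@tshift d) @^-1` A) <= M.
Proof.
move=> M0 mA AM.
have dT : depends m [set: Tr] by [].
have := @markov_le _ _ _ _ _ Q_law p_ge0 p_out p_sum m setT setT A M x M0 dT.
by rewrite prT mul1r setTI; apply.
Qed.

Lemma measurable_block_failures (t : nat -> nat) (G : nat -> set L) (E : nat -> set Tr) :
  (forall j, measurable (E j)) ->
  measurable [set X : Tr | exists J, forall j, (J <= j)%N ->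
    G j (X (t j)) /\ ~ E j (iter (t j) (@tshift d) X)].
Proof.
move=> mE; apply: (@measurable_eventually _ _ (fun j => at_time (t j) (G j) `&`
    ~` (iter (t j) (@tshift d) @^-1` E j))) => j.
apply: measurableI; first exact: measurable_at_time.
by apply: measurableC; exact: measurable_iter_tshift.
Qed.

(** Second Borel-Cantelli lemma, without independence: if at time [t j] the chain has
conditional probability at least [a / (j + 1)] of realising [E j] before time [t (j + 1)],
whenever it is in [G j], then it cannot stay in the sets [G j] and eventually avoid the
[E j]. The failures up to index [j + k] have probability at most [((j + 1) / (j + k + 1)) ^ a],
as [1 - a / (j + 1) <= ((j + 1) / (j + 2)) ^ a]. *)
Lemma block_borel_cantelli (t : nat -> nat) (G : nat -> set L) (E : nat -> set Tr) (a : R) :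
  (forall j, (t j <= t j.+1)%N) -> (forall j, depends (t j.+1 - t j) (E j)) ->
  0 < a -> a <= 1 ->
  (\forall j \near \oo, forall y, G j y -> a / j.+1%:R <= pr (Q y) (E j)) ->
  forall x, pr (Q x) [set X : Tr | exists J, forall j, (J <= j)%N ->
    G j (X (t j)) /\ ~ E j (iter (t j) (@tshift d) X)] = 0.
Proof.
move=> tS dE a0 a1 [J0 _ HE] x.
pose m j := (t j.+1 - t j)%N.
pose Bad j : set Tr := at_time 0 (G j) `&` ~` E j.
have dBad j : depends (m j) (Bad j).
  by apply: dependsI; [exact: dependsW (leq0n _) (@depends_at_time d 0 (G j))|exact: dependsC (dE j)].
have mBad j : measurable (Bad j) by exact: measurable_depends (dBad j).
(* [chain k j] holds for [X] when the [k] blocks from the [j]-th on are all bad, the trajectory [X]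
starting with the [j]-th. *)
pose chain := fix chain (k j : nat) : set Tr :=
  if k is k'.+1 then Bad j `&` iter (m j) (@tshift d) @^-1` chain k' j.+1 else setT.
have mchain k j : measurable (chain k j).
  elim: k j => [|k IH] j; first exact: measurableT.
  exact: (measurableI _ _ (mBad j) (measurable_iter_tshift (m j) (IH j.+1))).
pose M j k : R := j.+1%:R `^ a / (j + k).+1%:R `^ a.
have M0 j k : 0 <= M j k by rewrite divr_ge0 ?powR_ge0.
have le_chain k j y : (J0 <= j)%N -> pr (Q y) (chain k j) <= M j k.
  elim: k j y => [|k IH] j y J0j /=.
    by rewrite prT /M addn0 divff// gt_eqF// powR_gt0// ltr0n.
  have H := @markov_le _ _ _ _ _ Q_law p_ge0 p_out p_sum (m j) setT (Bad j) (chain k j.+1) (M j.+1 k) y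
      (M0 _ _) (dBad j) (fun _ _ => I) (mchain _ _) (fun y _ => IH j.+1 y (leqW J0j)).
  apply: le_trans H _.
  have j0 : 0 < j.+1%:R :> R by rewrite ltr0n.
  have bad_le : pr (Q y) (Bad j) <= 1 - a / j.+1%:R.
    have [Gy|nGy] := pselect (G j y).
      have mE : measurable (E j) by exact: measurable_depends (dE j).
      have : pr (Q y) (Bad j) <= pr (Q y) (~` E j).
        by apply: pr_mono => //; [exact: measurableC|exact: subIsetr].
      rewrite prC// => /le_trans; apply; rewrite lerD2l lerN2.
      exact: (HE j J0j y Gy).
    have -> : pr (Q y) (Bad j) = pr (Q y) set0.
      by apply: pr_eq_start => // X X0; split=> // -[]; rewrite /at_time /= X0.
    rewrite pr0 subr_ge0 ler_pdivrMr// mul1r (le_trans a1)// ler1n.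
    by [].
  apply: le_trans (ler_wpM2r (M0 _ _) bad_le) _.
  rewrite /M addSnnS mulrA ler_pM2r; last by rewrite invr_gt0 powR_gt0// ltr0n.
  have j2 : j.+2%:R = j.+1%:R * (1 + j.+1%:R^-1) :> R.
    by rewrite -natr1 mulrDr mulr1 divff// gt_eqF.
  have jV : 0 < 1 + j.+1%:R^-1 :> R by rewrite addr_gt0// invr_gt0.
  rewrite j2 powRM ?(ltW j0) ?(ltW jV)// mulrCA ler_piMr ?powR_ge0//.
  have le_exp : (1 + j.+1%:R^-1) `^ a <= expR (a / j.+1%:R).
    rewrite /powR (gt_eqF jV) ler_expR ler_wpM2l ?(ltW a0)//.
    by apply: le_trans (ln_le_sub1 jV) _; rewrite addrAC subrr add0r.
  have le_expN : 1 - a / j.+1%:R <= expR (- (a / j.+1%:R)).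
    by have := expR_ge1Dx (- (a / j.+1%:R)).
  apply: (@le_trans _ _ (expR (- (a / j.+1%:R)) * expR (a / j.+1%:R))).
    apply: le_trans (ler_wpM2r (powR_ge0 _ _) le_expN) _.
    by rewrite ler_wpM2l ?expR_ge0.
  by rewrite -expRD addNr expR0.
pose V J : set Tr := [set X | forall j, (J <= j)%N ->
    G j (X (t j)) /\ ~ E j (iter (t j) (@tshift d) X)].
have EV j : measurable (at_time (t j) (G j) `&` ~` (iter (t j) (@tshift d) @^-1` E j) : set Tr).
  apply: measurableI; first exact: measurable_at_time.
  apply: measurableC; apply: measurable_iter_tshift.
  exact: measurable_depends (dE j).
have mV J : measurable (V J).
  rewrite (_ : V J = \bigcap_(j in [set j | (J <= j)%N])
     (at_time (t j) (G j) `&` ~` (iter (t j) (@tshift d) @^-1` E j))).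
    by apply: bigcap_measurable => //; exists J => /=.
  by apply/seteqP; split => X /= H j /H.
rewrite (_ : [set _ | _] = \bigcup_J V (J + J0)%N); last first.
  apply/seteqP; split => X /= [J]; last by move=> _ H; exists (J + J0)%N.
  by move=> H; exists J => // j JJ; apply: H; exact: leq_trans (leq_addr _ _) JJ.
apply: pr_bigcup0 => // J; set K := (J + J0)%N.
have V_sub k j (X : Tr) : (K <= j)%N -> V K X -> chain k j (iter (t j) (@tshift d) X).
  elim: k j => [//|k IH] j Kj VX /=; split; last first.
    by rewrite /= -iterD subnK//; apply: IH => //; exact: leqW.
  have [GX EX] := VX j Kj; split=> //.
  by rewrite /at_time /= iter_tshiftE add0n.
apply/eqP; rewrite eq_le pr_ge0 andbT; apply/ler_addgt0Pr => e e0; rewrite add0r.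
have eV : 0 < e^-1 by rewrite invr_gt0.
have [n0 Hn0] := powR_large e^-1 a0.
pose k := (n0 * K.+1)%N.
apply: (@le_trans _ _ (M K k)).
  apply: (@le_trans _ _ (pr (Q x) (iter (t K) (@tshift d) @^-1` chain k K))).
    apply: pr_mono => //; first exact: measurable_iter_tshift.
    by move=> X VX; apply: V_sub.
  by apply: pr_tshift_le => // y; apply: le_chain; rewrite /K leq_addl.
have K0 : 0 < K.+1%:R :> R by rewrite ltr0n.
have U0 : 0 < (K + k).+1%:R :> R by rewrite ltr0n.
set u := (K + k).+1%:R / K.+1%:R : R.
have u0 : 0 < u by rewrite divr_gt0.
have ua : e^-1 <= u `^ a.
  apply: Hn0; rewrite ler_pdivlMr// -natrM ler_nat.
  exact: leqW (leq_addl _ _).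
have -> : M K k = (u `^ a)^-1.
  rewrite /M /u powRM ?(ltW U0) ?invr_ge0 ?(ltW K0)// -[K.+1%:R^-1]powR_inv1 ?(ltW K0)//.
  by rewrite powRAC powR_inv1 ?powR_ge0// invfM invrK mulrC.
by rewrite -[leRHS]invrK lef_pV2 ?posrE ?invr_gt0 ?powR_gt0.
Qed.

End BlockBorelCantelli.

(** * Normalised displacements *)

Section Normalised.
Context {R : realType} {d : nat}.
Local Notation Tr := (trajectory d).
Implicit Types (Y : nat -> Tr -> R) (s : nat -> R) (a b beta : R).

(** The event that the limit superior of [Y n / s n] is at most [a]. *)
Definition eventually_le Y s a : set Tr :=
  [set X | forall k : nat, exists n0, forall n, (n0 <= n)%N ->
     Y n X <= (a + k.+1%:R^-1) * s n].

Definition adapted Y := forall n (X X' : Tr),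
  (forall i, (i <= n)%N -> X i = X' i) -> Y n X = Y n X'.

Lemma measurable_eventually_le Y s a : adapted Y -> measurable (eventually_le Y s a).
Proof.
move=> dY; rewrite (_ : eventually_le Y s a = \bigcap_k [set X | exists n0, forall n,
    (n0 <= n)%N -> [set X | Y n X <= (a + k.+1%:R^-1) * s n] X]).
  apply: bigcapT_measurable => k; apply: measurable_eventually => n.
  apply: (@measurable_depends d n) => X X' XX' /=.
  by rewrite (dY n X X').
by apply/seteqP; split => X /= H k; [move=> _|]; exact: H.
Qed.

Definition disp n (X : Tr) : R := (Zdist (X 0%N) (X n))%:R.
Definition max_disp n (X : Tr) : R := (\max_(l < n.+1) Zdist (X 0%N) (X l))%:R.

Lemma adapted_disp : adapted disp.
Proof. by move=> n X X' XX'; rewrite /disp !XX'. Qed.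

Lemma adapted_max_disp : adapted max_disp.
Proof.
move=> n X X' XX'; rewrite /max_disp; congr (_%:R); apply: eq_bigr => l _.
by rewrite !XX'// -ltnS.
Qed.

Lemma adapted_opp Y : adapted Y -> adapted (fun n X => - Y n X).
Proof. by move=> dY n X X' XX'; rewrite (dY n X X'). Qed.

Lemma max_disp_ge n l (X : Tr) : (l <= n)%N -> (Zdist (X 0%N) (X l))%:R <= max_disp n X.
Proof.
move=> ln; rewrite /max_disp ler_nat.
by apply: (@leq_bigmax _ (fun l : 'I_n.+1 => Zdist (X 0%N) (X l)) (Ordinal (ln : (l < n.+1)%N))).
Qed.

Lemma max_disp_le n (r : nat) (X : Tr) :
  (forall l, (l <= n)%N -> (Zdist (X 0%N) (X l) <= r)%N) -> max_disp n X <= r%:R.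
Proof.
by move=> H; rewrite /max_disp ler_nat; apply/bigmax_leqP => l _; apply: H; rewrite -ltnS.
Qed.

Definition phi beta n : R := n%:R `^ beta^-1 * LL n `^ (1 - beta^-1).
Definition psi beta n : R := n%:R `^ beta^-1 * LL n `^ (- beta^-1).

Lemma phi_ge0 beta n : 0 <= phi beta n.
Proof. by rewrite mulr_ge0 ?powR_ge0. Qed.

Lemma psi_ge0 beta n : 0 <= psi beta n.
Proof. by rewrite mulr_ge0 ?powR_ge0. Qed.

Lemma psi_powR beta n : 0 < beta -> 0 < LL n :> R -> psi beta n `^ beta = n%:R / LL n.
Proof.
move=> b0 L0; rewrite /psi powRM ?powR_ge0// powRKV//.
rewrite -powRrM mulNr mulVf; last by rewrite gt_eqF.
by rewrite powR_inv1 ?(ltW L0).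
Qed.

Lemma near_psi_ge beta (x : R) : 0 < beta -> \forall n \near \oo, x <= psi beta n.
Proof.
move=> b0; pose y := `|x| `^ beta + 1.
have y0 : 0 < y by rewrite ltr_wpDl ?powR_ge0.
near=> n.
have L1 : 1 <= LL n :> R by near: n; exact: near_LL_ge.
have L0 : 0 < LL n :> R by lra.
have yL : y * LL n <= n%:R `^ 1 by near: n; exact: near_LL_le_powR.
rewrite powRr1 ?ler0n// -ler_pdivlMr// -(psi_powR b0 L0) in yL.
apply: le_trans (ler_norm x) _.
rewrite -[leLHS](powRVK b0) ?normr_ge0// -[leRHS](powRVK b0) ?psi_ge0//.
apply: le_powR; [by rewrite invr_ge0 ltW|exact: powR_ge0|].
by apply: le_trans yL; rewrite /y; lra.
Unshelve. all: by end_near. Qed.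

Lemma phi_mono beta m n : 1 < beta -> (2 <= m)%N -> (m <= n)%N -> 0 <= LL m :> R ->
  phi beta m <= phi beta n.
Proof.
move=> b1 m2 mn L0; have b0 : 0 <= beta^-1 by rewrite invr_ge0; lra.
have b2 : 0 <= 1 - beta^-1 by rewrite subr_ge0 invf_le1; lra.
apply: ler_pM; rewrite ?powR_ge0//.
  by apply: le_powR; rewrite // ler_nat.
by apply: le_powR => //; exact: LL_mono.
Qed.

Lemma phi_ge beta n : 1 < beta -> 1 <= LL n :> R -> n%:R `^ beta^-1 <= phi beta n.
Proof.
move=> b1 L1; rewrite ler_peMr ?powR_ge0//.
rewrite -[leLHS](powRr0 (LL n : R)) ler_powR// subr_ge0 invf_le1; lra.
Qed.

Lemma dyadic_block n J : (2 ^ J <= n)%N ->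
  exists j, [/\ (J <= j)%N, (2 ^ j <= n)%N & (n < 2 ^ j.+1)%N].
Proof.
move=> Jn; have n0 : (0 < n)%N by apply: leq_trans Jn; rewrite expn_gt0.
exists (trunc_log 2 n); have /andP[lo hi] := trunc_log_bounds (isT : (1 < 2)%N) n0.
split=> //; rewrite -ltnS -(ltn_exp2l _ _ (isT : (1 < 2)%N)).
exact: leq_ltn_trans Jn hi.
Qed.

Lemma ceil_bounds (x : R) : 0 <= x ->
  x <= (Num.truncn x).+1%:R /\ (Num.truncn x).+1%:R <= x + 1.
Proof.
move=> x0; split; first by rewrite ltW// truncnS_gt.
by rewrite -natr1 lerD2r truncn_le.
Qed.

End Normalised.

(** * Heat kernel estimates in a fixed environment *)

Section Estimates.
Context {R : realType} {d : nat}.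
Local Notation L := (lattice d).
Local Notation Tr := (trajectory d).
Local Notation D := (@Zdist d).
Variables (alpha beta eps c11 c12 c13 c14 c15 c16 : R).
Variables (p : L -> L -> R) (Q : L -> probability Tr R) (nb : L -> {fset L}).
Variables (m : L -> R) (N : L -> R).
Hypothesis (alpha_ge1 : 1 <= alpha) (eps_gt0 : 0 < eps) (eps_beta : eps + 1 < beta).
Hypothesis (c11_gt0 : 0 < c11) (c12_gt0 : 0 < c12) (c13_gt0 : 0 < c13)
  (c14_gt0 : 0 < c14) (c15_gt0 : 0 < c15) (c16_gt0 : 0 < c16).
Hypothesis Q_law : forall x, chain_law p x (Q x).
Hypothesis p_ge0 : forall x y, 0 <= p x y.
Hypothesis p_out : forall x y, y \notin nb x -> p x y = 0.
Hypothesis p_sum : forall x, \sum_(y <- nb x) p x y = 1.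
Hypothesis nb_dist : forall x y, y \in nb x -> (D x y <= 1)%N.
Hypothesis conn : forall x y, joined (@adj d) x y.
Hypothesis ball_fin : forall (x : L) (r : R), finite_set (Zball x r).
Hypothesis m_ge0 : forall x, 0 <= m x.

Definition vol x (r : R) := \sum_(y <- fset_set (Zball x r)) m y.
Definition q n x y := pr (Q x) (at_time n [set y]).

Hypothesis A1 : forall x (r : R), 1 <= r -> N x <= r ->
  c11 * r `^ alpha <= vol x r <= c12 * r `^ alpha.
Hypothesis A2_upper : forall x y (n : nat), (0 < n)%N -> (D x y <= n)%N -> N x <= n%:R ->
  q n x y <= m y * (c13 / n%:R `^ (alpha / beta) *
    expR (- c14 * ((D x y)%:R / n%:R `^ beta^-1) `^ (beta / (beta - 1)))).
Hypothesis A2_lower : forall x y (n : nat), (0 < n)%N ->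
  (D x y)%:R `^ (1 + eps) <= n%:R -> N x <= n%:R ->
  m y * (c15 / n%:R `^ (alpha / beta) *
    expR (- c16 * ((D x y)%:R / n%:R `^ beta^-1) `^ (beta / (beta - 1)))) <=
  q n x y + q n.+1 x y.

Implicit Types (x y z : L) (n k r : nat) (f g h : L -> R) (S : set L).

Local Notation gamma := (beta / (beta - 1)).
Local Notation step := (step p nb).

Lemma beta_gt1 : 1 < beta. Proof. move: (eps_gt0) (eps_beta); lra. Qed.
Lemma beta_gt0 : 0 < beta. Proof. have := beta_gt1; lra. Qed.
Lemma gamma_ge1 : 1 <= gamma.
Proof. by rewrite ler_pdivlMr; have := beta_gt1; lra. Qed.
Let b0 := beta_gt0.
Let g1 := gamma_ge1.
Let a0 : 0 < alpha. Proof. move: (alpha_ge1); lra. Qed.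
Let ab0 : 0 <= alpha / beta. Proof. by rewrite divr_ge0// ltW. Qed.
Let bV0 : 0 <= beta^-1. Proof. by rewrite invr_ge0 ltW. Qed.
Let g0 : 0 <= gamma. Proof. move: (g1); lra. Qed.

Lemma adj_sym : symmetric (@adj d).
Proof.
by move=> x y; rewrite /adj; congr (_ == _); apply: eq_bigr => i _; rewrite distrC.
Qed.

Lemma Zdistxx x : D x x = 0%N. Proof. exact: gdistxx. Qed.

Lemma Zdist_sym x y : D x y = D y x.
Proof. by apply: gdist_sym; [exact: adj_sym|exact: conn]. Qed.

Lemma Zdist_triangle y x z : (D x z <= D x y + D y z)%N.
Proof. exact: gdist_triangle. Qed.

Lemma mem_ball x (r : R) y : (y \in fset_set (Zball x r)) = ((D x y)%:R <= r).
Proof.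
by rewrite in_fset_set//; apply/idP/idP; rewrite inE.
Qed.

Lemma iter_step_local n y f g : (forall z, (D y z <= n)%N -> f z <= g z) ->
  iter n step f y <= iter n step g y.
Proof.
elim: n y => [|n IH] y fg /=; first by apply: fg; rewrite Zdistxx.
apply: le_step => // w /nb_dist yw; apply: IH => z wz; apply: fg.
exact: leq_trans (Zdist_triangle w _ _) (leq_add yw wz).
Qed.

Lemma pr_at_timeE n S x : pr (Q x) (at_time n S) = iter n step (ind S) x.
Proof. exact: pr_at_time. Qed.

Lemma pr_at_time_le n y S S' : (forall z, (D y z <= n)%N -> S z -> S' z) ->
  pr (Q y) (at_time n S) <= pr (Q y) (at_time n S').
Proof.
move=> SS; rewrite !pr_at_timeE; apply: iter_step_local => z /SS SS'.
have [Sz|nSz] := pselect (S z); first by rewrite !indT//; exact: SS'.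
by rewrite (indF nSz) ind_ge0.
Qed.

Lemma pr_at_time_far n y S : (forall z, (D y z <= n)%N -> ~ S z) ->
  pr (Q y) (at_time n S) = 0.
Proof.
move=> SS; apply/eqP; rewrite eq_le pr_ge0 andbT.
by apply: le_trans (@pr_at_time_le n y S set0 _) _ => //; rewrite (_ : at_time _ _ = set0) ?pr0.
Qed.

Lemma q_far n y z : (n < D y z)%N -> q n y z = 0.
Proof. by move=> nD; apply: pr_at_time_far => w wn /= E; move: wn; rewrite E leqNgt nD. Qed.

Lemma pr_at_time_sum n y S (F : {fset L}) : (forall z, S z -> z \in F) ->
  pr (Q y) (at_time n S) = \sum_(z <- F | `[< S z >]) q n y z.
Proof.
move=> SF; rewrite pr_at_timeE.
have E w : ind S w = \sum_(z <- F) ind S z * @ind R d [set z] w.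
  have [wF|wF] := boolP (w \in F).
    rewrite (big_fsetD1 _ wF)/= [ind [set w] w]indT// mulr1 big1_seq ?addr0//.
    move=> z /=; rewrite !inE => /andP[zw _]; rewrite [ind [set z] w]indF ?mulr0// => /= wz.
    by rewrite wz eqxx in zw.
  rewrite indF; last by move/SF; rewrite (negPf wF).
  rewrite big1_seq// => z /= zF; rewrite [ind [set z] w]indF ?mulr0// => /= wz.
  by rewrite wz zF in wF.
rewrite (eq_iter_step p nb n E) iter_step_sum [RHS]big_mkcond/=.
apply: eq_bigr => z _; rewrite /q pr_at_timeE /ind.
by case: ifP; rewrite ?mul1r// mul0r.
Qed.

(** Only a heat kernel bound and a volume enter the estimates of hitting probabilities. *)
Lemma pr_le_vol n y x (r : R) S (B : R) : 0 <= B -> (forall z, S z -> (D x z)%:R <= r) ->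
  (forall z, S z -> q n y z <= m z * B) -> pr (Q y) (at_time n S) <= vol x r * B.
Proof.
move=> B0 Sr qB; rewrite (@pr_at_time_sum n y S (fset_set (Zball x r))); last first.
  by move=> z /Sr; rewrite mem_ball.
rewrite /vol mulr_suml big_mkcond; apply: ler_sum => z _.
by case: asboolP => [/qB//|_]; rewrite mulr_ge0.
Qed.

Lemma pr_ge_vol n y x (r : R) S (B : R) : (forall z, S z -> (D x z)%:R <= r) ->
  (forall z, S z -> m z * B <= q n y z + q n.+1 y z) ->
  (\sum_(z <- fset_set (Zball x r) | `[< S z >]) m z) * B <=
    pr (Q y) (at_time n S) + pr (Q y) (at_time n.+1 S).
Proof.
move=> Sr qB; rewrite !(@pr_at_time_sum _ y S (fset_set (Zball x r))); try
  by move=> z /Sr; rewrite mem_ball.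
rewrite -big_split mulr_suml /=; apply: ler_sum => z /asboolP; exact: qB.
Qed.

(** The upper bound without restriction on the distance: beyond [n] steps the kernel vanishes. *)
Lemma heat_kernel_le n y z k : (0 < n)%N -> N y <= n%:R -> (k <= D y z)%N ->
  q n y z <= m z * (c13 / n%:R `^ (alpha / beta) *
    expR (- c14 * (k%:R / n%:R `^ beta^-1) `^ gamma)).
Proof.
move=> n0 Ny kD; have [nD|Dn] := ltnP n (D y z).
  by rewrite q_far// mulr_ge0// mulr_ge0 ?expR_ge0// divr_ge0 ?powR_ge0 ?(ltW c13_gt0).
apply: le_trans (A2_upper n0 Dn Ny) _.
apply: ler_wpM2l; first exact: m_ge0.
apply: ler_wpM2l; first by rewrite divr_ge0 ?powR_ge0 ?(ltW c13_gt0).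
apply: le_expRN_powR; [exact: ltW|exact: g0|by rewrite divr_ge0 ?powR_ge0|].
by rewrite ler_wpM2r ?invr_ge0 ?powR_ge0// ler_nat.
Qed.

(** At the diffusive scale the lower bound is of order [rho ^ (- alpha)] throughout a
ball; the condition on the distance holds there because [1 + eps < beta]. *)
Lemma heat_kernel_ge : exists2 c : R, 0 < c & exists rho0 : nat,
  forall (rho : nat) n y z, (rho0 <= rho)%N -> rho%:R `^ beta <= n%:R ->
    n%:R <= 2 * rho%:R `^ beta -> N y <= n%:R -> (D y z <= 2 * rho)%N ->
    m z * (c / rho%:R `^ alpha) <= q n y z + q n.+1 y z.
Proof.
exists (c15 / 2 `^ (alpha / beta) * expR (- c16 * 2 `^ gamma)).
  by rewrite mulr_gt0 ?expR_gt0// divr_gt0 ?powR_gt0.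
have gap : 0 < beta - (1 + eps) by move: (eps_beta); lra.
have [n0 n0P] := powR_large (2 `^ (1 + eps)) gap.
exists (maxn n0 1) => rho n y z; rewrite geq_max => /andP[n0rho rho1] lo hi Ny Dz.
have rho0 : 0 < rho%:R :> R by rewrite ltr0n.
have n_gt0 : 0 < n%:R :> R by apply: lt_le_trans lo; rewrite powR_gt0.
have Dz' : (D y z)%:R <= 2 * rho%:R :> R by rewrite -natrM ler_nat.
apply: le_trans (A2_lower (y := z) _ _ Ny); last first.
- apply: le_trans lo; apply: le_trans (le_powR _ _ Dz') _ => //; first by move: (eps_gt0); lra.
  rewrite powRM// ?ler0n//.
  have -> : beta = (beta - (1 + eps)) + (1 + eps) by ring.
  rewrite [in leRHS]powRD; last by rewrite (gt_eqF rho0) implybT.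
  by rewrite ler_wpM2r ?powR_ge0// n0P// ler_nat.
- by rewrite -(ltr0n R).
rewrite ler_wpM2l//.
have n1 : 0 < n%:R `^ beta^-1 :> R by rewrite powR_gt0.
have rn : rho%:R <= n%:R `^ beta^-1 :> R.
  by rewrite -[leLHS](powRVK b0)//; apply: le_powR => //; exact: powR_ge0.
rewrite mulrAC; apply: ler_pM.
- by rewrite !divr_ge0 ?powR_ge0// ltW.
- exact: expR_ge0.
- rewrite -mulrA ler_wpM2l ?(ltW c15_gt0)// -invfM lef_pV2 ?posrE ?mulr_gt0 ?powR_gt0//.
  have -> : rho%:R `^ alpha = (rho%:R `^ beta) `^ (alpha / beta) :> R.
    by rewrite -powRrM; congr (_ `^ _); field; move: (b0); lra.
  by rewrite -powRM ?powR_ge0//; apply: le_powR.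
- apply: le_expRN_powR; [exact: ltW|exact: g0|by rewrite divr_ge0 ?(ltW n1)|rewrite ler_pdivrMr//].
  by apply: le_trans Dz' _; rewrite ler_wpM2l.
Qed.

(** Two walks started from [x] and [x'] share a mass of at least [delta] on the ball of radius
[rho] about [x], at time about [rho ^ beta]; two consecutive times are added because of parity.
As a harmonic function is the mean of its values at that time, [h x] near its infimum and [h x']
near its supremum force the oscillation of [h] to be small. *)
Lemma bounded_harmonic_constant h : (forall x, step h x = h x) ->
  (forall x, 0 <= h x <= 1) -> forall x x', h x = h x'.
Proof.
move=> hh h01.
have [c c_gt0 [rho0 HK]] := heat_kernel_ge.
pose delta := c * c11.
have delta0 : 0 < delta by rewrite mulr_gt0.
suff main a b : (forall x, a <= h x <= b) -> forall x x',
    delta * (b - a) <= 2 * (h x - a + (b - h x')).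
  pose H := [set h z | z in [set: L]].
  have hasH : has_sup H /\ has_inf H.
    split; split; try (by exists (h 0); exists 0).
      by exists 1 => _ [x _ <-]; case/andP: (h01 x).
    by exists 0 => _ [x _ <-]; case/andP: (h01 x).
  case: hasH => hs hi.
  have hin x : inf H <= h x <= sup H.
    apply/andP; split; first by apply: ge_inf; [case: hi|exists x].
    by apply: ub_le_sup; [case: hs|exists x].
  have le_si : sup H <= inf H.
    rewrite leNgt; apply/negP => lt.
    have e0 : 0 < delta * (sup H - inf H) / 8 by rewrite divr_gt0// mulr_gt0// subr_gt0.
    have [_ [x _ <-] hx] := inf_adherent e0 hi.
    have [_ [x' _ <-] hx'] := sup_adherent e0 hs.
    have := main _ _ hin x x'.
    set t := delta * _ in e0 hx hx' *; lra.
  by move=> x x'; have := hin x; have := hin x'; lra.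
move=> hab x x'.
have [n1 n1P] := powR_large (a := 1) `|N x| ltr01.
have [n2 n2P] := powR_large (a := 1) `|N x'| ltr01.
(* Beyond the thresholds of both starting points, and with [x'] in the ball about [x], so that the
ball lies within [2 * rho] of [x']. *)
pose rho := (rho0 + n1 + n2 + D x x' + 1)%N.
pose n := (Num.truncn (rho%:R `^ beta : R)).+1.
have rho_ge1 : 1 <= rho%:R :> R by rewrite ler1n /rho addn1.
have rb : rho%:R <= rho%:R `^ beta :> R by apply: le1r_powR => //; by rewrite ltW// beta_gt1.
have lo : rho%:R `^ beta <= n%:R :> R by rewrite ltW// truncnS_gt.
have hi : n%:R <= 2 * rho%:R `^ beta :> R.
  rewrite /n -natr1; have : (Num.truncn (rho%:R `^ beta : R))%:R <= rho%:R `^ beta :> R.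
    by rewrite truncn_le ?powR_ge0.
  lra.
have Nle y k (kP : forall t : R, k%:R <= t -> `|N y| <= t `^ 1) :
    (k <= rho)%N -> N y <= rho%:R.
  move=> k_rho; apply: le_trans (ler_norm _) _; rewrite -[leRHS]powRr1//.
  by apply: kP; rewrite ler_nat.
have Nx : N x <= rho%:R by apply: (Nle _ _ n1P); rewrite /rho; clear; lia.
have Nx' : N x' <= rho%:R by apply: (Nle _ _ n2P); rewrite /rho; clear; lia.
pose F := fset_set (Zball x (rho%:R : R)).
pose B := c / rho%:R `^ alpha.
have QB w z : (w = x \/ w = x') -> z \in F -> m z * B <= q n w z + q n.+1 w z.
  move=> ww; rewrite mem_ball ler_nat => zF.
  apply: HK => //; first by rewrite /rho; clear; lia.
    by apply: le_trans (le_trans rb lo); case: ww => ->.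
  have := Zdist_triangle x x' z; rewrite (Zdist_sym x' x).
  by case: ww => ->; move: zF; rewrite /rho; clear; move: (Zdist _ _) (Zdist _ _) (Zdist _ _); lia.
have low w g : (w = x \/ w = x') -> (forall y, step g y = g y) -> (forall y, 0 <= g y) ->
    \sum_(z <- F) m z * B * g z <= 2 * g w.
  move=> ww gg gpos.
  have S k : \sum_(z <- F) g z * q k w z <= g w.
    rewrite -[leRHS](iter_step_fix k gg); under eq_bigr do rewrite /q pr_at_timeE.
    rewrite -iter_step_sum; apply: le_iter_step => // y.
    have [yF|yF] := boolP (y \in F).
      rewrite (big_fsetD1 _ yF)/= [ind [set y] y]indT// mulr1 big1_seq ?addr0//.
      move=> z /=; rewrite !inE => /andP[zw _]; rewrite [ind [set z] y]indF ?mulr0// => /= wz.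
      by rewrite wz eqxx in zw.
    rewrite big1_seq// => z /= zF; rewrite [ind [set z] y]indF ?mulr0// => /= wz.
    by rewrite wz zF in yF.
  have -> : 2 * g w = g w + g w by ring.
  apply: le_trans (lerD (S n) (S n.+1)); rewrite -big_split /= !big_seq.
  apply: ler_sum => z zF; rewrite -mulrDr mulrC ler_wpM2l//; exact: QB.
have hx := low x (fun y => h y - a) (or_introl erefl).
have hx' := low x' (fun y => b - h y) (or_intror erefl).
have st_a y : step (fun y => h y - a) y = h y - a.
  by rewrite stepD -[X in X + _ = _]/(step h y) hh (step_cst p_sum).
have st_b y : step (fun y => b - h y) y = b - h y.
  rewrite stepD (step_cst p_sum); congr (_ + _).
  by under [LHS]eq_step do rewrite -mulN1r; rewrite stepZ -[X in _ * X = _]/(step h y) hh mulN1r.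
have {}hx := hx st_a (fun y => ltac:(by have := hab y; lra)).
have {}hx' := hx' st_b (fun y => ltac:(by have := hab y; lra)).
rewrite [leRHS]mulrDr; apply: le_trans (lerD hx hx'); rewrite -big_split /=.
under eq_bigr => z _.
  rewrite -mulrDr (_ : h z - a + (b - h z) = b - a); last by ring.
  over.
rewrite -!mulr_suml -/(vol x rho%:R).
have /andP[V _] := A1 rho_ge1 Nx.
rewrite ler_wpM2r//; first
  by case/andP: (hab x) => ax xb; rewrite subr_ge0 (le_trans ax).
have rho_gt0 : 0 < rho%:R :> R by apply: lt_le_trans rho_ge1.
rewrite /delta /B mulrA ler_pdivlMr ?powR_gt0//.
by rewrite -mulrA mulrC ler_wpM2r// ltW.
Qed.

(** Summing the heat kernel bound over the dyadic shells
[2 ^ j * r <= D y z < 2 ^ (j + 1) * r]: the volume growth is absorbed by half of the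
exponent, and the terms then decay geometrically in [j]. *)
Lemma tail_bound : exists C c : R, [/\ 0 < C, 0 < c & forall y n r, (0 < n)%N -> (0 < r)%N ->
  n%:R `^ beta^-1 <= r%:R -> N y <= r%:R ->
  pr (Q y) (at_time n [set z | (r <= D y z)%N]) <=
    C * expR (- c * (r%:R / n%:R `^ beta^-1) `^ gamma)].
Proof.
pose c := c14 / 2.
have c0 : 0 < c by rewrite divr_gt0.
have [K K0 KP] := powR_le_expR a0 c0.
pose x := expR (- c).
have x1 : x < 1 by rewrite /x -expR0 ltr_expR oppr_lt0.
have x_0 : 0 <= x by exact: expR_ge0.
pose C0 := c12 * c13 * 2 `^ alpha * K.
have C00 : 0 < C0 by rewrite !mulr_gt0 ?powR_gt0.
exists (C0 / (1 - x)), c; split=> //; first by rewrite divr_gt0// subr_gt0.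
move=> y n r n0 r0 nr Nr; set s := r%:R / _.
have n1 : 0 < n%:R `^ beta^-1 :> R by rewrite powR_gt0// ltr0n.
have s1 : 1 <= s by rewrite ler_pdivlMr// mul1r.
have s0 : 0 <= s by lra.
set E := expR (- c * s `^ gamma).
have [nr'|rn] := ltnP n r.
  rewrite pr_at_time_far; last by move=> z zn /=; apply/negP; rewrite -ltnNge (leq_ltn_trans zn).
  by rewrite mulr_ge0 ?expR_ge0// divr_ge0// ?(ltW C00)// subr_ge0 ltW.
have Nn : N y <= n%:R by apply: le_trans Nr _; rewrite ler_nat.
pose A j : set L := [set z | (2 ^ j * r <= D y z)%N].
have shell j : pr (Q y) (at_time n (A j `\` A j.+1)) <= C0 * E * x ^+ j.
  pose B := c13 / n%:R `^ (alpha / beta) *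
    expR (- c14 * ((2 ^ j * r)%:R / n%:R `^ beta^-1) `^ gamma).
  have B0 : 0 <= B by rewrite mulr_ge0 ?expR_ge0// divr_ge0 ?powR_ge0// ltW.
  pose r' : R := (2 ^ j.+1 * r)%:R.
  apply: (@le_trans _ _ (vol y r' * B)).
    apply: pr_le_vol => // z [/= zl zr]; last exact: heat_kernel_le.
    by rewrite /r' ler_nat; move: zr => /negP; rewrite -ltnNge => /ltnW.
  pose u := 2 ^+ j * s.
  have pj : 1 <= 2 ^+ j :> R by rewrite exprn_ege1// ler1n.
  have u1 : 1 <= u by rewrite /u mulr_ege1.
  have u0 : 0 < u by lra.
  have r'E : r' = 2 * u * n%:R `^ beta^-1.
    rewrite /r' /u /s natrM natrX exprS; field; rewrite gt_eqF//.
  have r'r : r%:R <= r' by rewrite /r' ler_nat leq_pmull// expn_gt0.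
  have /andP[_ V] : c11 * r' `^ alpha <= vol y r' <= c12 * r' `^ alpha.
    apply: A1; last exact: le_trans r'r.
    by apply: le_trans r'r; rewrite ler1n.
  apply: le_trans (ler_wpM2r B0 V) _.
  have -> : c12 * r' `^ alpha * B = c12 * c13 * 2 `^ alpha * (u `^ alpha * expR (- c14 * u `^ gamma)).
    have -> : r' `^ alpha = 2 `^ alpha * u `^ alpha * n%:R `^ (alpha / beta).
      by rewrite r'E powRM ?mulr_ge0 ?(ltW u0) ?(ltW n1)// powRM ?(ltW u0)// -powRrM [beta^-1 * _]mulrC.
    rewrite /B natrM natrX.
    have -> : 2 ^+ j * r%:R / n%:R `^ beta^-1 = u by rewrite /u /s mulrA.
    by field; rewrite gt_eqF// powR_gt0// ltr0n.
  rewrite /C0 -!mulrA; do 3 (rewrite ler_wpM2l ?powR_ge0 ?(ltW c12_gt0) ?(ltW c13_gt0)//).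
  have ug : u <= u `^ gamma by apply: le1r_powR.
  apply: (@le_trans _ _ (K * expR (c * u) * expR (- c14 * u `^ gamma))).
    by rewrite ler_wpM2r ?expR_ge0// KP.
  rewrite -mulrA ler_wpM2l ?(ltW K0)// /E /x -expRM_natl -!expRD ler_expR.
  have sg1 : 1 <= s `^ gamma by apply: le_trans (le1r_powR s1 g1).
  have jl : j%:R + 1 <= 2 ^+ j :> R by rewrite natr1 -natrX ler_nat ltn_expl.
  have ug2 : s `^ gamma + j%:R <= u `^ gamma.
    rewrite /u [leRHS]powRM ?exprn_ge0//.
    have : (2 ^+ j : R) <= (2 ^+ j) `^ gamma by exact: le1r_powR.
    move=> /(le_trans jl) /(ler_wpM2r (powR_ge0 s gamma)) H; apply: le_trans _ H.
    by rewrite mulrDl mul1r addrC lerD2r ler_peMr.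
  have -> : c14 = 2 * c by rewrite /c; field.
  have := ler_wpM2l (ltW c0) ug; have := ler_wpM2l (ltW c0) ug2.
  by rewrite mulrDr mulrN mulrC; lra.
have mA n' S : measurable (at_time n' S : set Tr) by exact: measurable_at_time.
have peel J : pr (Q y) (at_time n (A 0%N)) <=
    \sum_(0 <= j < J) C0 * E * x ^+ j + pr (Q y) (at_time n (A J)).
  elim: J => [|J IH]; first by rewrite big_geq// add0r.
  apply: le_trans IH _; rewrite big_nat_recr//= -addrA lerD2l.
  apply: le_trans (lerD (shell J) (lexx _)).
  apply: le_trans (prU_le _ (mA _ _) (mA _ _)).
  apply: pr_mono => //; first exact: measurableU.
  by move=> X AX; have [|nA] := pselect (A J.+1 (X n)); [right|left].
have -> : [set z | (r <= D y z)%N] = A 0%N by rewrite /A expn0 mul1n.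
(* The walk cannot reach the distance [2 ^ n * r > n] in [n] steps. *)
apply: le_trans (peel n) _; rewrite [X in _ + X]pr_at_time_far ?addr0; last first.
  move=> z zn; rewrite /A /=; have : (n < 2 ^ n)%N by rewrite ltn_expl.
  move: zn r0; clear; nia.
rewrite -mulr_sumr [leRHS]mulrAC ler_wpM2l ?sum_geometric_le//.
by rewrite mulr_ge0 ?expR_ge0// ltW.
Qed.

Definition exit_by y r n : set Tr := [set X | exists2 i, (i <= n)%N & (r <= D y (X i))%N].

Lemma depends_exit_by y r n : depends n (exit_by y r n).
Proof. by move=> X Y XY [i ilen ri]; exists i; rewrite // -XY. Qed.

Lemma measurable_exit_by y r n : measurable (exit_by y r n).
Proof. exact: measurable_depends (@depends_exit_by y r n). Qed.

(** Reflection: a walk which has reached distance [2 * r] is at distance at least [r] at the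
final time, unless it travels [r] further. By induction on the time, with no stopping time. *)
Lemma exit_le y n r (e : R) :
  (forall z l, D y z = (2 * r)%N -> (l <= n)%N ->
     pr (Q z) (at_time l [set w | (r <= D z w)%N]) <= e) -> (0 < r)%N -> 0 <= e ->
  pr (Q y) (exit_by y (2 * r) n) <= pr (Q y) (at_time n [set w | (r <= D y w)%N]) + e.
Proof.
move=> He r0 e0.
suff main l z : (l <= n)%N -> (D y z <= 2 * r)%N -> pr (Q z) (exit_by y (2 * r) l) <=
    iter l step (ind [set w | (r <= D y w)%N]) z + e.
  by rewrite pr_at_timeE; apply: main => //; rewrite Zdistxx.
have boundary l' z' : (l' <= n)%N -> D y z' = (2 * r)%N ->
    1 <= iter l' step (ind [set w | (r <= D y w)%N]) z' + e.
  move=> ln Dz; have := He z' l' Dz ln.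
  have mS S : measurable (at_time l' S : set Tr) by exact: measurable_at_time.
  rewrite -pr_at_timeE => H.
  have : pr (Q z') (~` at_time l' [set w | (r <= D y w)%N]) <= e.
    apply: le_trans H; apply: pr_mono => //; first exact: measurableC.
    move=> X; rewrite /at_time /= => nr.
    have := Zdist_triangle (X l') y z'; rewrite Dz (Zdist_sym (X l')) => T.
    move: nr T => /negP; rewrite -ltnNge; clear; move: (Zdist _ _) (Zdist _ _); lia.
  by rewrite prC//; lra.
elim: l z => [|l IH] z ln Dz.
  have [Dz'|Dz'] := eqVneq (D y z) (2 * r)%N.
    apply: le_trans (boundary 0%N z ln Dz'); by apply: pr_le1; exact: measurable_exit_by.
  have -> : exit_by y (2 * r) 0 = at_time 0 [set w | (2 * r <= D y w)%N].
    apply/seteqP; split => X /=; first by case=> i; rewrite leqn0 => /eqP ->.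
    by move=> H; exists 0%N.
  rewrite pr_at_timeE /= indF ?addr_ge0 ?ind_ge0//= => H.
  by move/eqP: Dz'; apply; apply/eqP; rewrite eqn_leq Dz.
have [Dz'|Dz'] := eqVneq (D y z) (2 * r)%N.
  apply: le_trans (boundary l.+1 z ln Dz'); by apply: pr_le1; exact: measurable_exit_by.
rewrite (pr_first_step Q_law p_ge0 p_out p_sum); last exact: measurable_exit_by.
have -> : tcons z @^-1` exit_by y (2 * r) l.+1 = exit_by y (2 * r) l.
  apply/seteqP; split => X /=.
    case=> -[|i] il /= H; last by exists i.
    by case/eqP: Dz'; apply/eqP; rewrite eqn_leq Dz.
  by case=> i il H; exists i.+1.
rewrite -[in leRHS](step_cst p_sum e z) /= -stepD.
apply: le_step => // w /nb_dist zw; apply: IH; first exact: ltnW.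
have := Zdist_triangle z y w; move: zw Dz Dz'; clear.
  by move: (Zdist _ _) (Zdist _ _) (Zdist _ _); lia.
Qed.

Lemma exit_bound : exists C c : R, [/\ 0 < C, 0 < c & forall y n r, (0 < n)%N -> (0 < r)%N ->
  n%:R `^ beta^-1 <= r%:R -> (forall z, (D y z <= 2 * r)%N -> N z <= r%:R) ->
  pr (Q y) (exit_by y (2 * r) n) <=
    C * expR (- c * (r%:R / n%:R `^ beta^-1) `^ gamma)].
Proof.
have [C [c [C0 c0 H]]] := tail_bound.
exists (2 * C), c; split=> //; first by rewrite mulr_gt0.
move=> y n r n0 r0 nr Nz; set e := expR _.
have e0 : 0 <= C * e by rewrite mulr_ge0 ?expR_ge0// ltW.
have -> : 2 * C * e = C * e + C * e by ring.
apply: le_trans (exit_le (e := C * e) _ r0 e0) _; last first.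
  by rewrite lerD2r; apply: H => //; apply: Nz; rewrite Zdistxx.
move=> z [|l] Dz ln.
  rewrite pr_at_time_far// => w; rewrite leqn0 => /eqP /= ->.
  by apply/negP; rewrite -ltnNge.
have ln' : l.+1%:R `^ beta^-1 <= n%:R `^ beta^-1 :> R.
  by apply: le_powR => //; rewrite ler_nat.
have Nz' : N z <= r%:R by apply: Nz; rewrite Dz.
apply: le_trans (H z l.+1 r isT r0 (le_trans ln' nr) Nz') _.
apply: ler_wpM2l; first exact: ltW.
have l0 : 0 < l.+1%:R `^ beta^-1 :> R by rewrite powR_gt0// ltr0n.
apply: le_expRN_powR; [exact: ltW|exact: g0|by rewrite divr_ge0 ?powR_ge0|].
apply: ler_wpM2l; first by rewrite ler0n.
by rewrite lef_pV2// posrE powR_gt0// ltr0n.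
Qed.

Variable x0 : L.
Hypothesis N_small : exists r0 : nat, forall r y, (r0 <= r)%N ->
  (D x0 y)%:R <= r%:R `^ beta -> N y <= r%:R.

(** The walk moves at unit speed at most, so these trajectories carry the law of the walk. *)
Definition slow_path x : set Tr := [set X | X 0%N = x /\ forall n, (D x (X n) <= n)%N].

Lemma slow_pathE x : slow_path x =
  [set X | X 0%N = x] `&` \bigcap_n at_time n [set z | (D x z <= n)%N].
Proof.
apply/seteqP; split => X /= [X0 H]; split=> //; first by move=> n _; exact: H.
by move=> n; exact: (H n I).
Qed.

Lemma measurable_slow_path x : measurable (slow_path x).
Proof.
rewrite slow_pathE; apply: measurableI; first exact: measurable_coord.
by apply: bigcapT_measurable => n; exact: measurable_at_time.
Qed.

Lemma pr_slow_path x : pr (Q x) (slow_path x) = 1.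
Proof.
have mF n : measurable (at_time n [set z | (D x z <= n)%N] : set Tr).
  exact: measurable_at_time.
rewrite slow_pathE.
apply: pr_setI1; [exact: measurable_coord|exact: bigcapT_measurable|exact: (pr_start1 Q_law)|].
apply: pr_bigcap1 => // n; have := prC (Q x) (mF n).
have -> : ~` at_time n [set z | (D x z <= n)%N] = at_time n [set z | ~ (D x z <= n)%N] by [].
by rewrite pr_at_time_far => [|z zn]; [lra|exact].
Qed.

(** As [beta > 1], balls of radius proportional to [r] eventually fit into that of radius
[r ^ beta]. *)
Lemma near_N_le (kappa : nat) :
  \forall r \near \oo, forall z, (D x0 z <= kappa * r)%N -> N z <= r%:R.
Proof.
have [r0 H] := N_small.
have b10 : 0 < beta - 1 by rewrite subr_gt0 beta_gt1.
near=> r => z Dz; apply: H; first by near: r; exact: nbhs_infty_ge.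
have r1 : 0 < r%:R :> R by near: r; exact: nbhs_infty_gtr.
have kr : kappa%:R <= r%:R `^ (beta - 1) by near: r; exact: near_powR_ge.
apply: (@le_trans _ _ (kappa * r)%:R); first by rewrite ler_nat.
rewrite natrM; apply: le_trans (ler_wpM2r (ltW r1) kr) _.
by rewrite mulrC mulr_powRB1 ?(ltW r1).
Unshelve. all: by end_near. Qed.

Lemma powR_gammaK (x : R) : 0 <= x -> (x `^ (1 - beta^-1)) `^ gamma = x.
Proof.
move=> x_ge0; rewrite -powRrM (_ : (1 - beta^-1) * gamma = 1) ?powRr1//.
by field; move: (beta_gt1); lra.
Qed.

Lemma powR2M (x : R) : 0 <= x -> (2 * x) `^ beta^-1 <= 2 * x `^ beta^-1.
Proof.
move=> x_ge0; rewrite powRM// ler_wpM2r ?powR_ge0//.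
rewrite -[leRHS]powRr1//; apply: ler_powR; first by lra.
by rewrite invf_le1 ?beta_gt0// ltW// beta_gt1.
Qed.

(** Upper bound for the displacement: the maximum up to time [2 ^ (j + 1)] exceeds a large
multiple of [phi (2 ^ j)] with probability of order [j ^ - 2]. *)
Lemma disp_limsup_le : exists K, pr (Q x0) (eventually_le (@disp R d) (phi beta) K) = 1.
Proof.
have [C [c [C0 c0 HE]]] := exit_bound.
(* Large enough for [c * (K / 2) ^ gamma >= 2]: at distance [K * phi] the exponent of [exit_bound]
is then at least [2 * LL], and [gamma * (1 - 1 / beta) = 1]. *)
pose K := 2 * (1 + 2 / c).
have c2 : 0 < 2 / c by rewrite divr_gt0.
have K2 : 2 <= K by rewrite /K; lra.
have Kc : 2 <= c * (K / 2) `^ gamma.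
  have -> : K / 2 = 1 + 2 / c by rewrite /K; field; rewrite gt_eqF.
  apply: (@le_trans _ _ (c * (1 + 2 / c))).
    by rewrite mulrDr mulrCA divff ?gt_eqF// mulr1; lra.
  rewrite ler_wpM2l ?(ltW c0)//; apply: le1r_powR; [lra|exact: g1].
pose r j := (Num.truncn (K * phi beta (2 ^ j))).+1.
have r_bounds j : K * phi beta (2 ^ j) <= (r j)%:R /\ (r j)%:R <= K * phi beta (2 ^ j) + 1.
  apply: ceil_bounds; rewrite mulr_ge0 ?phi_ge0//; lra.
pose H j := exit_by x0 (2 * r j) (2 ^ j.+1).
have LL1 : \forall j \near \oo, 1 <= LL (2 ^ j) :> R.
  apply: (near_comp (P := fun n => 1 <= LL n :> R) _ (near_LL_ge 1)) => j.
  by apply/ltnW; rewrite ltn_expl.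
have pow_ge (x : R) : \forall j \near \oo, x <= (2 ^ j)%:R `^ beta^-1.
  apply: (near_comp (P := fun n => x <= n%:R `^ beta^-1)) => [j|]; first by apply/ltnW; rewrite ltn_expl.
  by apply: near_powR_ge; rewrite invr_gt0 beta_gt0.
have [r1 _ Nr1] := near_N_le 2.
have C24 : 0 <= C * 24 by rewrite mulr_ge0// ltW.
have BC : pr (Q x0) [set X | exists n0, forall n, (n0 <= n)%N -> ~ H n X] = 1.
  apply: (@pr_borel_cantelli _ _ _ (Q x0) H (fun j => C * 24 * inv_sq j)).
  - by move=> j; exact: measurable_exit_by.
  - suff [j0 _ Hj] : \forall j \near \oo, pr (Q x0) (H j) <= C * 24 * inv_sq j by exists j0.
    near=> j; have L1 : 1 <= LL (2 ^ j) :> R by near: j.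
    have j0 : (0 < j)%N by near: j; exact: nbhs_infty_gt.
    set n : nat := (2 ^ j)%N in L1 *.
    have nb_r : n%:R `^ beta^-1 <= phi beta n by apply: phi_ge => //; exact: beta_gt1.
    have [rlo _] := r_bounds j; rewrite -/n in rlo.
    have n_ge0 : 0 <= n%:R `^ beta^-1 :> R by exact: powR_ge0.
    have n_pow : (2 ^ j.+1)%:R `^ beta^-1 <= 2 * n%:R `^ beta^-1 :> R.
      by rewrite expnS natrM; exact: powR2M.
    have r1r : (r1 <= r j)%N.
      rewrite -(ler_nat R); apply: (@le_trans _ _ (n%:R `^ beta^-1)); first by rewrite /n; near: j; exact: pow_ge.
      apply: le_trans nb_r _; apply: le_trans rlo; rewrite ler_peMl ?phi_ge0//; lra.
    have n_pos : 0 < (2 ^ j.+1)%:R `^ beta^-1 :> R by rewrite powR_gt0// ltr0n expn_gt0.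
    have nr : (2 ^ j.+1)%:R `^ beta^-1 <= (r j)%:R :> R.
      apply: le_trans n_pow _; apply: le_trans rlo.
      by apply: ler_pM => //; exact: phi_ge.
    apply: le_trans (HE x0 (2 ^ j.+1)%N (r j) _ _ nr _) _; rewrite ?expn_gt0//.
      exact: Nr1 r1r.
    rewrite -mulrA; apply: ler_wpM2l; first exact: ltW.
    apply: le_trans _ (expR_LL_exp2 j0); rewrite -/n ler_expR mulNr lerN2.
    apply: (@le_trans _ _ (c * (K / 2) `^ gamma * LL n)).
      by rewrite ler_wpM2r//; lra.
    rewrite -mulrA ler_wpM2l ?(ltW c0)//.
    rewrite -[X in _ * X](powR_gammaK (x := LL n)); last by lra.
    have LLp : 0 <= LL n `^ (1 - beta^-1) :> R by exact: powR_ge0.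
    have K20 : 0 <= K / 2 by lra.
    rewrite -powRM//; apply: le_powR; [exact: g0|exact: mulr_ge0|].
    rewrite ler_pdivlMr//; apply: le_trans rlo; rewrite /phi.
    apply: le_trans (ler_wpM2l (mulr_ge0 K20 LLp) n_pow) _.
    rewrite le_eqVlt; apply/orP; left; apply/eqP; by field.
  - move=> j; apply: mulr_ge0; [exact: C24|exact: inv_sq_ge0].
  - exact: cvg_series_inv_sq.
exists (3 * K); apply/eqP; rewrite eq_le pr_le1 /=; last first.
  exact: measurable_eventually_le (@adapted_disp R d).
have mBC : measurable [set X | exists n0, forall n, (n0 <= n)%N -> ~ H n X].
  by apply: (@measurable_eventually _ _ (fun n => ~` H n)) => n; apply: measurableC; exact: measurable_exit_by.
rewrite -[X in X <= _](pr_setI1 mBC (measurable_slow_path x0) BC (pr_slow_path x0)).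
apply: pr_mono; [exact: measurableI (measurable_slow_path x0)|exact: measurable_eventually_le (@adapted_disp R d)|].
move=> X [[J HJ] [X0 _]] k.
have [J1 _ HJ1] := LL1.
have [J2 _ HJ2] := pow_ge 1.
exists (2 ^ (J + J1 + J2 + 1))%N => n /dyadic_block[j [Jj jn nj]].
have LJ1 : 1 <= LL (2 ^ j) :> R by apply: HJ1; move: Jj; clear => /=; lia.
have PJ : 1 <= (2 ^ j)%:R `^ beta^-1 :> R by apply: HJ2; move: Jj; clear => /=; lia.
have Hj : ~ H j X by apply: HJ; move: Jj; clear; lia.
have Dn : (D x0 (X n) <= 2 * r j)%N.
  rewrite leqNgt; apply/negP => nD; apply: Hj; exists n; [exact: ltnW|exact: ltnW].
have [_ rhi] := r_bounds j.
have j2 : (2 <= 2 ^ j)%N by rewrite -{1}(expn1 2) leq_exp2l//; move: Jj; clear; lia.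
have p1 : 1 <= phi beta (2 ^ j) :> R.
  by apply: le_trans PJ _; apply: phi_ge => //; exact: beta_gt1.
have pm : phi beta (2 ^ j) <= phi beta n :> R.
  by apply: phi_mono => //; [exact: beta_gt1|lra].
rewrite /disp X0.
have D2 : (D x0 (X n))%:R <= 2 * (r j)%:R :> R by rewrite -natrM ler_nat.
have kp : 0 <= k.+1%:R^-1 * phi beta n :> R by rewrite mulr_ge0 ?phi_ge0.
have K0 : 0 <= K by lra.
have Kp : K * phi beta (2 ^ j) <= K * phi beta n by rewrite ler_wpM2l.
have Kp1 : 2 <= K * phi beta (2 ^ j) by apply: le_trans K2 _; rewrite ler_peMr.
rewrite mulrDl -mulrA; move: D2 rhi kp Kp Kp1.
move: (k.+1%:R^-1 * _) (K * phi _ (2 ^ j)) (K * phi _ n) (r j)%:R (D _ _)%:R => a b e f g.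
lra.
Unshelve. all: by end_near. Qed.

Lemma pr_at_time_succ n y S S' : (forall z w, S z -> (D z w <= 1)%N -> S' w) ->
  pr (Q y) (at_time n.+1 S) <= pr (Q y) (at_time n S').
Proof.
move=> SS'; rewrite !pr_at_timeE iterSr; apply: le_iter_step => // w.
have [S'w|nS'w] := pselect (S' w).
  rewrite (indT S'w) -[leRHS](step_cst p_sum 1 w); apply: le_step => // z _.
  exact: ind_le1.
rewrite (indF nS'w) -[leRHS](step_cst p_sum 0 w); apply: le_step => // z zw.
rewrite indF// => Sz; apply: nS'w; apply: SS' Sz _; rewrite Zdist_sym.
exact: nb_dist.
Qed.

(** The annulus of radii [2 * r] and [l * r] has volume at least [r ^ alpha] when [l] is large, and
the heat kernel is at least the exponential factor over [n ^ (alpha / beta)] there. *)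
Lemma far_lower_bound : exists l : nat, (2 <= l)%N /\ forall y n r, (0 < n)%N -> (0 < r)%N ->
  N y <= (2 * r)%:R -> (l * r)%:R `^ (1 + eps) <= n%:R -> n%:R `^ beta^-1 <= r%:R ->
  c15 / 2 * expR (- c16 * ((l * r)%:R / n%:R `^ beta^-1) `^ gamma) <=
    pr (Q y) (at_time n [set z | (2 * r <= D y z)%N]).
Proof.
pose l := (Num.truncn ((c12 * 2 `^ alpha + 1) / c11)).+2.
exists l; split=> // y n r n0 r0 Ny lr nr.
have r1 : 1 <= r%:R :> R by rewrite ler1n.
have lr0 : (2 * r <= l * r)%N by rewrite leq_mul2r /l orbT.
have lrn : (l * r)%:R <= n%:R :> R.
  apply: le_trans lr; apply: le1r_powR; last by move: (eps_gt0); lra.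
  by rewrite ler1n muln_gt0 r0.
have Nn : N y <= n%:R by apply: le_trans Ny _; apply: le_trans lrn; rewrite ler_nat.
have n1 : 0 < n%:R `^ beta^-1 :> R by rewrite powR_gt0// ltr0n.
pose S : set L := [set z | (2 * r < D y z <= l * r)%N].
set E := expR _.
pose B := c15 / n%:R `^ (alpha / beta) * E.
have SB z : S z -> m z * B <= q n y z + q n.+1 y z.
  move=> /andP[_ zl]; have Dz : (D y z)%:R <= (l * r)%:R :> R by rewrite ler_nat.
  have An : (D y z)%:R `^ (1 + eps) <= n%:R.
    by apply: le_trans lr; apply: le_powR => //; move: (eps_gt0); lra.
  apply: le_trans (A2_lower n0 An Nn); apply: ler_wpM2l; first exact: m_ge0.
  apply: ler_wpM2l; first by rewrite divr_ge0 ?powR_ge0 ?(ltW c15_gt0).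
  apply: le_expRN_powR; [exact: ltW|exact: g0|by rewrite divr_ge0 ?powR_ge0|].
  by apply: ler_wpM2r; rewrite // invr_ge0 ltW.
have Sl z : S z -> (D y z)%:R <= ((l * r)%:R : R) by case/andP => _; rewrite ler_nat.
have H := pr_ge_vol Sl SB.
pose S2 : set L := [set z | (2 * r <= D y z)%N].
have H1 : pr (Q y) (at_time n S) <= pr (Q y) (at_time n S2).
  by apply: pr_at_time_le => z _ /andP[/ltnW].
have H2 : pr (Q y) (at_time n.+1 S) <= pr (Q y) (at_time n S2).
  apply: pr_at_time_succ => z w /andP[zr _] zw; rewrite /S2 /=.
  have := Zdist_triangle w y z; rewrite (Zdist_sym w z); move: zr zw; clear.
  by move: (D _ _) (D _ _) (D _ _); lia.
have vol_split : vol y (l * r)%:R = vol y (2 * r)%:R +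
    \sum_(z <- fset_set (Zball y ((l * r)%:R : R)) | `[< S z >]) m z.
  rewrite /vol (bigID (fun z => (D y z <= 2 * r)%N))/=; congr (_ + _).
    rewrite big_fset_condE; apply: eq_fbigl => z; rewrite !inE/= !mem_ball !ler_nat.
    apply/andP/idP => [[]//|zr]; split=> //; exact: leq_trans lr0.
  rewrite big_seq_cond [RHS]big_seq_cond; apply: eq_bigl => z; rewrite mem_ball ler_nat.
  apply/idP/idP => [/andP[zl zr]|/andP[zl /asboolP/andP[zr _]]]; rewrite zl /=.
    by apply/asboolP; rewrite /S /= zl ltnNge zr.
  by rewrite -ltnNge.
have /andP[V1 _] : c11 * (l * r)%:R `^ alpha <= vol y (l * r)%:R <= c12 * (l * r)%:R `^ alpha.
  apply: A1; first by rewrite ler1n muln_gt0 r0.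
  by apply: le_trans Ny _; rewrite ler_nat.
have /andP[_ V2] : c11 * (2 * r)%:R `^ alpha <= vol y (2 * r)%:R <= c12 * (2 * r)%:R `^ alpha.
  by apply: A1 => //; rewrite ler1n muln_gt0 r0.
have vol_S : r%:R `^ alpha <= \sum_(z <- fset_set (Zball y ((l * r)%:R : R)) | `[< S z >]) m z.
  have l_ge : c12 * 2 `^ alpha + 1 <= c11 * l%:R `^ alpha.
    have l1 : 1 <= l%:R :> R by rewrite ler1n.
    have : l%:R <= l%:R `^ alpha :> R by exact: le1r_powR.
    have : (c12 * 2 `^ alpha + 1) / c11 <= l%:R.
      by apply: ltW; apply: lt_trans (truncnS_gt _) _; rewrite ltr_nat.
    rewrite ler_pdivrMr// => h1 h2; apply: le_trans h1 _.
    by rewrite mulrC ler_wpM2l// ltW.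
  move: V1 V2; rewrite vol_split !natrM !powRM// => V1 V2.
  have ra0 : 0 <= r%:R `^ alpha :> R by exact: powR_ge0.
  have := ler_wpM2r ra0 l_ge; rewrite mulrDl mul1r -!mulrA; lra.
have B_ge : c15 * E <= r%:R `^ alpha * B.
  rewrite /B mulrA; apply: ler_wpM2r; first exact: expR_ge0.
  rewrite mulrCA ler_peMr ?(ltW c15_gt0)// ler_pdivlMr ?mul1r; last by rewrite powR_gt0// ltr0n.
  have -> : alpha / beta = beta^-1 * alpha by rewrite mulrC.
  by rewrite powRrM; apply: le_powR; rewrite ?(ltW a0) ?(ltW n1).
have B0 : 0 <= B by rewrite mulr_ge0 ?expR_ge0// divr_ge0 ?powR_ge0// ltW.
have := ler_wpM2r B0 vol_S; move: H H1 H2 B_ge; rewrite -/S2.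
have -> : c15 / 2 * E = (c15 * E) / 2 by field.
move: (c15 * E) (r%:R `^ alpha * B) (_ * B) (pr _ _) (pr _ _) (pr _ _) => a1 a2 a3 a4 a5 a6.
lra.
Qed.

(** Lower bound for the displacement: over each dyadic block the walk travels a distance
[2 * k * phi] with conditional probability at least of order [1 / j], whatever its position at the
start of the block. This happens infinitely often, and then one of the two ends of the block is
far from the origin. *)
Lemma disp_limsup_ge : exists2 k, 0 < k & pr (Q x0) (eventually_le (@disp R d) (phi beta) k) = 0.
Proof.
have [l [l2 HL]] := far_lower_bound.
have l0 : 0 < l%:R :> R by rewrite ltr0n; exact: leq_trans l2.
(* Chosen so that the exponent of [far_lower_bound] is [LL], see [k16]; the factor 4 accounts for
rounding up and for the ratio of the times [2 ^ j] and [2 ^ (j + 1)]. *)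
pose k := c16^-1 `^ gamma^-1 / (4 * l%:R).
have gp : 0 < gamma by move: (g1); lra.
have k0 : 0 < k.
  by rewrite divr_gt0 ?mulr_gt0// powR_gt0// invr_gt0.
have k16 : c16 * (4 * l%:R * k) `^ gamma = 1.
  rewrite /k mulrCA divff ?mulr1; last by rewrite gt_eqF// mulr_gt0.
  by rewrite powRKV ?divff ?gt_eqF// invr_ge0 ltW.
clearbody k.
pose r j := (Num.truncn (k * phi beta (2 ^ j.+1))).+1.
have r_bounds j : k * phi beta (2 ^ j.+1) <= (r j)%:R /\ (r j)%:R <= k * phi beta (2 ^ j.+1) + 1.
  by apply: ceil_bounds; rewrite mulr_ge0 ?phi_ge0// ltW.
pose E j : set Tr := [set X | (2 * r j <= D (X 0%N) (X (2 ^ j)%N))%N].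
pose G j : set L := [set y | (D x0 y <= 2 ^ j)%N].
pose a := Num.min 1 (c15 / 2).
have a_gt0 : 0 < a by rewrite lt_min ltr01 divr_gt0.
have a_le1 : a <= 1 by rewrite ge_min lexx.
have dE j : depends (2 ^ j.+1 - 2 ^ j) (E j).
  rewrite expnS mul2n -addnn addnK => X Y XY; rewrite /E /= !XY//.
have expn_ge j : (j <= 2 ^ j.+1)%N by apply/ltnW/(ltn_trans (ltnSn j)); rewrite ltn_expl.
have block : \forall j \near \oo, forall y, G j y -> a / j.+1%:R <= pr (Q y) (E j).
  have [r0 HN] := N_small.
  (* The gap between the exponents [1 / (1 + eps)] and [1 / beta] makes the lower heat kernel bound
  valid at distances of order [phi]. *)
  pose theta := (1 + eps)^-1 - beta^-1.
  have th0 : 0 < theta.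
    by rewrite subr_gt0 ltf_pV2 ?posrE; move: (eps_gt0) (eps_beta); lra.
  pose M := 2 * k * l%:R * 2 `^ (1 + eps)^-1.
  have M0 : 0 < M by do 3 (apply: mulr_gt0 => //); rewrite ?powR_gt0.
  have N1 : \forall j \near \oo, M * LL (2 ^ j.+1) <= (2 ^ j.+1)%:R `^ theta.
    exact: (near_comp (P := fun n => M * LL n <= n%:R `^ theta) expn_ge (near_LL_le_powR M0 th0)).
  have N2 (x : R) : \forall j \near \oo, x <= LL (2 ^ j.+1).
    exact: (near_comp (P := fun n => x <= LL n) expn_ge (near_LL_ge x)).
  have N3 (x : R) : \forall j \near \oo, x <= (2 ^ j)%:R `^ beta^-1.
    apply: (near_comp (P := fun n => x <= n%:R `^ beta^-1)) => [j|].
      by apply/ltnW; rewrite ltn_expl.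
    by apply: near_powR_ge; rewrite invr_gt0 beta_gt0.
  near=> j => y Gy.
  set n := (2 ^ j)%N; set n2 := (2 ^ j.+1)%N.
  have n2E : n2%:R = 2 * n%:R :> R by rewrite /n2 expnS natrM.
  have n_gt0 : (0 < n)%N by rewrite expn_gt0.
  have np : 0 < n%:R `^ beta^-1 :> R by rewrite powR_gt0// ltr0n.
  have L1 : 1 <= LL n2 :> R by rewrite /n2; near: j; exact: N2.
  have Lk : k^-1 `^ gamma <= LL n2 :> R by rewrite /n2; near: j; exact: N2.
  have ML : M * LL n2 <= n2%:R `^ theta by rewrite /n2; near: j; exact: N1.
  have nr0 : r0%:R <= n%:R `^ beta^-1 by rewrite /n; near: j; exact: N3.
  have nk : k^-1 <= n%:R `^ beta^-1 by rewrite /n; near: j; exact: N3.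
  have [rlo rhi] := r_bounds j; rewrite -/n2 in rlo rhi.
  have LLg : k^-1 <= LL n2 `^ (1 - beta^-1) :> R.
    rewrite -[leLHS](powRVK gp) ?invr_ge0 ?(ltW k0)//.
    have -> : 1 - beta^-1 = gamma^-1 by field; move: (beta_gt1); lra.
    by apply: le_powR; rewrite ?invr_ge0 ?(ltW gp)// powR_ge0.
  have nn2 : n%:R `^ beta^-1 <= n2%:R `^ beta^-1 :> R.
    by apply: le_powR; [exact: bV0|exact: ler0n|rewrite n2E; move: (ler0n R n); lra].
  have kphi_ge : n%:R `^ beta^-1 <= k * phi beta n2.
    rewrite /phi mulrCA; apply: le_trans nn2 _; rewrite ler_peMr ?powR_ge0//.
    by rewrite -ler_pdivrMl// mulr1.
  have phi1 : 1 <= k * phi beta n2.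
    rewrite -ler_pdivrMl// mulr1; apply: le_trans nk _; apply: le_trans nn2 _.
    by apply: phi_ge => //; exact: beta_gt1.
  have r2 : (r j)%:R <= 2 * (k * phi beta n2) by lra.
  have nr : n%:R `^ beta^-1 <= (r j)%:R by exact: le_trans rlo.
  have Ny : N y <= (2 * r j)%:R.
    apply: HN.
      rewrite -(ler_nat R); apply: le_trans nr0 _; apply: le_trans nr _.
      by rewrite ler_nat leq_pmull.
    apply: (@le_trans _ _ n%:R); first by rewrite ler_nat.
    rewrite -[leLHS](powRKV beta_gt0)//; apply: le_powR; [exact: ltW beta_gt0|exact: ltW|].
    by apply: le_trans nr _; rewrite ler_nat leq_pmull.
  have lrn : (l * r j)%:R `^ (1 + eps) <= n%:R.
    have e0 : 0 < 1 + eps by move: (eps_gt0); lra.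
    rewrite -[leRHS](powRVK (r := (1 + eps)^-1)) ?invr_gt0// invrK.
    apply: le_powR; [exact: ltW|by []|].
    have L0 : 0 <= LL n2 :> R by lra.
    have phiL : phi beta n2 <= n2%:R `^ beta^-1 * LL n2.
      rewrite ler_wpM2l ?powR_ge0// -[leRHS]powRr1//; apply: ler_powR => //.
      by rewrite gerBl invr_ge0 ltW// beta_gt0.
    have n2p : 0 < n2%:R :> R by rewrite ltr0n expn_gt0.
    have t2 : 0 < 2 `^ (1 + eps)^-1 :> R by rewrite powR_gt0.
    have n2h : n2%:R `^ (1 + eps)^-1 = n2%:R `^ beta^-1 * n2%:R `^ theta :> R.
      rewrite -powRD ?(gt_eqF n2p) ?implybT//.
      by congr (_ `^ _); rewrite /theta; ring.
    suff : 2 `^ (1 + eps)^-1 * (l * r j)%:R <= 2 `^ (1 + eps)^-1 * n%:R `^ (1 + eps)^-1 :> R.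
      by rewrite ler_pM2l.
    rewrite -powRM// -n2E n2h; apply: le_trans (ler_wpM2l (powR_ge0 _ _) ML).
    apply: (@le_trans _ _ (M * (n2%:R `^ beta^-1 * LL n2))); last by rewrite mulrCA.
    apply: le_trans (ler_wpM2l (ltW M0) phiL).
    rewrite natrM mulrC; apply: le_trans (ler_wpM2r (ltW t2) (ler_wpM2l (ltW l0) r2)) _.
    by rewrite le_eqVlt; apply/orP; left; apply/eqP; rewrite /M; ring.
  have PE : pr (Q y) (E j) = pr (Q y) (at_time n [set z | (2 * r j <= D y z)%N]).
    apply: (pr_eq_start Q_law); [exact: measurable_depends (dE j)|exact: measurable_at_time|].
    by move=> X X0; rewrite /E /at_time /= X0.
  rewrite PE; apply: le_trans (HL y n (r j) n_gt0 _ Ny lrn nr); last by [].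
  have exp_ge : expR (- LL n2) <= expR (- c16 * ((l * r j)%:R / n%:R `^ beta^-1) `^ gamma).
    rewrite ler_expR mulNr lerN2 -[leRHS]mul1r -[X in X * LL n2]k16 -[leRHS]mulrA ler_wpM2l ?(ltW c16_gt0)//.
    have L0 : 0 <= LL n2 :> R by lra.
    rewrite -[X in _ <= _ * X](powR_gammaK L0) -powRM ?powR_ge0//; last by apply: mulr_ge0; [apply: mulr_ge0 => //|]; exact: ltW.
    apply: le_powR; [exact: g0|by rewrite divr_ge0 ?powR_ge0|].
    rewrite ler_pdivrMr// natrM.
    apply: le_trans (ler_wpM2l (ltW l0) r2) _; rewrite /phi n2E.
    have c0 : 0 <= l%:R * (2 * k) * LL n2 `^ (1 - beta^-1).
      by rewrite !mulr_ge0 ?powR_ge0// ?(ltW l0)// ltW.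
    have := ler_wpM2l c0 (powR2M (ler0n R n)).
    rewrite !mulrA [X in X <= _ -> _]mulrAC; move=> H; apply: le_trans (le_trans _ H) _.
      by rewrite le_eqVlt; apply/orP; left; apply/eqP; ring.
    by rewrite le_eqVlt; apply/orP; left; apply/eqP; ring.
  apply: le_trans (ler_wpM2l _ exp_ge); last by rewrite divr_ge0// ltW.
  have n21 : 1 < n2%:R :> R by rewrite ltr1n /n2 -{1}(expn0 2) ltn_exp2l.
  rewrite expRN_LL// /n2 ln_exp2.
  have jp : 0 < j.+1%:R :> R by rewrite ltr0n.
  have ln2p : 0 < ln 2 :> R by rewrite ln_gt0// ltr1n.
  apply: ler_pM; [exact: ltW|by rewrite invr_ge0|by rewrite /a ge_min lexx orbT|].
  rewrite lef_pV2 ?posrE ?mulr_gt0//.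
  by rewrite ler_piMr ?ln2_le1.
have mono j : (2 ^ j <= 2 ^ j.+1)%N by rewrite leq_exp2l.
have BC := block_borel_cantelli Q_law p_ge0 p_out p_sum (t := fun j => (2 ^ j)%N)
  mono dE a_gt0 a_le1 block x0.
exists (k / 2); first by rewrite divr_gt0.
set V := eventually_le _ _ _; set W := [set X | _] in BC.
have mV : measurable V by exact: measurable_eventually_le (@adapted_disp R d).
have mW : measurable W.
  by apply: measurable_block_failures => j; exact: measurable_depends (dE j).
have mP := measurable_slow_path x0.
apply: (@pr_eq0_sub _ _ _ (Q x0) _ _ mV (measurableU _ _ mW (measurableC mP))); last first.
  apply/eqP; rewrite eq_le pr_ge0 andbT.
  apply: le_trans (prU_le (Q x0) mW (measurableC mP)) _.
  by rewrite BC prC// pr_slow_path subrr addr0.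
move=> X VX; have [PX|] := pselect (slow_path x0 X); last by right.
left; have [X0 Xn] := PX.
(* With this slack both ends of a block are eventually within [(3 / 4) * k * phi]. *)
pose k1 := Num.truncn (4 / k).
have [n0 Hn0] := VX k1.
have k14 : k1.+1%:R^-1 <= k / 4.
  rewrite -[leRHS]invf_div lef_pV2 ?posrE ?ltr0n ?divr_gt0//.
  by rewrite ltW// truncnS_gt.
have [J1 _ HJ1] : \forall j \near \oo, 0 <= LL (2 ^ j) :> R.
  apply: (near_comp (P := fun n => 0 <= LL n :> R) _ (near_LL_ge 0)) => j.
  by apply/ltnW; rewrite ltn_expl.
exists (n0 + J1 + 1)%N => j Jj; split; first by rewrite /G /=; exact: Xn.
rewrite /E /= !iter_tshiftE add0n => far.
have j_exp : (j < 2 ^ j)%N by rewrite ltn_expl.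
have two_exp : (2 ^ j + 2 ^ j = 2 ^ j.+1)%N by rewrite addnn -mul2n -expnS.
have D1 : (D x0 (X (2 ^ j)%N))%:R <= (k / 2 + k1.+1%:R^-1) * phi beta (2 ^ j).
  have := Hn0 (2 ^ j)%N; rewrite /disp X0; apply; move: Jj j_exp; clear; lia.
have D2 : (D x0 (X (2 ^ j.+1)%N))%:R <= (k / 2 + k1.+1%:R^-1) * phi beta (2 ^ j.+1).
  have := Hn0 (2 ^ j.+1)%N; rewrite /disp X0; apply; move: Jj j_exp two_exp; clear; lia.
have pm : phi beta (2 ^ j) <= phi beta (2 ^ j.+1) :> R.
  apply: phi_mono; [exact: beta_gt1| |exact: mono|by apply: HJ1; move: Jj; clear => /=; lia].
  by rewrite -{1}(expn1 2) leq_exp2l//; move: Jj; clear; lia.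
have := Zdist_triangle x0 (X (2 ^ j)%N) (X (2 ^ j.+1)%N).
rewrite two_exp in far; move/(leq_trans far); rewrite (Zdist_sym _ x0) -(ler_nat R) natrD natrM.
have [rlo _] := r_bounds j.
have r1 : 1 <= (r j)%:R :> R by rewrite ler1n.
have kk : k / 2 + k1.+1%:R^-1 <= 3 / 4 * k.
  by apply: le_trans (lerD (lexx _) k14) _; lra.
have := ler_wpM2r (phi_ge0 beta (2 ^ j)) kk; have := ler_wpM2r (phi_ge0 beta (2 ^ j.+1)) kk.
have := ler_wpM2l (ltW k0) pm.
move: D1 D2 rlo r1; rewrite -!mulrA.
move: (k * phi beta (2 ^ j)) (k * phi beta (2 ^ j.+1)) ((_ + _) * _) ((_ + _) * _).
move: (D _ _)%:R (D _ _)%:R (r j)%:R => e1 e2 e3 e4 e5 e6 e7; lra.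
Unshelve. all: by end_near. Qed.

Definition stay r n : set Tr := [set X | forall i, (i <= n)%N -> (D x0 (X i) <= r)%N].

Lemma depends_stay r n : depends n (stay r n).
Proof. by move=> X Y XY H i ilen; rewrite -XY//; exact: H. Qed.

Lemma measurable_stay r n : measurable (stay r n).
Proof. exact: measurable_depends (@depends_stay r n). Qed.

Lemma stay_anti r bl n : (bl <= n)%N -> stay r n `<=` stay r bl.
Proof. by move=> mn X H i im; apply: H; exact: leq_trans mn. Qed.

Local Notation near_x0 r := [set z | (D x0 z <= r)%N].

(** At time [lam * r ^ beta] the heat kernel is at most of order [(lam ^ (1 / beta) * r) ^ (- alpha)],
which is small compared with the inverse of the volume of a ball of radius [r]. *)
Lemma return_half : exists2 lam : R, 1 <= lam & \forall r \near \oo, forall n y,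
  lam * r%:R `^ beta <= n%:R -> (D x0 y <= r)%N ->
  pr (Q y) (at_time n (near_x0 r)) <= 2^-1.
Proof.
(* [lam] is such that [lam ^ (alpha / beta) >= 2 * c12 * c13]. *)
pose T := 2 * (c12 * c13).
have T0 : 0 < T by rewrite !mulr_gt0.
have Tab : 0 <= T `^ (beta / alpha) by exact: powR_ge0.
pose lam := 1 + T `^ (beta / alpha).
have lam1 : 1 <= lam by rewrite /lam; lra.
have lam0 : 0 < lam by lra.
have lamT : T <= lam `^ (alpha / beta).
  have -> : T = (T `^ (beta / alpha)) `^ (alpha / beta).
    rewrite -powRrM (_ : beta / alpha * (alpha / beta) = 1) ?powRr1 ?(ltW T0)//.
    by field; rewrite (gt_eqF beta_gt0) (gt_eqF a0).
  by apply: le_powR; [exact: ab0|exact: Tab|rewrite /lam lerDr].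
exists lam => //; near=> r => n y rn Dy.
have r1 : (1 <= r)%N by near: r; exact: nbhs_infty_ge.
have Nr : forall z, (D x0 z <= 1 * r)%N -> N z <= r%:R by near: r; exact: near_N_le.
have r1' : 1 <= r%:R :> R by rewrite ler1n.
have r0 : 0 < r%:R :> R by rewrite ltr0n.
have rb : r%:R <= r%:R `^ beta :> R by apply: le1r_powR => //; rewrite ltW// beta_gt1.
have rn' : r%:R <= n%:R :> R.
  by apply: le_trans rb _; apply: le_trans rn; rewrite ler_peMl ?powR_ge0.
have n0 : (0 < n)%N by rewrite -(ltr0n R); exact: lt_le_trans rn'.
have Nn : N y <= n%:R by apply: le_trans rn'; apply: Nr; rewrite mul1n.
have np : 0 < n%:R `^ (alpha / beta) :> R by rewrite powR_gt0// ltr0n.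
have B0 : 0 <= c13 / n%:R `^ (alpha / beta) by rewrite divr_ge0// ltW.
apply: (@le_trans _ _ (vol x0 r%:R * (c13 / n%:R `^ (alpha / beta)))).
  apply: pr_le_vol => // z zr; first by rewrite ler_nat.
  apply: le_trans (heat_kernel_le n0 Nn (leq0n _)) _.
  rewrite ler_wpM2l// ler_piMr//.
  by rewrite -expR0 ler_expR mulNr oppr_le0 mulr_ge0 ?powR_ge0// ltW.
have Nx0 : N x0 <= r%:R by apply: Nr; rewrite Zdistxx.
have /andP[_ V] := A1 r1' Nx0.
apply: le_trans (ler_wpM2r B0 V) _.
rewrite mulrA ler_pdivrMr//.
have H : T * r%:R `^ alpha <= n%:R `^ (alpha / beta).
  apply: (@le_trans _ _ ((lam * r%:R `^ beta) `^ (alpha / beta))); last first.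
    by apply: le_powR; [exact: ab0|rewrite mulr_ge0 ?powR_ge0// ltW|].
  rewrite powRM ?powR_ge0 ?(ltW lam0)// -powRrM.
  have -> : beta * (alpha / beta) = alpha by field; move: (beta_gt0); lra.
  by rewrite ler_wpM2r ?powR_ge0.
by rewrite ler_pdivlMl//; apply: le_trans H; rewrite /T le_eqVlt; apply/orP; left; apply/eqP; ring.
Unshelve. all: by end_near. Qed.

Lemma stay_le r bl : (forall y, (D x0 y <= r)%N -> pr (Q y) (at_time bl (near_x0 r)) <= 2^-1) ->
  forall K y, (D x0 y <= r)%N -> pr (Q y) (stay r (K * bl)) <= 2^-1 ^+ K.
Proof.
move=> Hm; elim=> [|K IH] y Dy; first by apply: pr_le1; exact: measurable_stay.
have h0 : 0 <= 2^-1 ^+ K :> R by rewrite exprn_ge0// invr_ge0.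
have mA := measurable_stay r (K * bl).
have mC := @measurable_at_time d bl (near_x0 r).
apply: (@le_trans _ _ (pr (Q y) (at_time bl (near_x0 r) `&`
    iter bl (@tshift d) @^-1` stay r (K * bl)))).
  apply: pr_mono; [exact: measurable_stay|by apply: measurableI => //; exact: measurable_iter_tshift|].
  move=> X HX; split; first by apply: HX; rewrite mulSn leq_addr.
  by move=> i iK; rewrite iter_tshiftE; apply: HX; rewrite mulSn addnC leq_add2l.
apply: le_trans (markov_le Q_law p_ge0 p_out p_sum y h0
  (@depends_at_time d bl (near_x0 r)) (@subset_refl _ _) mA IH) _.
by rewrite exprS ler_wpM2r// Hm.
Qed.

Lemma half_expR : 2^-1 <= expR (- 2^-1) :> R.
Proof.
have H : expR (2^-1) <= 2 :> R.
  rewrite -[leRHS](lnK (_ : 2 \is Num.pos)) ?posrE// ler_expR; exact: ln2_ge.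
by rewrite expRN lef_pV2 ?posrE ?expR_gt0.
Qed.

Lemma exp2_ge j : (j <= 2 ^ j)%N.
Proof. by apply/ltnW; rewrite ltn_expl. Qed.

(** Lower bound for the maximum: staying within distance [r] costs a factor [1 / 2] every
[lam * r ^ beta] steps, so the probability of doing so for [2 ^ j] steps is summable in [j] when
[r] is a small multiple of [psi (2 ^ j)]. *)
Lemma max_disp_liminf_ge : exists2 k, 0 < k &
  pr (Q x0) (eventually_le (fun n X => - @max_disp R d n X) (psi beta) (- k)) = 1.
Proof.
have [lam lam1 [r1 _ Hr1]] := return_half.
have lam0 : 0 < lam by lra.
(* For this [k] there are at least [4 * LL] periods, and [2 ^ (- 4 * LL)] is at most
[exp (- 2 * LL)]. *)
pose k := (8 * lam)^-1 `^ beta^-1 / 2.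
have k2 : (2 * k) `^ beta * (8 * lam) = 1.
  rewrite /k [2 * _]mulrC divfK// powRKV ?beta_gt0// ?mulVf// ?gt_eqF ?mulr_gt0//.
  by rewrite invr_ge0 mulr_ge0// ltW.
have k0 : 0 < k by rewrite /k divr_gt0// powR_gt0// invr_gt0 mulr_gt0.
clearbody k.
pose r j := (Num.truncn (k * psi beta (2 ^ j))).+1.
have r_bounds j : k * psi beta (2 ^ j) <= (r j)%:R /\ (r j)%:R <= k * psi beta (2 ^ j) + 1.
  by apply: ceil_bounds; rewrite mulr_ge0 ?psi_ge0// ltW.
pose H j := stay (r j) (2 ^ j).
have BC : pr (Q x0) [set X | exists n0, forall n, (n0 <= n)%N -> ~ H n X] = 1.
  apply: (@pr_borel_cantelli _ _ _ (Q x0) H (fun j => 48 * inv_sq j)).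
  - by move=> j; exact: measurable_stay.
  - suff [j0 _ Hj] : \forall j \near \oo, pr (Q x0) (H j) <= 48 * inv_sq j by exists j0.
    have psi_large (x : R) : \forall j \near \oo, x <= psi beta (2 ^ j).
      exact: (near_comp (P := fun n => x <= psi beta n) exp2_ge (near_psi_ge x beta_gt0)).
    have LL_large : \forall j \near \oo, 1 <= LL (2 ^ j) :> R.
      exact: (near_comp (P := fun n => 1 <= LL n :> R) exp2_ge (near_LL_ge 1)).
    near=> j.
    have L1 : 1 <= LL (2 ^ j) :> R by near: j.
    have L0 : 0 < LL (2 ^ j) :> R by lra.
    have j0 : (0 < j)%N by near: j; exact: nbhs_infty_gt.
    have p1 : k^-1 <= psi beta (2 ^ j) by near: j; exact: psi_large.
    have p2 : k^-1 * r1%:R <= psi beta (2 ^ j) by near: j; exact: psi_large.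
    have kp1 : 1 <= k * psi beta (2 ^ j) by rewrite -ler_pdivrMl// mulr1.
    have kp2 : r1%:R <= k * psi beta (2 ^ j) by rewrite -ler_pdivrMl.
    have [rlo rhi] := r_bounds j.
    have r1r : (r1 <= r j)%N by rewrite -(ler_nat R); exact: le_trans rlo.
    have rj1 : 1 <= (r j)%:R :> R by rewrite ler1n.
    have rb1 : 1 <= (r j)%:R `^ beta :> R.
      by apply: le_trans rj1 (le1r_powR rj1 _); rewrite ltW// beta_gt1.
    have lr1 : 1 <= lam * (r j)%:R `^ beta by rewrite mulr_ege1.
    pose bl := (Num.truncn (lam * (r j)%:R `^ beta)).+1.
    have [mlo mhi] : lam * (r j)%:R `^ beta <= bl%:R /\ bl%:R <= lam * (r j)%:R `^ beta + 1.
      by apply: ceil_bounds; lra.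
    pose K := (2 ^ j %/ bl)%N.
    have HK : pr (Q x0) (H j) <= 2^-1 ^+ K.
      apply: (@le_trans _ _ (pr (Q x0) (stay (r j) (K * bl)))).
        apply: pr_mono; [exact: measurable_stay|exact: measurable_stay|].
        by apply: stay_anti; exact: leq_trunc_div.
      apply: stay_le; last by rewrite Zdistxx.
      by move=> y Dy; exact: (Hr1 (r j) r1r bl y mlo Dy).
    apply: le_trans HK _.
    have nK : (2 ^ j)%:R <= K.+1%:R * bl%:R :> R.
      by rewrite -natrM ler_nat ltnW// ltn_ceil.
    have m2 : bl%:R <= 2 * lam * (r j)%:R `^ beta by rewrite -mulrA; lra.
    have K4 : 4 * LL (2 ^ j) <= K.+1%:R :> R.
      have K0 : 0 <= K.+1%:R :> R by [].
      have r2 : (r j)%:R `^ beta <= (2 * k) `^ beta * ((2 ^ j)%:R / LL (2 ^ j)).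
        have k20 : 0 <= 2 * k by rewrite mulr_ge0// ltW.
        rewrite -(psi_powR beta_gt0 L0) -powRM ?psi_ge0//; apply: le_powR; [exact: ltW beta_gt0|by []|lra].
      have H1 : (2 ^ j)%:R <= K.+1%:R * (2 * lam * ((2 * k) `^ beta * ((2 ^ j)%:R / LL (2 ^ j)))).
        apply: le_trans nK _; rewrite ler_wpM2l//; apply: le_trans m2 _.
        by rewrite ler_wpM2l// mulr_ge0// ltW.
      have n0 : 0 < (2 ^ j)%:R :> R by rewrite ltr0n expn_gt0.
      have kE : (2 * k) `^ beta = (8 * lam)^-1.
        apply: (mulIf (_ : 8 * lam != 0)); first by rewrite gt_eqF// mulr_gt0.
        by rewrite k2 mulVf// gt_eqF// mulr_gt0.
      rewrite kE in H1.
      have E1 : K.+1%:R * (2 * lam * ((8 * lam)^-1 * ((2 ^ j)%:R / LL (2 ^ j)))) =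
                K.+1%:R / (4 * LL (2 ^ j)) * (2 ^ j)%:R.
        by field; rewrite !gt_eqF.
      rewrite E1 -[leLHS]mul1r ler_pM2r// ler_pdivlMr ?mulr_gt0// mul1r in H1.
      exact: H1.
    apply: (@le_trans _ _ (2 * (24 * inv_sq j))); last by rewrite mulrA -natrM.
    apply: (@le_trans _ _ (2 * 2^-1 ^+ K.+1)).
      by rewrite exprS mulrA divff// mul1r.
    rewrite ler_wpM2l//; apply: le_trans _ (expR_LL_exp2 j0).
    apply: (@le_trans _ _ (expR (- 2^-1) ^+ K.+1)).
      by apply: lerXn2r; rewrite ?nnegrE ?invr_ge0 ?expR_ge0// half_expR.
    by rewrite -expRM_natl ler_expR mulrN lerN2; lra.
  - by move=> j; apply: mulr_ge0 => //; exact: inv_sq_ge0.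
  - exact: cvg_series_inv_sq.
exists (k / 2); first by rewrite divr_gt0.
have mV := measurable_eventually_le (psi beta) (- (k / 2)) (adapted_opp (@adapted_max_disp R d)).
apply/eqP; rewrite eq_le pr_le1 //=.
have mBC : measurable [set X | exists n0, forall n, (n0 <= n)%N -> ~ H n X].
  by apply: (@measurable_eventually _ _ (fun n => ~` H n)) => n; apply: measurableC; exact: measurable_stay.
rewrite -[X in X <= _](pr_setI1 mBC (measurable_slow_path x0) BC (pr_slow_path x0)).
apply: pr_mono; [exact: measurableI (measurable_slow_path x0)|exact: mV|].
move=> X [[J HJ] [X0 _]] i.
have [J1 _ HJ1] : \forall j \near \oo, 1 <= LL (2 ^ j) :> R.
  exact: (near_comp (P := fun n => 1 <= LL n :> R) exp2_ge (near_LL_ge 1)).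
exists (2 ^ (J + J1 + 1))%N => n /dyadic_block[j [Jj jn nj]].
have LJ1 : 1 <= LL (2 ^ j) :> R by apply: HJ1; move: Jj; clear => /=; lia.
have Hj : ~ H j X by apply: HJ; move: Jj; clear; lia.
have rM : (r j)%:R <= max_disp n X :> R.
  rewrite leNgt; apply/negP => lt; apply: Hj => l lj.
  rewrite -(ler_nat R); apply: le_trans (ltW lt).
  by rewrite -X0; apply: max_disp_ge; exact: leq_trans jn.
have [rlo _] := r_bounds j.
have j2 : (2 <= 2 ^ j)%N by rewrite -{1}(expn1 2) leq_exp2l//; move: Jj; clear; lia.
have psi2 : psi beta n <= 2 * psi beta (2 ^ j).
  rewrite /psi mulrA; apply: ler_pM; rewrite ?powR_ge0//.
    apply: le_trans (powR2M (ler0n R (2 ^ j))); apply: le_powR; [exact: bV0|by []|].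
    by rewrite -natrM -expnS ler_nat ltnW.
  have LLn : LL (2 ^ j) <= LL n :> R by exact: LL_mono.
  have LL0 : 0 < LL (2 ^ j) :> R by lra.
  rewrite !powRN lef_pV2 ?posrE ?powR_gt0//; last exact: lt_le_trans LLn.
  by apply: le_powR; [exact: bV0|exact: ltW|].
have pi : 0 <= i.+1%:R^-1 * psi beta n :> R by rewrite mulr_ge0 ?psi_ge0.
have kp := ler_wpM2l (ltW k0) psi2.
rewrite mulrDl mulNr; apply: (@le_trans _ _ (- (k / 2 * psi beta n))); last by rewrite lerDl.
rewrite lerN2; apply: le_trans rM; apply: le_trans rlo.
by move: kp; set t := psi beta n; set u := psi beta _; lra.
Unshelve. all: by end_near. Qed.

(** A walk started within distance [s] of the origin is again there after about [s ^ beta] steps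
with probability bounded below, by the lower heat kernel bound; it leaves the ball of radius
[l * s] in the meantime with smaller probability if [l] is large, so it returns without leaving
with probability bounded below. *)
Lemma stay_return : exists l : nat, exists2 qq : R, 0 < qq < 1 & (1 <= l)%N /\
  \forall s \near \oo, forall bl y, s%:R `^ beta <= bl%:R -> bl%:R <= 2 * s%:R `^ beta ->
    (D x0 y <= s)%N ->
    qq <= pr (Q y) (at_time bl (near_x0 s) `&` stay (l * s) bl).
Proof.
have [c c0 [rho0 HK]] := heat_kernel_ge.
have [C [c' [C0 c'0 HE]]] := exit_bound.
(* [q2] bounds the probability of return, and [l1] makes that of the exit at most [q2 / 2]. *)
pose q2 := Num.min 1 (c11 * c / 2 `^ alpha / 2).
have q20 : 0 < q2 by rewrite lt_min ltr01 !divr_gt0// ?mulr_gt0// powR_gt0.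
have q21 : q2 <= 1 by rewrite ge_min lexx.
pose l1 := (Num.truncn (4 * C / (c' * q2))).+2.
have l1C : 4 * C / (c' * q2) <= l1%:R.
  by apply: ltW; apply: lt_trans (truncnS_gt _) _; rewrite ltr_nat.
have exit_small : C * expR (- c' * (l1%:R / 2)) <= q2 / 2.
  rewrite mulNr expRN ler_pdivrMr ?expR_gt0//.
  have e1 := expR_ge1Dx (c' * (l1%:R / 2)).
  rewrite ler_pdivrMr ?mulr_gt0// in l1C.
  have : q2 / 2 * (c' * (l1%:R / 2)) <= q2 / 2 * expR (c' * (l1%:R / 2)).
    by rewrite ler_wpM2l ?divr_ge0 ?(ltW q20)//; lra.
  apply: le_trans; move: l1C; set t := l1%:R; lra.
exists (3 * l1)%N, (q2 / 2); first by apply/andP; split; lra.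
split; first by rewrite muln_gt0.
have [r1 _ Hr1] := near_N_le 1.
near=> s => bl y lo hi Dy.
have s2 : (2 <= s)%N by near: s; exact: nbhs_infty_ge.
have srho : (rho0 <= s)%N by near: s; exact: nbhs_infty_ge.
have Ns : forall z, (D x0 z <= 3 * l1 * s)%N -> N z <= s%:R by near: s; exact: near_N_le.
have sr1 : (r1.+1 <= s)%N by near: s; exact: nbhs_infty_ge.
have s1 : 1 <= s%:R :> R by rewrite ler1n ltnW.
have s0 : 0 < s%:R :> R by rewrite ltr0n ltnW.
have sb : s%:R <= s%:R `^ beta :> R by apply: le1r_powR => //; rewrite ltW// beta_gt1.
have sbl : s%:R <= bl%:R :> R by exact: le_trans lo.
have bl0 : (0 < bl)%N by rewrite -(ltr0n R); exact: lt_le_trans sbl.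
have sle : (s <= 3 * l1 * s)%N by rewrite leq_pmull// muln_gt0.
have Ny : N y <= bl%:R by apply: le_trans sbl; apply: Ns; exact: leq_trans sle.
(* The lower bound concerns the sum over two consecutive times; a walk in the smaller ball at the
second time was in the larger one at the first. *)
pose S : set L := near_x0 s; pose S' : set L := near_x0 s.-1.
have back : q2 <= pr (Q y) (at_time bl S).
  have H1 : pr (Q y) (at_time bl S') <= pr (Q y) (at_time bl S).
    by apply: pr_at_time_le => z _ /leq_trans; apply; exact: leq_pred.
  have H2 : pr (Q y) (at_time bl.+1 S') <= pr (Q y) (at_time bl S).
    apply: pr_at_time_succ => z w; rewrite /S /S' /= => zs zw.
    apply: leq_trans (Zdist_triangle z _ _) _; apply: leq_trans (leq_add zs zw) _.
    by rewrite addn1 prednK// ltnW.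
  have Sr z : S' z -> (D x0 z)%:R <= (s.-1%:R : R) by rewrite ler_nat.
  have SB z : S' z -> m z * (c / s%:R `^ alpha) <= q bl y z + q bl.+1 y z.
    move=> zs; apply: HK => //.
    apply: leq_trans (Zdist_triangle x0 _ _) _; rewrite (Zdist_sym y) mul2n -addnn.
    by apply: leq_add => //; apply: leq_trans zs _; exact: leq_pred.
  have H := pr_ge_vol Sr SB.
  have Vs : \sum_(z <- fset_set (Zball x0 (s.-1%:R : R)) | `[< S' z >]) m z = vol x0 s.-1%:R.
    rewrite /vol big_seq_cond [RHS]big_seq; apply: eq_bigl => z.
    rewrite mem_ball ler_nat andb_idr// => zs; exact/asboolP.
  have Np : N x0 <= s.-1%:R.
    apply: Hr1; last by rewrite Zdistxx.
    by rewrite /= -ltnS prednK// ltnW.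
  have p1 : 1 <= s.-1%:R :> R by rewrite ler1n -ltnS prednK// ltnW.
  have /andP[V _] := A1 p1 Np.
  have sp : s%:R / 2 <= s.-1%:R :> R.
    rewrite -[s in s%:R / 2](prednK (ltnW s2)) -natr1; move: p1.
    by move: (s.-1%:R : R) => t; lra.
  have Va : c11 * (s%:R `^ alpha / 2 `^ alpha) <= vol x0 s.-1%:R.
    apply: le_trans V; rewrite ler_wpM2l ?(ltW c11_gt0)//.
    rewrite -powR_inv1 ?powR_ge0// powRAC powR_inv1// -powRM// ?invr_ge0//.
    by apply: le_powR; [exact: ltW a0|rewrite divr_ge0|].
  have sa : 0 < s%:R `^ alpha :> R by rewrite powR_gt0.
  have c0' : 0 <= c / s%:R `^ alpha by rewrite divr_ge0 ?(ltW c0)// ltW.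
  rewrite Vs in H; have {}Va := ler_wpM2r c0' Va.
  have E : c11 * (s%:R `^ alpha / 2 `^ alpha) * (c / s%:R `^ alpha) = c11 * c / 2 `^ alpha.
    by field; rewrite !gt_eqF ?powR_gt0.
  rewrite E in Va.
  apply: (@le_trans _ _ (c11 * c / 2 `^ alpha / 2)); first by rewrite ge_min lexx orbT.
  rewrite ler_pdivrMr//; lra.
pose r := (l1 * s)%N.
have r0 : (0 < r)%N by rewrite muln_gt0 /= ltnW.
have bl_pow : bl%:R `^ beta^-1 <= 2 * s%:R :> R.
  apply: (@le_trans _ _ ((2 * s%:R `^ beta) `^ beta^-1)).
    by apply: le_powR; [exact: bV0|by []|].
  apply: le_trans (powR2M (powR_ge0 _ _)) _.
  by rewrite (powRVK beta_gt0)// ltW.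
have blr : bl%:R `^ beta^-1 <= r%:R :> R.
  by apply: le_trans bl_pow _; rewrite /r natrM ler_wpM2r ?(ltW s0)// ler_nat.
have blp : 0 < bl%:R `^ beta^-1 :> R by rewrite powR_gt0// ltr0n.
have Nz z : (D y z <= 2 * r)%N -> N z <= r%:R.
  move=> zr; apply: (@le_trans _ _ s%:R); last by rewrite /r ler_nat leq_pmull.
  apply: Ns; apply: leq_trans (Zdist_triangle y _ _) _; apply: leq_trans (leq_add Dy zr) _.
  have : (s <= l1 * s)%N by rewrite leq_pmull.
  by rewrite /r -mulnA; move: (l1 * s)%N; clear; lia.
have Hexit : pr (Q y) (exit_by y (2 * r) bl) <= q2 / 2.
  apply: le_trans (HE y bl r bl0 r0 blr Nz) _; apply: le_trans exit_small.
  rewrite ler_wpM2l ?(ltW C0)// ler_expR !mulNr lerN2 ler_wpM2l ?(ltW c'0)//.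
  have lr : l1%:R / 2 <= r%:R / bl%:R `^ beta^-1 :> R.
    rewrite ler_pdivlMr// mulrAC ler_pdivrMr// /r natrM -mulrA ler_wpM2l//.
    by rewrite mulrC.
  apply: (le_trans lr); apply: le1r_powR g1.
  by rewrite ler_pdivlMr// mul1r.
have mS : measurable (at_time bl S : set Tr) by exact: measurable_at_time.
have mst := measurable_stay (3 * l1 * s) bl.
have := pr_split (Q y) mS mst.
have : pr (Q y) (at_time bl S `&` ~` stay (3 * l1 * s) bl) <= pr (Q y) (exit_by y (2 * r) bl).
  apply: pr_mono; [by apply: measurableI => //; exact: measurableC|exact: measurable_exit_by|].
  move=> X [_ nst]; apply: contrapT => nex; apply: nst => i ibl.
  rewrite leqNgt; apply/negP => far; apply: nex; exists i => //.
  have := Zdist_triangle y x0 (X i); have : (s <= l1 * s)%N by rewrite leq_pmull.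
  move: far Dy; rewrite /r -mulnA; move: (l1 * s)%N (D _ _) (D _ _) (D _ _); clear; lia.
by lra.
Unshelve. all: by end_near. Qed.

Lemma stay_ge (l s bl : nat) (qq : R) : 0 <= qq -> qq <= 1 ->
  (forall y, (D x0 y <= s)%N -> qq <= pr (Q y) (at_time bl (near_x0 s) `&` stay (l * s) bl)) ->
  (1 <= l)%N -> forall K y, (D x0 y <= s)%N -> qq ^+ K <= pr (Q y) (stay (l * s) (K * bl)).
Proof.
move=> q0 q1 Hq l1; have sl : (s <= l * s)%N by rewrite leq_pmull.
elim=> [|K IH] y Dy.
  rewrite mul0n expr0 -[X in X <= _](pr_start1 Q_law y); apply: pr_mono.
  - exact: measurable_coord.
  - exact: measurable_stay.
  - by move=> X /= X0 i; rewrite leqn0 => /eqP ->; rewrite X0; exact: leq_trans sl.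
have qK : qq ^+ K <= 1 by apply: exprn_ile1.
have mA := measurable_stay (l * s) (K * bl).
have dC : depends bl (at_time bl (near_x0 s) `&` stay (l * s) bl).
  by apply: dependsI; [exact: depends_at_time|exact: depends_stay].
have mC := measurable_depends dC.
apply: (@le_trans _ _ (pr (Q y) ((at_time bl (near_x0 s) `&` stay (l * s) bl) `&`
    iter bl (@tshift d) @^-1` stay (l * s) (K * bl)))); last first.
  apply: pr_mono; [by apply: measurableI => //; exact: measurable_iter_tshift|exact: measurable_stay|].
  move=> X [[_ H1] H2] i iK; have [ibl|bli] := leqP i bl; first exact: H1.
  have := H2 (i - bl)%N; rewrite iter_tshiftE subnK; last exact: ltnW.
  by apply; rewrite leq_subLR -mulSn.
apply: le_trans (markov_ge Q_law p_ge0 p_out p_sum y qK dC (@subIsetl _ _ _) mA IH).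
by rewrite exprS ler_wpM2r ?exprn_ge0// Hq.
Qed.

Lemma near_exp_sq (a b : R) : 0 < a -> 0 < b ->
  \forall j \near \oo, j.+1%:R `^ 3 <= a * 2 `^ (b * j.+1%:R).
Proof.
move=> a_gt0 b_gt0; have ln2p : 0 < ln 2 :> R by rewrite ln_gt0// ltr1n.
have three0 : 0 < 3 :> R by [].
have [n0 H] := near_powR_le_expR three0 (mulr_gt0 b_gt0 ln2p) a_gt0.
exists n0 => // j /= n0j; have := H j.+1%:R; rewrite ler_nat => /(_ (leqW n0j)).
by rewrite /powR (gt_eqF (_ : 0 < 2))// mulrAC.
Qed.

(** Upper bound for the maximum: along the times [2 ^ (j ^ 2)] each block is so much longer than the
past that the walk starts it well inside the ball of radius of order [psi] of the end of the block.
It stays in a ball of this order during the block with conditional probability at least of order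
[1 / j], hence does so infinitely often. *)
Lemma max_disp_liminf_le : exists K : R,
  pr (Q x0) (eventually_le (fun n X => - @max_disp R d n X) (psi beta) (- K)) = 0.
Proof.
have [l [qq /andP[q0 q1] [l1 [s1 _ Hs1]]]] := stay_return.
have [C [c [C0 c0 HE]]] := exit_bound.
(* The block has at most [LL / (- 2 * ln qq)] periods of length [(kap * psi) ^ beta], and
[exp (- LL / 2)] is at least [1 / (j + 1)] at the time [2 ^ ((j + 1) ^ 2)]. *)
pose kap := (2 * - ln qq) `^ beta^-1.
have lnq : 0 < - ln qq by rewrite oppr_gt0 ln_lt0// q0.
have kap0 : 0 < kap by rewrite powR_gt0// mulr_gt0.
have kapb : kap `^ beta = 2 * - ln qq by rewrite powRKV ?beta_gt0// mulr_ge0// ltW.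
clearbody kap.
pose t j := (2 ^ (j * j))%N.
pose r j := (Num.truncn (kap * psi beta (t j.+1))).+1.
have r_bounds j : kap * psi beta (t j.+1) <= (r j)%:R /\ (r j)%:R <= kap * psi beta (t j.+1) + 1.
  by apply: ceil_bounds; rewrite mulr_ge0 ?psi_ge0// ltW.
pose s j := (2 * r j)%N.
pose E j := stay (l * s j) (t j.+1 - t j).
pose G j : set L := near_x0 (s j).
have t_mono j : (t j <= t j.+1)%N by rewrite /t leq_exp2l// leq_mul.
have t_ge j : (j <= t j)%N.
  by apply: leq_trans (exp2_ge j) _; rewrite /t leq_exp2l// ; case: j => // j; rewrite leq_pmull.
have tS_ge j : (j <= t j.+1)%N by exact: leq_trans (t_mono j).
have psi_large (x : R) : \forall j \near \oo, x <= psi beta (t j.+1).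
  exact: (near_comp (P := fun n => x <= psi beta n) tS_ge (near_psi_ge x beta_gt0)).
have LL_large : \forall j \near \oo, 1 <= LL (t j.+1) :> R.
  exact: (near_comp (P := fun n => 1 <= LL n :> R) tS_ge (near_LL_ge 1)).
have ln_t j : ln (t j.+1)%:R <= j.+1%:R ^+ 2 :> R.
  by rewrite /t ln_exp2 natrM -expr2 ler_piMr ?exprn_ge0// ln2_le1.
have block : \forall j \near \oo, forall y, G j y -> qq / j.+1%:R <= pr (Q y) (E j).
  near=> j => y Gy; set n := t j.+1.
  have L1 : 1 <= LL n :> R by rewrite /n; near: j.
  have L0 : 0 < LL n :> R by lra.
  have p1 : kap^-1 * s1%:R <= psi beta n by rewrite /n; near: j; exact: psi_large.
  have p2 : kap^-1 <= psi beta n by rewrite /n; near: j; exact: psi_large.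
  have kp1 : s1%:R <= kap * psi beta n by rewrite -ler_pdivrMl.
  have kp2 : 1 <= kap * psi beta n by rewrite -ler_pdivrMl// mulr1.
  have [rlo rhi] := r_bounds j; rewrite -/n in rlo rhi.
  have sr : (r j)%:R <= (s j)%:R :> R by rewrite ler_nat leq_pmull.
  have ss1 : (s1 <= s j)%N by rewrite -(ler_nat R); apply: le_trans sr; exact: le_trans rlo.
  have sj1 : 1 <= (s j)%:R :> R by apply: le_trans sr; rewrite ler1n.
  have sb1 : 1 <= (s j)%:R `^ beta :> R.
    by apply: le_trans sj1 (le1r_powR sj1 _); rewrite ltW// beta_gt1.
  pose bl := (Num.truncn ((s j)%:R `^ beta : R)).+1.
  have [blo bhi] : (s j)%:R `^ beta <= bl%:R :> R /\ bl%:R <= (s j)%:R `^ beta + 1 :> R.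
    by apply: ceil_bounds; lra.
  have bhi2 : bl%:R <= 2 * (s j)%:R `^ beta :> R by lra.
  pose K := (n %/ bl)%N.
  have HK : qq ^+ K.+1 <= pr (Q y) (E j).
    apply: (@le_trans _ _ (pr (Q y) (stay (l * s j) (K.+1 * bl)))).
      apply: stay_ge => //; [exact: ltW|exact: ltW|].
      by move=> z Dz; apply: Hs1.
    apply: pr_mono; [exact: measurable_stay|exact: measurable_stay|].
    apply: stay_anti; apply: leq_trans (leq_subr _ _) _.
    by apply: ltnW; rewrite ltn_ceil.
  apply: le_trans HK; rewrite exprS ler_wpM2l ?(ltW q0)//.
  have n0 : 0 < n%:R :> R by rewrite ltr0n expn_gt0.
  have KL : K%:R * (2 * - ln qq) <= LL n :> R.
    have H1 : K%:R * bl%:R <= n%:R :> R by rewrite -natrM ler_nat leq_trunc_div.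
    have H2 : K%:R * (kap `^ beta * (n%:R / LL n)) <= n%:R :> R.
      apply: le_trans H1; rewrite ler_wpM2l//; apply: le_trans blo.
      rewrite -(psi_powR beta_gt0 L0) -powRM ?psi_ge0 ?(ltW kap0)//.
      apply: le_powR; [exact: ltW beta_gt0|by rewrite mulr_ge0 ?psi_ge0 ?(ltW kap0)|].
      exact: le_trans sr.
    rewrite kapb in H2.
    have E1 : K%:R * (2 * - ln qq * (n%:R / LL n)) = K%:R * (2 * - ln qq) / LL n * n%:R.
      by field; rewrite gt_eqF.
    by move: H2; rewrite E1 -[X in _ <= X]mul1r ler_pM2r// ler_pdivrMr// mul1r.
  have j0 : 0 < j.+1%:R :> R by rewrite ltr0n.
  have LLj : LL n <= 2 * ln j.+1%:R :> R.
    have -> : 2 * ln j.+1%:R = ln (j.+1%:R ^+ 2) :> R by rewrite lnXn// mulr_natl.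
    have n1 : 1 < n%:R :> R.
      by rewrite ltr1n /n /t -{1}(expn0 2) ltn_exp2l.
    by rewrite /LL ler_ln ?posrE ?ln_gt0 ?exprn_gt0// ln_t.
  have -> : qq ^+ K = expR (K%:R * ln qq) by rewrite expRM_natl lnK// posrE.
  rewrite -[j.+1%:R^-1]lnK ?posrE ?invr_gt0// ler_expR lnV ?posrE//.
  by move: KL LLj; move: (K%:R : R) (ln qq) (ln j.+1%:R) (LL n) => u v w z; lra.
pose H j := exit_by x0 (s j) (t j).
have xc : 0 < expR (- c) < 1 by rewrite expR_gt0 -[X in _ < X]expR0 ltr_expR oppr_lt0.
have BC1 : pr (Q x0) [set X | exists n0, forall n, (n0 <= n)%N -> ~ H n X] = 1.
  apply: (@pr_borel_cantelli _ _ _ (Q x0) H (fun j => C * expR (- c) ^+ j)).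
  - by move=> j; exact: measurable_exit_by.
  - suff [j0 _ Hj] : \forall j \near \oo, pr (Q x0) (H j) <= C * expR (- c) ^+ j by exists j0.
    have b2 : 0 < beta^-1 by rewrite invr_gt0 beta_gt0.
    have grow := near_exp_sq kap0 b2.
    have [r1 _ Hr1] := near_N_le 2.
    near=> j; set n := t j.+1.
    have L1 : 1 <= LL n :> R by rewrite /n; near: j.
    have p1 : kap^-1 * r1%:R <= psi beta n by rewrite /n; near: j; exact: psi_large.
    have p2 : kap^-1 <= psi beta n by rewrite /n; near: j; exact: psi_large.
    have kp1 : r1%:R <= kap * psi beta n by rewrite -ler_pdivrMl.
    have j1 : (0 < j)%N by near: j; exact: nbhs_infty_gt.
    have gj : j.+1%:R `^ 3 <= kap * 2 `^ (beta^-1 * j.+1%:R) by near: j.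
    have [rlo rhi] := r_bounds j; rewrite -/n in rlo rhi.
    have r1r : (r1 <= r j)%N by rewrite -(ler_nat R); exact: le_trans rlo.
    have tp : 0 < (t j)%:R `^ beta^-1 :> R by rewrite powR_gt0// ltr0n expn_gt0.
    have jr : j%:R * (t j)%:R `^ beta^-1 <= (r j)%:R :> R.
      apply: le_trans rlo; rewrite /psi.
      have LLp : LL n `^ beta^-1 <= j.+1%:R ^+ 2 :> R.
        apply: (@le_trans _ _ (LL n)).
          rewrite -[leRHS]powRr1; last by lra.
          by apply: ler_powR => //; rewrite invf_le1 ?beta_gt0// ltW// beta_gt1.
        apply: le_trans (ln_t j); apply: ln_le_id; rewrite ln_gt0// ltr1n.
        by rewrite /n /t -{1}(expn0 2) ltn_exp2l.
      have L0 : 0 < LL n `^ beta^-1 :> R by rewrite powR_gt0//; lra.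
      rewrite powRN mulrA ler_pdivlMr//.
      have tE : n%:R `^ beta^-1 = (t j)%:R `^ beta^-1 * 2 `^ (beta^-1 * (2 * j + 1)%:R) :> R.
        have -> : n = (t j * 2 ^ (2 * j + 1))%N.
          rewrite /n /t -expnD; congr (2 ^ _)%N; clear; nia.
        rewrite natrM powRM//; congr (_ * _).
        by rewrite natrX -powR_mulrn// -powRrM [_%:R * _]mulrC.
      have jS : j%:R <= j.+1%:R :> R by rewrite ler_nat.
      have core : j%:R * LL n `^ beta^-1 <= kap * 2 `^ (beta^-1 * (2 * j + 1)%:R) :> R.
        apply: (@le_trans _ _ (j.+1%:R * j.+1%:R ^+ 2)).
          by apply: ler_pM; rewrite ?ler0n ?(ltW L0).
        rewrite -exprS -powR_mulrn ?ler0n//; apply: le_trans gj _.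
        rewrite ler_wpM2l ?(ltW kap0)//.
        apply: ler_powR; first by rewrite ler1n.
        by rewrite ler_wpM2l ?(ltW b2)// ler_nat; move: j1; clear; lia.
      rewrite tE mulrCA mulrAC mulrC.
      by rewrite ler_wpM2l ?(ltW tp).
    have tr : (t j)%:R `^ beta^-1 <= (r j)%:R :> R.
      by apply: le_trans jr; rewrite ler_peMl ?(ltW tp)// ler1n.
    apply: le_trans (HE x0 (t j) (r j) _ _ tr _) _; rewrite ?expn_gt0//.
      exact: (Hr1 _ r1r).
    rewrite ler_wpM2l ?(ltW C0)// -expRM_natl ler_expR mulNr mulrN lerN2 mulrC.
    rewrite ler_wpM2l ?(ltW c0)//.
    have jr' : j%:R <= (r j)%:R / (t j)%:R `^ beta^-1 :> R by rewrite ler_pdivlMr.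
    apply: (le_trans jr'); apply: le1r_powR g1.
    by apply: (le_trans _ jr'); rewrite ler1n.
  - by move=> j; rewrite mulr_ge0 ?(ltW C0)// exprn_ge0// expR_ge0.
  - have := @is_cvg_geometric_series R C (expR (- c)).
    by rewrite /geometric /=; apply; rewrite ger0_norm ?expR_ge0//; case/andP: xc.
have dE j : depends (t j.+1 - t j) (E j) by exact: depends_stay.
have BC2 := block_borel_cantelli Q_law p_ge0 p_out p_sum (t := t) t_mono dE q0 (ltW q1) block x0.
(* Staying gives a maximum of at most [l * s j <= 4 * kap * l * psi], and the event to be excluded a
maximum of at least [(KK - 1) * psi]. *)
pose KK := 4 * kap * l%:R + 2.
exists KK.
set V := eventually_le _ _ _; set W := [set X | _] in BC2; set W1 := [set X | _] in BC1.
have mV : measurable V by exact: measurable_eventually_le (adapted_opp (@adapted_max_disp R d)).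
have mW : measurable W.
  by apply: measurable_block_failures => j; exact: measurable_depends (dE j).
have mW1 : measurable W1.
  by apply: (@measurable_eventually _ _ (fun n => ~` H n)) => n; apply: measurableC; exact: measurable_exit_by.
have mP := measurable_slow_path x0.
have mW1P := measurableI _ _ mW1 mP.
apply: (@pr_eq0_sub _ _ _ (Q x0) _ _ mV (measurableU _ _ mW (measurableC mW1P))); last first.
  apply/eqP; rewrite eq_le pr_ge0 andbT.
  apply: le_trans (prU_le (Q x0) mW (measurableC mW1P)) _.
  by rewrite BC2 prC// (pr_setI1 mW1 mP BC1 (pr_slow_path x0)) subrr addr0.
move=> X VX.
have [[[J1 HJ1] [X0 _]]|] := pselect ((W1 `&` slow_path x0) X); last by right.
left; have [n0 Hn0] := VX 0%N.
have [J2 _ HJ2] := psi_large (kap^-1).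
have [J3 _ HJ3] := psi_large 1.
exists (n0 + J1 + J2 + J3)%N => j Jj.
have nH : forall i, (i <= t j)%N -> (D x0 (X i) < s j)%N.
  move=> i ij; rewrite ltnNge; apply/negP => far.
  by apply: (HJ1 j _); [move: Jj; clear; lia|exists i].
split; first by apply: ltnW; exact: nH.
move=> EX.
have all_in : forall i, (i <= t j.+1)%N -> (D (X 0%N) (X i) <= l * s j)%N.
  move=> i ij; rewrite X0; have [ij'|ij'] := leqP i (t j).
    by apply: leq_trans (ltnW (nH i ij')) _; rewrite leq_pmull.
  have := EX (i - t j)%N; rewrite iter_tshiftE subnK ?(ltnW ij')//.
  by apply; rewrite leq_sub2r.
have M1 : max_disp (t j.+1) X <= (l * s j)%:R :> R by exact: max_disp_le.
have n0t : (n0 <= t j.+1)%N by apply: leq_trans (tS_ge j); move: Jj; clear; lia.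
have := Hn0 _ n0t; rewrite invr1 -lerN2 opprK -mulNr => M2.
have [rlo rhi] := r_bounds j.
have k1 : 1 <= kap * psi beta (t j.+1).
  by rewrite -ler_pdivrMl// mulr1; apply: HJ2; move: Jj; clear => /=; lia.
have p1 : 1 <= psi beta (t j.+1) by apply: HJ3; move: Jj; clear => /=; lia.
move: M1 M2; rewrite natrM /s natrM => M1 M2.
have ll : 0 <= l%:R :> R by [].
have rr : (r j)%:R <= 2 * (kap * psi beta (t j.+1)) by lra.
have H1 := ler_wpM2l ll rr.
have := le_trans M2 M1; rewrite /KK.
have -> : - (- (4 * kap * l%:R + 2) + 1) * psi beta (t j.+1) =
  2 * (l%:R * (2 * (kap * psi beta (t j.+1)))) + psi beta (t j.+1) by ring.
by move: H1 p1; lra.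
Unshelve. all: by end_near. Qed.

End Estimates.

(** * Environments and their translations *)

Section Translation.
Context {R : realType} {d : nat}.
Local Notation L := (lattice d).
Implicit Types (w : env R d) (x y z : L).

Lemma adj_shift x y z : adj (x + z) (y + z) = adj x y :> bool.
Proof.
rewrite /adj; congr (_ == _); apply: eq_bigr => i _.
by rewrite !mxE opprD addrACA subrr addr0.
Qed.

Lemma walk_shift (e f : rel L) z x y p : (forall a b, f (a + z) (b + z) = e a b) ->
  walk e x y p -> walk f (x + z) (y + z) [seq u + z | u <- p].
Proof.
move=> ef; elim: p x => [|c p IH] x [/= pp yE]; first by rewrite -yE.
by case/andP: pp => xc pp; have [] := IH c (conj pp yE); split=> //=; rewrite ef xc.
Qed.

Lemma joined_shift (e f : rel L) z x y : (forall a b, f (a + z) (b + z) = e a b) ->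
  joined e x y -> joined f (x + z) (y + z).
Proof. by move=> ef [p pP]; exists [seq u + z | u <- p]; exact: walk_shift pP. Qed.

Lemma Zdist_shift z : (forall x y, joined (@adj d) x y) ->
  forall x y, Zdist (x + z) (y + z) = Zdist x y.
Proof.
move=> conn x y.
have le (u a b : L) : (Zdist (a + u) (b + u) <= Zdist a b)%N.
  have [[p pP sp] _] := gdist_spec (conn a b).
  rewrite /Zdist -sp -(size_map (+%R^~ u) p); apply: gdist_le; apply: walk_shift pP => v v'.
  exact: adj_shift.
apply/eqP; rewrite eqn_leq le//=.
by have := le (- z) (x + z) (y + z); rewrite !addrK.
Qed.

Lemma edge_translateD z z' (e : edges d) :
  edge_translate z (edge_translate z' e) = edge_translate (z' + z) e.
Proof.
apply: val_inj; apply/seteqP; split => y /=.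
  by case=> _ [v ve <-] <-; exists v; rewrite ?addrA.
by case=> v ve <-; exists (v + z'); rewrite ?addrA//; exists v.
Qed.

Lemma edge_translate0 (e : edges d) : edge_translate 0 e = e.
Proof.
apply: val_inj => /=; apply/seteqP; split => y /=; first by case=> x xe <-; rewrite addr0.
by move=> ye; exists y; rewrite ?addr0.
Qed.

Lemma env_shiftD z z' w : env_shift z (env_shift z' w) = env_shift (z + z') w.
Proof. by apply/funext => e; rewrite /env_shift edge_translateD. Qed.

Lemma env_shift0 w : env_shift 0 w = w.
Proof. by apply/funext => e; rewrite /env_shift edge_translate0. Qed.

Lemma image_env_shift z (A : set (env R d)) : env_shift z @` A = env_shift (- z) @^-1` A.
Proof.
apply/seteqP; split => w /=.
  by case=> v Av <-; rewrite env_shiftD addNr env_shift0.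
by move=> Aw; exists (env_shift (- z) w) => //; rewrite env_shiftD subrr env_shift0.
Qed.

(** Either way, the conductance is a measurable function of the environment. *)
Lemma conductance_coord (x y : L) :
  (exists e : edges d, forall w, conductance w x y = (w e)%:num) \/
  (forall w, conductance w x y = 0).
Proof.
rewrite /conductance; case: insubP => [e _ _|_]; [left|right] => //.
by exists e.
Qed.

Lemma conductance_shift z w x y : conductance (env_shift z w) x y = conductance w (x + z) (y + z).
Proof.
rewrite /conductance.
have E : [set x + z; y + z] = [set u + z | u in [set x; y]] by rewrite image_setU !image_set1.
case: insubP => [e xye eE|xyn].
  have xyz : [set x + z; y + z] \in edges d by rewrite E -eE; exact: translate_edge.
  rewrite insubT /env_shift; congr (_%:num); congr (w _).
  by apply: val_inj => /=; rewrite eE -E.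
case: insubP => // e xyze eE; exfalso; move/negP: xyn; apply.
by have := translate_edge (- z) e; rewrite eE image_setU !image_set1 !addrK.
Qed.

Lemma conductance_ge0 w x y : 0 <= conductance w x y.
Proof. by case: (conductance_coord x y) => [[e ->]|->]. Qed.

Lemma open_edge_shift z w x y : open_edge (env_shift z w) x y = open_edge w (x + z) (y + z).
Proof. by rewrite /open_edge conductance_shift. Qed.

Lemma open_edge_adj w x y : open_edge w x y -> adj x y.
Proof.
rewrite /open_edge /conductance; case: insubP => [e xye _|_]; last by rewrite ltxx.
move=> _; move: xye; rewrite inE => -[a [b [ab E]]].
have xab : [set a; b] x by rewrite -E; left.
have yab : [set a; b] y by rewrite -E; right.
have axy : [set x; y] a by rewrite E; left.
have bxy : [set x; y] b by rewrite E; right.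
case: xab => /= xE; case: yab => /= yE.
- by case: bxy => /= bE; move: ab; rewrite bE xE yE.
- by rewrite xE yE.
- by rewrite xE yE adj_sym.
- by case: axy => /= aE; move: ab; rewrite aE xE yE.
Qed.

Hypothesis nbr_fin : forall x, finite_set [set y : L | adj x y].

Definition nbrs x : {fset L} := fset_set [set y : L | adj x y].

Lemma mem_nbrs x y : (y \in nbrs x) = adj x y.
Proof. by rewrite /nbrs in_fset_set//; apply/idP/idP; rewrite inE. Qed.

Lemma vertex_weightE w x : vertex_weight w x = \sum_(y <- nbrs x) conductance w x y.
Proof. by rewrite /vertex_weight fsbig_finite. Qed.

Lemma vertex_weight_ge0 w x : 0 <= vertex_weight w x.
Proof. by rewrite vertex_weightE sumr_ge0// => y _; exact: conductance_ge0. Qed.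

Lemma vertex_weight_shift z w x : vertex_weight (env_shift z w) x = vertex_weight w (x + z).
Proof.
rewrite !vertex_weightE.
have -> : nbrs (x + z) = [fset (y + z)%R | y in nbrs x]%fset.
  apply/fsetP => y; rewrite mem_nbrs; apply/idP/imfsetP => /=.
    move=> xy; exists (y - z); last by rewrite subrK.
    by rewrite mem_nbrs -(adj_shift _ _ z) subrK.
  by case=> u; rewrite mem_nbrs => xu ->; rewrite adj_shift.
rewrite big_imfset /=; last by move=> u v _ _ /addIr.
by apply: eq_bigr => y _; rewrite conductance_shift.
Qed.

Lemma vertex_weight_gt0 w x y : open_edge w x y -> 0 < vertex_weight w x.
Proof.
move=> xy; rewrite vertex_weightE.
have yn : y \in nbrs x by rewrite mem_nbrs; exact: open_edge_adj xy.
rewrite (big_fsetD1 _ yn) /= ltr_pwDl// sumr_ge0// => u _; exact: conductance_ge0.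
Qed.

Lemma transition_shift z w x y : transition (env_shift z w) x y = transition w (x + z) (y + z).
Proof. by rewrite /transition conductance_shift vertex_weight_shift. Qed.

Lemma transition_ge0 w x y : 0 <= transition w x y.
Proof. by rewrite divr_ge0 ?conductance_ge0 ?vertex_weight_ge0. Qed.

Lemma transition_out w x y : y \notin nbrs x -> transition w x y = 0.
Proof.
rewrite mem_nbrs => xy; rewrite /transition (_ : conductance w x y = 0) ?mul0r//.
apply/eqP; rewrite eq_le conductance_ge0 andbT leNgt.
by apply/negP => /open_edge_adj; exact/negP.
Qed.

Lemma transition_sum w x : 0 < vertex_weight w x -> \sum_(y <- nbrs x) transition w x y = 1.
Proof.
by move=> w0; rewrite -mulr_suml -vertex_weightE divff// gt_eqF.
Qed.

Lemma measurable_conductance x y : measurable_fun setT (fun w : env R d => conductance w x y).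
Proof.
have [[e eE]|E] := conductance_coord x y; last first.
  by rewrite (_ : (fun w => _) = cst 0)//; apply/funext => w; rewrite E.
move=> _ B mB; rewrite setTI; apply: sub_sigma_algebra; exists e, B; split=> //.
by apply/seteqP; split => w /=; rewrite eE.
Qed.

Lemma measurable_vertex_weight x : measurable_fun setT (fun w : env R d => vertex_weight w x).
Proof.
under eq_fun do rewrite vertex_weightE.
by apply: measurable_sum => y; exact: measurable_conductance.
Qed.

Lemma measurable_transition x y : measurable_fun setT (fun w : env R d => transition w x y).
Proof.
rewrite (_ : (fun w => _) = (fun w => conductance w x y * vertex_weight w x `^ (-1))); last first.
  by apply/funext => w; rewrite powR_inv1// vertex_weight_ge0.
apply: measurable_funM; first exact: measurable_conductance.
apply: (@measurableT_comp _ _ _ _ _ _ (fun a : R => a `^ (-1)) setT (fun w => vertex_weight w x)).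
  exact: measurable_powR.
exact: measurable_vertex_weight.
Qed.

Lemma measurable_preimage_shift z (A : set (env R d)) : measurable A ->
  measurable (env_shift z @^-1` A).
Proof.
suff sub : <<s @coordinate_events R d >> `<=`
    [set B : set (env R d) | measurable (env_shift z @^-1` B)] by exact: sub.
apply: smallest_sub; first split.
- by rewrite /= preimage_set0.
- move=> B mB /=; rewrite setTD preimage_setC; exact: measurableC.
- move=> F mF /=; rewrite preimage_bigcup; exact: bigcupT_measurable.
move=> _ [e [B [mB ->]]] /=.
by apply: sub_sigma_algebra; exists (edge_translate z e), B.
Qed.

End Translation.

(** * Invariance of the limit superior *)

Section Invariance.
Context {R : realType} {d : nat}.
Local Notation L := (lattice d).
Local Notation Tr := (trajectory d).
Implicit Types (Y : nat -> Tr -> R) (s : nat -> R) (a b beta : R) (X : Tr) (x : L).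

(** What a scale and a functional need for the limit superior of their ratio not to notice that a
step is added at the start of the trajectory. *)
Definition regular_scale s := [/\ forall n, 0 <= s n,
  forall M : R, \forall n \near \oo, M <= s n &
  forall delta : R, 0 < delta -> \forall n \near \oo, `|s n.+1 - s n| <= delta * s n].

Definition shift_stable Y := forall x X, exists D : R, forall n,
  `|Y n.+1 (tcons x X) - Y n X| <= D.

Lemma shift_stable_opp Y : shift_stable Y -> shift_stable (fun n X => - Y n X).
Proof.
by move=> sY x X; have [D H] := sY x X; exists D => n; rewrite -opprD normrN.
Qed.

Lemma eventually_le_mono Y s a b : (forall n, 0 <= s n) -> a <= b ->
  eventually_le Y s a `<=` eventually_le Y s b.
Proof.
move=> s0 ab X H k; have [n0 Hn0] := H k; exists n0 => n /Hn0 /le_trans; apply.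
by rewrite ler_wpM2r// lerD2r.
Qed.

(** A bounded change of the numerator and a relative change [o(1)] of the scale are absorbed
in the slack. *)
Lemma eventually_le_transfer (u v s t : nat -> R) a (D : R) :
  (forall n, u n <= v n + D) -> (forall M : R, \forall n \near \oo, M <= s n) ->
  (forall delta : R, 0 < delta -> \forall n \near \oo, `|t n - s n| <= delta * s n) ->
  (forall k : nat, \forall n \near \oo, v n <= (a + k.+1%:R^-1) * s n) ->
  forall k : nat, \forall n \near \oo, u n <= (a + k.+1%:R^-1) * t n.
Proof.
move=> uv s_oo st Hv k; pose eta : R := k.+1%:R^-1.
have eta0 : 0 < eta by rewrite invr_gt0 ltr0n.
pose A := `|a + eta| + 1.
have A0 : 0 < A by rewrite ltr_wpDl.
have delta0 : 0 < eta / (4 * A) by rewrite divr_gt0// mulr_gt0.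
(* Half of the slack [eta] is used for [v], a quarter for [D] and a quarter for the change of
scale. *)
pose k' := (2 * k + 1)%N.
have k'E : k'.+1%:R^-1 = eta / 2.
  rewrite /eta /k' -invfM -natrM; congr (_%:R^-1); clear; lia.
near=> n; have H1 : v n <= (a + k'.+1%:R^-1) * s n by near: n; exact: Hv.
have H2 : 4 * D / eta <= s n by near: n; exact: s_oo.
have H3 : `|t n - s n| <= eta / (4 * A) * s n by near: n; exact: st.
have H0 : 0 <= s n by near: n; exact: s_oo.
rewrite -/eta; rewrite k'E in H1.
have D1 : D <= eta / 4 * s n.
  by move: H2; rewrite ler_pdivrMr//; lra.
have H4 : (a + eta) * (s n - t n) <= eta / 4 * s n.
  apply: le_trans (ler_norm _) _; rewrite normrM.
  apply: (@le_trans _ _ (A * (eta / (4 * A) * s n))).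
    by apply: ler_pM => //; [rewrite /A; lra|rewrite distrC].
  by rewrite le_eqVlt; apply/orP; left; apply/eqP; field; rewrite gt_eqF.
by apply: le_trans (uv n) _; move: H1 D1 H4; lra.
Unshelve. all: by end_near. Qed.

Lemma eventually_leP Y s a X : eventually_le Y s a X <->
  forall k : nat, \forall n \near \oo, Y n X <= (a + k.+1%:R^-1) * s n.
Proof.
split=> H k; first by have [n0 Hn0] := H k; exists n0.
by have [n0 _ Hn0] := H k; exists n0 => n /Hn0.
Qed.

Lemma eventually_le_tcons Y s a x X : regular_scale s -> shift_stable Y ->
  eventually_le Y s a (tcons x X) <-> eventually_le Y s a X.
Proof.
move=> [s0 s_oo ss] sY; have [D HD] := sY x X.
have nearS (P : nat -> Prop) : (\forall n \near \oo, P n) <-> (\forall n \near \oo, P n.+1).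
  split=> -[n0 _ H]; first by exists n0 => // n /= n0n; apply: H; exact: leqW.
  by exists n0.+1 => // -[//|n] /= n0n; exact: H.
have bound n : Y n.+1 (tcons x X) <= Y n X + D /\ Y n X <= Y n.+1 (tcons x X) + D.
  by have := HD n; rewrite ler_norml => /andP[]; lra.
have E : eventually_le Y s a (tcons x X) <->
    forall k : nat, \forall n \near \oo, Y n.+1 (tcons x X) <= (a + k.+1%:R^-1) * s n.+1.
  pose P k n := Y n (tcons x X) <= (a + k.+1%:R^-1) * s n.
  by split=> [/eventually_leP|] H; [|apply/eventually_leP] => k;
    [exact: (nearS (P k)).1 (H k)|exact: (nearS (P k)).2 (H k)].
apply: (iff_trans E); apply: iff_trans (iff_sym (eventually_leP Y s a X)); split.
  apply: (@eventually_le_transfer _ _ (fun n => s n.+1) s a D).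
  - by move=> n; have [] := bound n.
  - by move=> M; exact: (nearS (fun n => M <= s n)).1 (s_oo M).
  - move=> delta delta0; pose e := Num.min 2^-1 (delta / 2).
    have e0 : 0 < e by rewrite lt_min; apply/andP; split; [lra|exact: divr_gt0].
    have e1 : e <= 2^-1 by rewrite ge_min lexx ?orTb.
    have e2 : e <= delta / 2 by rewrite ge_min lexx ?orbT.
    near=> n; have H : `|s n.+1 - s n| <= e * s n by near: n; exact: ss.
    rewrite distrC; apply: (le_trans H).
    have sn := s0 n; have e1s := ler_wpM2r sn e1; have e2s := ler_wpM2r sn e2.
    have : s n / 2 <= s n.+1 by move: H; rewrite ler_norml => /andP[]; lra.
    by move=> /(ler_wpM2l (ltW delta0)); lra.
apply: (@eventually_le_transfer _ _ s (fun n => s n.+1) a D) => //.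
by move=> n; have [] := bound n.
Unshelve. all: by end_near. Qed.

Lemma limn_esup_eq (u : nat -> R) (C : R) :
  (forall k : nat, \forall n \near \oo, u n <= C + k.+1%:R^-1) ->
  (forall k : nat, ~ \forall n \near \oo, u n <= C - k.+1%:R^-1) ->
  limn_esup (fun n => (u n)%:E) = C%:E.
Proof.
move=> up lo; apply/eqP; rewrite eq_le; apply/andP; split.
  apply/lee_addgt0Pr => e e0.
  have [k ke] := exists_inv_le e0.
  have [n0 _ Hn0] := up k.
  apply: (@le_trans _ _ (ereal_sup ((fun n => (u n)%:E) @` [set n | (n0 <= n)%N]))).
    by apply: ereal_inf_lbound; exists [set n | (n0 <= n)%N] => //; exists n0.
  apply: ge_ereal_sup => _ [n /= n0n <-]; rewrite -EFinD lee_fin.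
  by apply: le_trans (Hn0 n n0n) _; rewrite lerD2l.
apply: le_ereal_inf_tmp => _ [A [n0 _ n0A] <-]; apply/lee_subgt0Pr => e e0.
have [k ke] := exists_inv_le e0.
have [n [n0n un]] : exists n, (n0 <= n)%N /\ C - k.+1%:R^-1 < u n.
  apply: contrapT => H; apply: (lo k); exists n0 => // n /= n0n.
  by rewrite leNgt; apply/negP => lt; apply: H; exists n.
apply: (@le_trans _ _ (u n)%:E).
  by rewrite -EFinB lee_fin; apply: le_trans (ltW un); rewrite lerD2l lerN2.
by apply: ereal_sup_ubound; exists n => //; exact: n0A.
Qed.

Lemma limn_esup_eventually_le Y s (C : R) X : regular_scale s ->
  (forall k : nat, eventually_le Y s (C + k.+1%:R^-1) X) ->
  (forall k : nat, ~ eventually_le Y s (C - k.+1%:R^-1) X) ->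
  limn_esup (fun n => (Y n X / s n)%:E) = C%:E.
Proof.
move=> [s0 s_oo _] up lo; apply: limn_esup_eq => k.
  have /eventually_leP/(_ (2 * k + 1)%N) H := up (2 * k + 1)%N.
  near=> n; have sn : 1 <= s n by near: n; exact: s_oo.
  rewrite ler_pdivrMr; last by lra.
  have : Y n X <= (C + (2 * k + 1).+1%:R^-1 + (2 * k + 1).+1%:R^-1) * s n by near: n.
  rewrite (_ : (2 * k + 1).+1 = (2 * k.+1)%N); last by clear; lia.
  rewrite natrM invfM; set e := _.+1%:R^-1 => H1; apply: (le_trans H1).
  by rewrite le_eqVlt; apply/orP; left; apply/eqP; field.
move=> H; apply: (lo k); apply/eventually_leP => i.
near=> n; have sn : 1 <= s n by near: n; exact: s_oo.
have : Y n X / s n <= C - k.+1%:R^-1 by near: n.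
rewrite ler_pdivrMr; last by lra.
move=> /le_trans; apply; rewrite ler_wpM2r ?lerDl//; lra.
Unshelve. all: by end_near. Qed.

(** The ratios of consecutive values of [n], of [LL n] and of their powers of exponent in
[[-1, 1]] are [1 + O(1 / n)]. *)
Lemma scale_regular (b c : R) : 0 <= b <= 1 -> `|c| <= 1 ->
  (forall M : R, \forall n \near \oo, M <= n%:R `^ b * LL n `^ c) ->
  regular_scale (fun n => n%:R `^ b * LL n `^ c).
Proof.
move=> /andP[b0 b1] c1 H; split=> //; first by move=> n; rewrite mulr_ge0 ?powR_ge0.
move=> delta delta0; near=> n.
have n4 : 3 / delta <= n%:R by near: n; exact: near_ler_nat.
have n2 : (2 <= n)%N by near: n; exact: nbhs_infty_ge.
have L1 : 1 <= LL n :> R by near: n; exact: near_LL_ge.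
have l1 : 1 <= ln n%:R :> R by near: n; exact: near_ln_ge.
have n0 : 0 < n%:R :> R by rewrite ltr0n; exact: leq_trans n2.
have n1 : 1 <= n%:R :> R by rewrite ler1n; exact: leq_trans n2.
pose e : R := n%:R^-1.
have e0 : 0 < e by rewrite invr_gt0.
have e1 : e <= 1 by rewrite invf_le1.
have LLle : LL n <= LL n.+1 :> R by apply: LL_mono.
have de : 3 * e <= delta.
  by rewrite /e ler_pdivrMr// mulrC -ler_pdivrMr.
have nS : n.+1%:R = n%:R * (1 + e) :> R by rewrite mulrDr mulr1 divff ?gt_eqF// natr1.
have lnS : ln n.+1%:R <= ln n%:R + e :> R.
  rewrite nS lnM ?posrE//; last by lra.
  by rewrite lerD2l; have := ln_le_sub1 (_ : 0 < 1 + e); move=> /(_ ltac:(lra)); lra.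
have lnS0 : 0 < ln n.+1%:R :> R by rewrite ln_gt0// ltr1n ltnS ltnW.
have LLS : LL n.+1 <= LL n * (1 + e) :> R.
  have -> : LL n.+1 = LL n + ln (ln n.+1%:R / ln n%:R) :> R.
    rewrite /LL -lnM ?posrE ?divr_gt0//; try lra.
    by congr ln; field; rewrite gt_eqF//; lra.
  rewrite mulrDr mulr1 lerD2l.
  have q0 : 0 < ln n.+1%:R / ln n%:R :> R by rewrite divr_gt0//; lra.
  apply: le_trans (ln_le_sub1 q0) _.
  rewrite lerBlDr ler_pdivrMr; last by lra.
  apply: (le_trans lnS); rewrite mulrDl mul1r addrC lerD2r.
  have : 1 * 1 <= LL n * ln n%:R :> R by apply: ler_pM.
  by move=> /(ler_wpM2l (ltW e0)); rewrite mul1r mulr1 mulrCA mulrA.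
clearbody e.
pose u : R := (n.+1%:R / n%:R) `^ b; pose v : R := (LL n.+1 / LL n) `^ c.
have L0 : 0 < LL n :> R by lra.
have LS0 : 0 < LL n.+1 :> R by lra.
have ub : 1 <= u <= 1 + e.
  rewrite /u nS mulrAC divff ?gt_eqF// mul1r; apply/andP; split.
    by rewrite -[leLHS](powRr0 (1 + e)); apply: ler_powR => //; lra.
  by rewrite -[leRHS]powRr1; [apply: ler_powR => //; lra|lra].
have q1 : 1 <= (LL n.+1 : R) / LL n <= 1 + e.
  by rewrite ler_pdivlMr// mul1r LLle ler_pdivrMr// mulrC.
have vb : 1 - e <= v <= 1 + e.
  have [q1a q1b] := andP q1; move: c1; rewrite ler_norml => /andP[c1 c2].
  apply/andP; split.
    apply: (@le_trans _ _ ((LL n.+1 / LL n) `^ (-1))); last exact: ler_powR.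
    rewrite powR_inv1 ?divr_ge0 ?(ltW L0) ?(ltW LS0)//.
    have q0 : 0 < LL n.+1 / LL n :> R by lra.
    rewrite -[leRHS]mul1r ler_pdivlMr//.
    have e1' : 0 <= 1 - e by rewrite subr_ge0.
    have : (1 - e) * (LL n.+1 / LL n) <= (1 - e) * (1 + e) by rewrite ler_wpM2l.
    by have := mulr_ge0 (ltW e0) (ltW e0); move: (_ / _) => q; lra.
  apply: (@le_trans _ _ ((LL n.+1 / LL n) `^ 1)); first exact: ler_powR.
  by rewrite powRr1//; lra.
have sE : n.+1%:R `^ b * LL n.+1 `^ c = (u * v) * (n%:R `^ b * LL n `^ c).
  rewrite /u /v !powRM ?invr_ge0 ?(ltW L0) ?(ltW LS0) ?(ltW n0)//.
  have p1 : n%:R^-1 `^ b * n%:R `^ b = 1 :> R by rewrite -powRM ?invr_ge0 ?(ltW n0)// mulVf ?gt_eqF// powR1.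
  have p2 : (LL n)^-1 `^ c * LL n `^ c = 1 :> R by rewrite -powRM ?invr_ge0 ?(ltW L0)// mulVf ?gt_eqF// powR1.
  transitivity (n.+1%:R `^ b * LL n.+1 `^ c * (n%:R^-1 `^ b * n%:R `^ b) * ((LL n)^-1 `^ c * LL n `^ c)).
    by rewrite p1 p2 !mulr1.
  by ring.
rewrite sE -[X in _ - X]mul1r -mulrBl normrM [X in _ * X]ger0_norm ?mulr_ge0 ?powR_ge0//.
rewrite ler_wpM2r ?mulr_ge0 ?powR_ge0//.
apply: le_trans de.
have [u1 u2] := andP ub; have [v1 v2] := andP vb.
rewrite ler_norml; apply/andP; split.
  have : 1 * (1 - e) <= u * v by apply: ler_pM => //; lra.
  lra.
have : u * v <= (1 + e) * (1 + e) by apply: ler_pM; lra.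
have : e * e <= 1 * e by rewrite ler_wpM2r// ltW.
lra.
Unshelve. all: by end_near. Qed.

End Invariance.

(** * Almost every environment *)

Section GoodEnvironments.
Context {R : realType} {d : nat}.
Local Notation L := (lattice d).
Variables (alpha c1 c2 : R).
Hypothesis (alpha_ge1 : 1 <= alpha) (c1_gt0 : 0 < c1) (c2_gt0 : 0 < c2).
Hypothesis hball : forall (x : L) (r : R), 1 <= r ->
  c1 * r `^ alpha <= #|` fset_set (Zball x r)|%:R <= c2 * r `^ alpha.
Variables (P : probability (env R d) R) (x0 : L).
Implicit Types (w : env R d) (x y z : L).

Lemma Zball_finite x (r : R) : finite_set (Zball x r).
Proof.
suff big (r' : R) : 1 <= r' -> finite_set (Zball x r').
  apply: (sub_finite_set (B := Zball x (Num.max 1 r))); last by apply: big; rewrite le_max lexx.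
  by move=> y; rewrite /Zball /gball /= => yr; rewrite le_max yr orbT.
move=> r1; apply: contrapT => inf; have /andP[+ _] := hball x r1.
rewrite /fset_set; case: pselect => // _; rewrite cardfs0 leNgt => /negP; apply.
by rewrite mulr_gt0// powR_gt0//; lra.
Qed.

Lemma nbr_finite x : finite_set [set y : L | adj x y].
Proof.
apply: sub_finite_set (Zball_finite x 1) => y /= xy.
by rewrite /Zball /gball /= lern1; exact: gdist_adj.
Qed.

Lemma sum_fset_le (F G : {fset L}) (m : L -> R) : (forall x, 0 <= m x) ->
  (forall x, x \in F -> x \in G) -> \sum_(x <- F) m x <= \sum_(x <- G) m x.
Proof.
move=> m0 FG; have -> : \sum_(x <- F) m x = \sum_(x <- G | x \in F) m x.
  rewrite [RHS]big_fset_condE; apply: eq_fbigl => x; rewrite !inE.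
  by case xF: (x \in F); rewrite ?andbF// FG.
by rewrite big_mkcond; apply: ler_sum => x _; case: ifP.
Qed.

Variables (Omega0 : set (env R d)) (mOmega0 : measurable Omega0) (POmega0 : P Omega0 = 1%E).
Variables (c11 c12 : R) (N : L -> env R d -> R).
Hypothesis (c11_gt0 : 0 < c11).
Hypothesis A1 : forall w x (r : R), Omega0 w -> cluster_of w x0 x ->
  1 <= r -> N x w <= r ->
  c11 * r `^ alpha <= cluster_vol w x0 x r <= c12 * r `^ alpha.

(** The weights of a finite cluster would have a bounded sum, against the lower volume bound. *)
Lemma cluster_infinite w : Omega0 w -> infinite_set (cluster_of w x0).
Proof.
move=> w0 fin; pose S := \sum_(y <- fset_set (cluster_of w x0)) vertex_weight w y.
have wge0 := vertex_weight_ge0 nbr_finite w.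
have a0 : 0 < alpha by move: (alpha_ge1); lra.
have [n0 Hn0] := powR_large ((S + 1) / c11) a0.
pose r : R := n0%:R + 1 + `|N x0 w|.
have r1 : 1 <= r by rewrite /r addrAC lerDr addr_ge0.
have Nr : N x0 w <= r by apply: le_trans (ler_norm _) _; rewrite /r lerDr addr_ge0.
have cx0 : cluster_of w x0 x0 by exact: joined_refl.
have /andP[V _] := A1 w0 cx0 r1 Nr.
have nr : n0%:R <= r by rewrite /r -addrA lerDl addr_ge0.
have := Hn0 r nr; rewrite ler_pdivrMr// mulrC => H.
have fin' : finite_set (Zball x0 r `&` cluster_of w x0) by exact: finite_setIl (Zball_finite _ _).
have : cluster_vol w x0 x0 r <= S.
  rewrite /cluster_vol fsbig_finite//; apply: sum_fset_le => // y.
  by rewrite !in_fset_set// !inE => -[].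
by lra.
Qed.

Hypothesis B1_invariant : forall z (A : set (env R d)), measurable A ->
  P (env_shift z @` A) = P A.
Hypothesis B2 : {ae P, forall w, exists! K : set L,
  is_component (open_edge w) (ray_set w) K /\ infinite_set K}.

Lemma pr_preimage_shift z (A : set (env R d)) : measurable A ->
  pr P (env_shift z @^-1` A) = pr P A.
Proof.
by move=> mA; rewrite /pr -(B1_invariant (- z) mA) image_env_shift opprK.
Qed.

(** Almost surely, by stationarity, every vertex lies in an infinite cluster, hence starts a ray by
König's lemma. Each cluster is then an infinite component of the set of these vertices, so there
is only one, by uniqueness, and it is the whole lattice. *)
Lemma good_environments : exists Good : set (env R d),
  [/\ measurable Good, pr P Good = 1, Good `<=` Omega0,
      (forall z w, Good w -> Good (env_shift z w)) &
      (forall w, Good w -> forall x, cluster_of w x0 x /\ 0 < vertex_weight w x)].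
Proof.
have [B [mB B0 HB]] := B2.
pose O' := Omega0 `&` ~` B.
have mO' : measurable O' by apply: measurableI => //; exact: measurableC.
have PO' : pr P O' = 1.
  apply: pr_setI1 => //; [exact: measurableC|by rewrite /pr POmega0|].
  by rewrite prC// /pr B0 subr0.
pose F (n : nat) := if @choice.unpickle 'rV[int]_d n is Some z then env_shift z @^-1` O' else setT.
have mF n : measurable (F n).
  by rewrite /F; case: choice.unpickle => [z|//]; exact: measurable_preimage_shift.
have GoodP w : (\bigcap_n F n) w <-> forall z, O' (env_shift z w).
  split=> H z; last by move=> _; rewrite /F; case: choice.unpickle => [u|//]; exact: H.
  by have := H (choice.pickle z) I; rewrite /F choice.pickleK.
exists (\bigcap_n F n).
have infw w : (\bigcap_n F n) w -> forall x, infinite_set [set y | joined (open_edge w) x y].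
  move=> /GoodP Gw x fin; have [w0 _] := Gw (x - x0).
  apply: (cluster_infinite w0).
  have := finite_image (fun y => y - (x - x0)) fin; apply: sub_finite_set.
  move=> y /= jy; exists (y + (x - x0)); last by rewrite addrK.
  have := @joined_shift d (open_edge (env_shift (x - x0) w)) (open_edge w) (x - x0) x0 y.
  rewrite [x0 + _]addrC subrK; apply => // a b; by rewrite open_edge_shift.
have ray w : (\bigcap_n F n) w -> forall x, has_ray (open_edge w) x.
  move=> Gw x; apply: ray_of_infinite (infw w Gw x) => y.
  by apply: sub_finite_set (nbr_finite y) => z /= /open_edge_adj.
split.
- exact: bigcapT_measurable.
- apply: pr_bigcap1 => // n; rewrite /F; case: choice.unpickle => [z|]; last exact: prT.
  by rewrite pr_preimage_shift.
- by move=> w /GoodP/(_ 0)[]; rewrite env_shift0.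
- by move=> z w /GoodP Gw; apply/GoodP => u; rewrite env_shiftD.
- move=> w Gw x; split; last first.
    have [g [g0 _ /(_ 0%N)]] := ray w Gw x.
    by rewrite g0; exact: vertex_weight_gt0 nbr_finite _ _ _.
  have [_ nB] : O' w by have /GoodP/(_ 0) := Gw; rewrite env_shift0.
  have [K [[_ _] Kuniq]] : exists! K : set L,
      is_component (open_edge w) (ray_set w) K /\ infinite_set K.
    by apply: contrapT => H; apply: nB; exact: HB.
  have joinE y z : joined_in (open_edge w) (ray_set w) y z <-> joined (open_edge w) y z.
    split; first by case=> p pP _; exists p.
    by move=> [p pP]; exists p => // u _; exact: ray.
  have comp y : K = [set z | joined_in (open_edge w) (ray_set w) y z].
    apply: Kuniq; split; first by exists y => //; exact: ray.
    move=> fin; apply: (infw w Gw y); apply: sub_finite_set fin => z /= yz.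
    exact/joinE.
  have : K x by rewrite (comp x); apply/joinE; exact: joined_refl.
  by rewrite (comp x0) => /joinE.
Qed.

Variables (beta eps : R).
Hypothesis (beta_gt0 : 0 < beta).
Hypothesis mN : forall x, measurable_fun Omega0 (N x).
Hypothesis A3 : exists f : nat -> R,
  [/\ forall m n : nat, (1 <= m)%N -> (m <= n)%N -> f n <= f m,
      forall x (n : nat), (1 <= n)%N ->
        (P (Omega0 `&` [set w | (n%:R <= N x w)%R]) <= (f n)%:E)%E
    & (\sum_(1 <= n <oo) (n%:R `^ (alpha * beta) * f n)%R%:E < +oo)%E].

(** Borel-Cantelli, after a union bound over the ball of radius [r ^ beta], whose volume is of order
[r ^ (alpha * beta)]. *)
Lemma N_small_ae : exists Small : set (env R d), [/\ measurable Small, pr P Small = 1 &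
  forall w, Small w -> Omega0 w -> exists r0 : nat, forall (r : nat) y, (r0 <= r)%N ->
    (Zdist x0 y)%:R <= r%:R `^ beta -> N y w <= r%:R].
Proof.
have [f [_ fP fsum]] := A3.
pose bad (r : nat) y := Omega0 `&` [set w | r%:R <= N y w].
have mbad r y : measurable (bad r y).
  have := mN y mOmega0 (measurable_itv `[(r%:R : R), +oo[).
  by congr measurable; apply/seteqP; split => w [w0 /=]; rewrite in_itv /= andbT.
pose ball (r : nat) := fset_set (Zball x0 (r%:R `^ beta : R)).
pose F (r : nat) := \bigcup_(y in [set` ball r]) bad r y.
have mF r : measurable (F r).
  by apply: fin_bigcup_measurable => // y _.
have f0 r : (1 <= r)%N -> 0 <= f r.
  by move=> r1; rewrite -lee_fin; apply: le_trans (fP x0 r r1); exact: measure_ge0.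
have PF r : (1 <= r)%N -> pr P (F r) <= c2 * (r%:R `^ (alpha * beta) * f r).
  move=> r1.
  have Pbad y : pr P (bad r y) <= f r by rewrite -lee_fin -prE//; exact: fP.
  have sub (s : seq L) : pr P (\bigcup_(y in [set` s]) bad r y) <= (size s)%:R * f r.
    elim: s => [|y s IH] /=.
      by rewrite mul0r (_ : [set` [::]] = set0) ?bigcup_set0 ?pr0//; apply/seteqP; split.
    rewrite (_ : [set` y :: s] = [set y] `|` [set` s]); last first.
      apply/seteqP; split => u /=; rewrite in_cons.
        by case/orP => [/eqP|]; [left|right].
      by case=> [->|->]; rewrite ?eqxx ?orbT.
    rewrite bigcup_setU bigcup_set1 -natr1 mulrDl mul1r addrC.
    apply: le_trans (prU_le P (mbad _ _) _) (lerD (Pbad y) IH).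
    by apply: fin_bigcup_measurable => //; exact: finite_seq.
  apply: le_trans (sub _) _; rewrite mulrA ler_wpM2r ?f0//.
  have r1' : 1 <= r%:R `^ beta :> R.
    apply: (@le_trans _ _ (1 `^ beta)); first by rewrite powR1.
    apply: le_powR; [exact: ltW|by []|by rewrite ler1n].
  have /andP[_ +] := hball x0 r1'.
  by rewrite -powRrM [beta * _]mulrC.
pose u r := if r is 0%N then 0 else c2 * (r%:R `^ (alpha * beta) * f r).
have u0 r : 0 <= u r.
  by case: r => // r; rewrite /u mulr_ge0 ?(ltW c2_gt0)// mulr_ge0 ?powR_ge0 ?f0.
have cu : cvgn (series u).
  apply: nondecreasing_is_cvgn.
    by apply/nondecreasing_seqP => n; rewrite /series /= big_nat_recr//= lerDl.
  exists (c2 * fine (\sum_(1 <= n <oo) (n%:R `^ (alpha * beta) * f n)%R%:E)%E) => _ [n _ <-].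
  have t0 (k : nat) : (1 <= k)%N -> (0 <= (k%:R `^ (alpha * beta) * f k)%:E)%E.
    by move=> k1; rewrite lee_fin mulr_ge0 ?powR_ge0 ?f0.
  have tot0 : (0 <= \sum_(1 <= n <oo) (n%:R `^ (alpha * beta) * f n)%R%:E)%E.
    by apply: nneseries_ge0 => k k1 _; exact: t0.
  have tot_fin : (\sum_(1 <= n <oo) (n%:R `^ (alpha * beta) * f n)%R%:E)%E \is a fin_num.
    by rewrite ge0_fin_numE.
  case: n => [|n].
    by rewrite /series /= big_geq// mulr_ge0 ?(ltW c2_gt0)// fine_ge0.
  rewrite /series /= big_nat_recl// add0r.
  have -> : \sum_(0 <= i < n) u i.+1 = c2 * \sum_(1 <= i < n.+1) i%:R `^ (alpha * beta) * f i.
    by rewrite big_add1 /= mulr_sumr.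
  rewrite ler_wpM2l ?(ltW c2_gt0)// -lee_fin fineK// -sumEFin.
  by apply: nneseries_lim_ge => k k1 _; exact: t0.
have BC : pr P [set w | exists n0, forall n, (n0 <= n)%N -> ~ F n w] = 1.
  apply: (pr_borel_cantelli mF _ u0 cu).
  by exists 1%N => -[//|r] r1; exact: PF.
exists [set w | exists n0, forall n, (n0 <= n)%N -> ~ F n w]; split=> //.
  by apply: (@measurable_eventually _ _ (fun n => ~` F n)) => n; exact: measurableC.
move=> w [n0 Hn0] w0; exists n0 => r y n0r yr.
rewrite leNgt; apply/negP => rN; apply: (Hn0 r n0r); exists y; last by split=> //=; exact: ltW.
by rewrite /ball /= in_fset_set; [rewrite inE|exact: Zball_finite].
Qed.

End GoodEnvironments.

(** * Deterministic constants *)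

Section Constants.
Context {R : realType} {d : nat}.
Local Notation L := (lattice d).
Local Notation Tr := (trajectory d).
Variables (P : probability (env R d) R) (x0 : L) (PX : env R d -> L -> probability Tr R).
Variable Good : set (env R d).
Hypothesis nbr_fin : forall x, finite_set [set y : L | adj x y].
Hypothesis mGood : measurable Good.
Hypothesis PGood : pr P Good = 1.
Hypothesis Good_shift : forall z w, Good w -> Good (env_shift z w).
Hypothesis Good_law : forall w, Good w -> forall x, chain_law (transition w) x (PX w x).
Hypothesis B1_ergodic : forall A : set (env R d), measurable A ->
  (forall z : L, env_shift z @` A = A) -> P A = 0%E \/ P A = 1%E.
Hypothesis zero_one : forall w, Good w -> forall A : set Tr, measurable A ->
  (forall x X, A (tcons x X) <-> A X) ->
  exists2 c : R, c = 0 \/ c = 1 & forall x, pr (PX w x) A = c.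
Implicit Types (w : env R d) (x z : L) (A : set Tr) (Y : nat -> Tr -> R) (s : nat -> R).

(** On cylinders the law is a polynomial in the transition probabilities. *)
Lemma measurable_law x A : measurable A -> measurable_fun Good (fun w => pr (PX w x) A).
Proof.
move: A; apply: (trajectory_induction
  (P := fun A => measurable_fun Good (fun w => pr (PX w x) A))).
- by under eq_fun do rewrite prT; exact: measurable_cst.
- by under eq_fun do rewrite pr0; exact: measurable_cst.
- move=> s n; apply: (eq_measurable_fun (fun w => (x == s 0%N)%:R *
     \prod_(i < n) transition w (s i) (s i.+1))).
    by move=> w; rewrite inE => Gw; rewrite (pr_cylinder (Good_law Gw)).
  apply: measurable_funM; first exact: measurable_cst.
  apply: (@measurable_prod _ _ _ _ 'I_n) => i _.
  by apply: measurable_funTS; exact: measurable_transition.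
- move=> A mA mf; under eq_fun do rewrite prC//.
  by apply: measurable_funB => //; exact: measurable_cst.
- move=> F mF tF mf; apply/measurable_EFinP.
  rewrite (_ : EFin \o _ = fun w => (\sum_(n <oo) (pr (PX w x) (F n))%:E)%E); last first.
    by apply/funext => w /=; rewrite pr_bigcup.
  apply: ge0_emeasurable_sum => [k w _ _|k _]; first by rewrite lee_fin pr_ge0.
  by apply/measurable_EFinP; exact: mf.
Qed.

(** The transition probabilities are covariant under translations, and they determine the laws. *)
Lemma law_shift z w x A : Good w -> measurable A ->
  pr (PX w (x + z)) A = pr (PX (env_shift z w) x) (@tmove d z @^-1` A).
Proof.
move=> Gw; move: A; apply: (trajectory_induction
  (P := fun A => pr (PX w (x + z)) A = pr (PX (env_shift z w) x) (@tmove d z @^-1` A))).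
- by rewrite preimage_setT !prT.
- by rewrite preimage_set0 !pr0.
- move=> s n; rewrite (pr_cylinder (Good_law Gw)).
  rewrite (_ : @tmove d z @^-1` cylinder s n = cylinder (fun i => s i - z) n); last first.
    apply/seteqP; split => X /= H i ilen; first by rewrite -(H i ilen) /tmove addrK.
    by rewrite /tmove (H i ilen) subrK.
  rewrite (pr_cylinder (Good_law (Good_shift z Gw))) [x == _]eq_sym subr_eq [s 0%N == _]eq_sym.
  by congr (_ * _); apply: eq_bigr => i _; rewrite (transition_shift nbr_fin) !subrK.
- move=> A mA AE; rewrite prC// AE preimage_setC prC//.
  exact: measurable_tmove.
- move=> F mF tF FE; apply: EFin_inj; rewrite preimage_bigcup !pr_bigcup//.
  + by apply: eq_eseriesr => n _; rewrite FE.
  + by move=> n; exact: measurable_tmove.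
  + by move=> i j _ _ [X [Fi Fj]]; apply: (tF i j) => //; exists (tmove z X).
Qed.

Definition full A : set (env R d) := Good `&` [set w | pr (PX w x0) A = 1].

Lemma measurable_full A : measurable A -> measurable (full A).
Proof.
move=> mA; have := measurable_law x0 mA mGood (measurable_set1 (1 : R)).
by congr measurable; apply/seteqP; split.
Qed.

(** By the zero-one law of the walk and the covariance of the laws, the environments in which such
an event is almost sure form a translation invariant set, and ergodicity applies. *)
Lemma full_zero_one A : measurable A -> (forall x X, A (tcons x X) <-> A X) ->
  (forall z X, A (tmove z X) <-> A X) -> pr P (full A) = 0 \/ pr P (full A) = 1.
Proof.
move=> mA invA trA.
have fullS z w : full A w -> full A (env_shift z w).
  move=> [Gw Aw]; split; first exact: Good_shift.
  have [c _ cE] := zero_one Gw mA invA.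
  have := law_shift z x0 Gw mA; rewrite /= cE -(cE x0) Aw.
  rewrite (_ : tmove z @^-1` A = A); first by move=> <-.
  by apply/seteqP; split => X /=; rewrite trA.
have [] := @B1_ergodic (full A) (measurable_full mA).
- move=> z; rewrite image_env_shift; apply/seteqP; split => w /= Aw; last exact: fullS.
  by have := fullS z _ Aw; rewrite env_shiftD subrr env_shift0.
- by rewrite /pr => ->; left.
- by rewrite /pr => ->; right.
Qed.

Section Limsup.
Variables (Y : nat -> Tr -> R) (s : nat -> R).
Hypothesis adapted_Y : adapted Y.
Hypothesis shift_Y : shift_stable Y.
Hypothesis move_Y : forall n z X, Y n (tmove z X) = Y n X.
Hypothesis s_regular : regular_scale s.
Local Notation V := (eventually_le Y s).

Let mV a : measurable (V a). Proof. exact: measurable_eventually_le. Qed.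
Let invV a x X : V a (tcons x X) <-> V a X. Proof. exact: eventually_le_tcons. Qed.
Let moveV a z X : V a (tmove z X) <-> V a X.
Proof.
split=> H k; have [n0 Hn0] := H k; exists n0 => n /Hn0; by rewrite move_Y.
Qed.
Let VW a b : a <= b -> V a `<=` V b.
Proof. by have [s0 _ _] := s_regular; exact: eventually_le_mono. Qed.
Let mfull a : measurable (full (V a)). Proof. exact: measurable_full. Qed.
Let fullW a b : a <= b -> full (V a) `<=` full (V b).
Proof.
move=> ab w [Gw Aw]; split=> //; apply/eqP; rewrite eq_le pr_le1//= -[X in X <= _]Aw.
by apply: pr_mono => //; exact: VW.
Qed.
Let full01 a : pr P (full (V a)) = 0 \/ pr P (full (V a)) = 1.
Proof. by apply: full_zero_one; [exact: mV|exact: invV|exact: moveV]. Qed.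

(** The constant is the infimum of the levels [a] for which [V a] is almost surely full. Below it
[V a] is almost surely not full, and then null by the zero-one law of the walk. The bounds [lo] and
[hi] may depend on the environment, so they range over countably many values. *)
Lemma limsup_constant (lo hi : nat -> R) (F : set (env R d)) :
  measurable F -> pr P F = 1 ->
  (forall w, F w -> Good w -> exists n, pr (PX w x0) (V (hi n)) = 1) ->
  (forall w, F w -> Good w -> exists n, pr (PX w x0) (V (lo n)) = 0) ->
  exists C : R, [/\ exists n, lo n <= C, exists n, C <= hi n &
    {ae P, forall w, forall x, {ae PX w x, forall X : Tr,
      limn_esup (fun n => (Y n X / s n)%:E) = C%:E}}].
Proof.
move=> mF PF Hhi Hlo.
have PFG : pr P (F `&` Good) = 1 by exact: pr_setI1.
have mFG : measurable (F `&` Good) by exact: measurableI.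
have [nhi Phi] : exists n, pr P (full (V (hi n))) = 1.
  apply: contrapT => H; have Z n : pr P (full (V (hi n))) = 0.
    by have [//|E] := full01 (hi n); exfalso; apply: H; exists n.
  have U0 := pr_bigcup0 (fun n => mfull (hi n)) Z.
  have : pr P (F `&` Good) = 0.
    apply: pr_eq0_sub mFG _ _ U0; first by apply: bigcupT_measurable.
    by move=> w [Fw Gw]; have [n Hn] := Hhi w Fw Gw; exists n.
  by rewrite PFG => /eqP; rewrite oner_eq0.
have [nlo Plo] : exists n, pr P (full (V (lo n))) = 0.
  apply: contrapT => H; have Z n : pr P (full (V (lo n))) = 1.
    by have [E|//] := full01 (lo n); exfalso; apply: H; exists n.
  have U1 := pr_bigcap1 (fun n => mfull (lo n)) Z.
  have mU : measurable (\bigcap_n full (V (lo n))) by exact: bigcapT_measurable.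
  have := pr_setI1 mFG mU PFG U1.
  rewrite (_ : _ `&` _ = set0) ?pr0; first by move/eqP; rewrite eq_sym oner_eq0.
  apply/seteqP; split => w // -[[Fw Gw] Uw]; have [n Hn] := Hlo w Fw Gw.
  by have [_ /=] := Uw n I; rewrite Hn => /eqP; rewrite eq_sym oner_eq0.
pose S := [set a | pr P (full (V a)) = 1].
have lbS : lbound S (lo nlo).
  move=> a /= Sa; rewrite leNgt; apply/negP => lt.
  have := pr_mono P (mfull a) (mfull (lo nlo)) (fullW (ltW lt)).
  by rewrite Sa Plo; lra.
have S0 : S !=set0 by exists (hi nhi).
have infS : has_inf S by split=> //; exists (lo nlo).
pose C := inf S.
have above e : 0 < e -> pr P (full (V (C + e))) = 1.
  move=> e0; have [a Sa ae] := inf_adherent e0 infS.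
  apply/eqP; rewrite eq_le pr_le1//= -[X in X <= _]Sa.
  by apply: pr_mono => //; exact/fullW/ltW.
have below e : 0 < e -> pr P (full (V (C - e))) = 0.
  move=> e0; have [//|E] := full01 (C - e); exfalso.
  have : C <= C - e by apply: ge_inf => //; exists (lo nlo).
  by lra.
exists C; split.
- by exists nlo; apply: lb_le_inf.
- by exists nhi; apply: ge_inf => //; exists (lo nlo).
have e_gt0 (k : nat) : 0 < k.+1%:R^-1 :> R by rewrite invr_gt0 ltr0n.
pose G1 := \bigcap_k full (V (C + k.+1%:R^-1)).
pose G2 := \bigcap_k ~` full (V (C - k.+1%:R^-1)).
have mG1 : measurable G1 by exact: bigcapT_measurable.
have mG2 : measurable G2 by apply: bigcapT_measurable => k; exact: measurableC.
have P1 : pr P G1 = 1 by apply: pr_bigcap1 => // k; exact: above.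
have P2 : pr P G2 = 1.
  apply: pr_bigcap1 => [k|k]; first exact: measurableC.
  by rewrite prC// below// subr0.
have := pr_eq1_ae (measurableI _ _ mG1 mG2) (pr_setI1 mG1 mG2 P1 P2).
apply: negligibleS => w /= H; apply: contra_not H => -[Uw Lw] x.
have Gw : Good w by have [] := Uw 0%N I.
pose U k : set Tr := V (C + k.+1%:R^-1) `&` ~` V (C - k.+1%:R^-1).
have mU k : measurable (U k) by apply: measurableI => //; exact: measurableC.
have PU : pr (PX w x) (\bigcap_k U k) = 1.
  apply: pr_bigcap1 => // k; apply: pr_setI1 => //.
  - exact: measurableC.
  - have [c _ cE] := zero_one Gw (mV (C + k.+1%:R^-1)) (invV (C + k.+1%:R^-1)).
    by rewrite cE -(cE x0); have [] := Uw k I.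
  - have [c c01 cE] := zero_one Gw (mV (C - k.+1%:R^-1)) (invV (C - k.+1%:R^-1)).
    rewrite prC// cE; case: c01 => [->|c1]; first by rewrite subr0.
    by exfalso; apply: (Lw k I); split=> //=; rewrite cE.
have := pr_eq1_ae (bigcapT_measurable mU) PU.
apply: negligibleS => X /= HX; apply: contra_not HX => UX.
by apply: limn_esup_eventually_le => // k; have [] := UX k I.
Qed.

End Limsup.

End Constants.

(** * The laws of the iterated logarithm *)

Section Functionals.
Context {R : realType} {d : nat}.
Local Notation L := (lattice d).
Local Notation Tr := (trajectory d).
Hypothesis conn : forall x y, joined (@adj d) x y.
Implicit Types (X : Tr) (x y z : L).

Lemma norm_natB_le (a b k : nat) : (a <= b + k)%N -> (b <= a + k)%N ->
  `|a%:R - b%:R| <= k%:R :> R.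
Proof.
rewrite -!(ler_nat R) !natrD => h1 h2.
by rewrite ler_norml; apply/andP; split; lra.
Qed.

Lemma disp_shift_stable : shift_stable (@disp R d).
Proof.
move=> x X; exists (Zdist x (X 0%N))%:R => n; rewrite /disp /=.
apply: norm_natB_le; first by rewrite addnC; exact: Zdist_triangle.
by rewrite (Zdist_sym conn x (X 0%N)) addnC; exact: Zdist_triangle.
Qed.

Lemma max_disp_shift_stable : shift_stable (@max_disp R d).
Proof.
move=> x X; exists (Zdist x (X 0%N))%:R => n; rewrite /max_disp.
pose f l := Zdist (X 0%N) (X l).
have fle l : (l <= n)%N -> (f l <= \max_(l < n.+1) f l)%N.
  by move=> ln; apply: (@leq_bigmax _ (fun l : 'I_n.+1 => f l) (Ordinal (ln : (l < n.+1)%N))).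
apply: norm_natB_le.
  apply/bigmax_leqP => -[[|l] ln] _ /=; first by rewrite /Zdist gdistxx.
  apply: leq_trans (Zdist_triangle conn (X 0%N) _ _) _; rewrite addnC leq_add2r; exact: fle.
apply/bigmax_leqP => -[l ln] _ /=.
apply: leq_trans (Zdist_triangle conn x _ _) _; rewrite (Zdist_sym conn _ x) addnC leq_add2r.
by apply: (@leq_bigmax _ (fun l : 'I_n.+2 => Zdist (tcons x X 0%N) (tcons x X l)) (Ordinal (ln : (l.+1 < n.+2)%N))).
Qed.

Lemma disp_move n z X : disp n (tmove z X) = disp n X :> R.
Proof. by rewrite /disp /tmove (Zdist_shift z conn). Qed.

Lemma max_disp_move n z X : max_disp n (tmove z X) = max_disp n X :> R.
Proof.
by rewrite /max_disp; congr (_%:R); apply: eq_bigr => l _; rewrite /tmove (Zdist_shift z conn).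
Qed.

Lemma phi_regular (beta : R) : 1 < beta -> regular_scale (phi beta).
Proof.
move=> b1; have b0 : 0 < beta by lra.
have bV : 0 < beta^-1 by rewrite invr_gt0.
have bV1 : beta^-1 < 1 by rewrite invf_lt1.
apply: (scale_regular (b := beta^-1) (c := 1 - beta^-1)).
- by rewrite !ltW.
- by rewrite ler_norml; apply/andP; split; lra.
move=> M; near=> n; apply: (@le_trans _ _ (n%:R `^ beta^-1)).
  by near: n; exact: near_powR_ge.
by apply: phi_ge => //; near: n; exact: near_LL_ge.
Unshelve. all: by end_near. Qed.

Lemma psi_regular (beta : R) : 1 < beta -> regular_scale (psi beta).
Proof.
move=> b1; have b0 : 0 < beta by lra.
have bV : 0 < beta^-1 by rewrite invr_gt0.
have bV1 : beta^-1 < 1 by rewrite invf_lt1.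
apply: (scale_regular (b := beta^-1) (c := - beta^-1)).
- by rewrite !ltW.
- by rewrite ler_norml; apply/andP; split; lra.
by move=> M; exact: near_psi_ge.
Qed.

End Functionals.

Theorem theorem1p4 (R : realType) (d : nat)
  (alpha c1 c2 : R) (halpha : 1 <= alpha) (hc1 : 0 < c1) (hc2 : 0 < c2)
  (hball : forall (x : lattice d) (r : R), 1 <= r ->
     c1 * r `^ alpha <= #|` fset_set (Zball x r)|%:R <= c2 * r `^ alpha)
  (P : probability (env R d) R) (x0 : lattice d)
  (* the laws of the random walks *)
  (PX : env R d -> lattice d -> probability (trajectory d) R)
  (hPX : forall w x, cluster_of w x0 x -> 0 < vertex_weight w x ->
     chain_law (transition w) x (PX w x))
  (* assumption (A) *)
  (Omega0 : set (env R d)) (mOmega0 : measurable Omega0)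
  (POmega0 : P Omega0 = 1%E)
  (c11 c12 c13 c14 c15 c16 beta eps : R)
  (hc11 : 0 < c11) (hc12 : 0 < c12) (hc13 : 0 < c13)
  (hc14 : 0 < c14) (hc15 : 0 < c15) (hc16 : 0 < c16)
  (hbeta : 0 < beta) (heps : 0 < eps) (heps_beta : eps + 1 < beta)
  (N : lattice d -> env R d -> R)
  (mN : forall x, measurable_fun Omega0 (N x))
  (A1 : forall w x (r : R), Omega0 w -> cluster_of w x0 x ->
     1 <= r -> N x w <= r ->
     c11 * r `^ alpha <= cluster_vol w x0 x r <= c12 * r `^ alpha)
  (A2_upper : forall w x y (n : nat), Omega0 w ->
     cluster_of w x0 x -> cluster_of w x0 y -> (0 < n)%N ->
     Num.max (Zdist x y)%:R (N x w) <= n%:R ->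
     heat_kernel PX n w x y <=
       c13 / n%:R `^ (alpha / beta) *
       expR (- c14 * ((Zdist x y)%:R / n%:R `^ beta^-1)
                       `^ (beta / (beta - 1))))
  (A2_lower : forall w x y (n : nat), Omega0 w ->
     cluster_of w x0 x -> cluster_of w x0 y -> (0 < n)%N ->
     Num.max ((Zdist x y)%:R `^ (1 + eps)) (N x w) <= n%:R ->
     c15 / n%:R `^ (alpha / beta) *
       expR (- c16 * ((Zdist x y)%:R / n%:R `^ beta^-1)
                       `^ (beta / (beta - 1))) <=
     heat_kernel PX n w x y + heat_kernel PX n.+1 w x y)
  (A3 : exists f : nat -> R,
     [/\ forall m n : nat, (1 <= m)%N -> (m <= n)%N -> f n <= f m,
         forall x (n : nat), (1 <= n)%N ->
           (P (Omega0 `&` [set w | (n%:R <= N x w)%R]) <= (f n)%:E)%E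
       & (\sum_(1 <= n <oo) (n%:R `^ (alpha * beta) * f n)%R%:E < +oo)%E])
  (* assumption (B) *)
  (B1_invariant : forall (z : lattice d) (A : set (env R d)), measurable A ->
     P (env_shift z @` A) = P A)
  (B1_ergodic : forall A : set (env R d), measurable A ->
     (forall z : lattice d, env_shift z @` A = A) -> P A = 0%E \/ P A = 1%E)
  (B2 : {ae P, forall w, exists! K : set (lattice d),
     is_component (open_edge w) (ray_set w) K /\ infinite_set K}) :
  exists C1 C2 : R, [/\ 0 < C1, 0 < C2 &
    {ae P, forall w, forall x, cluster_of w x0 x ->
      {ae PX w x, forall X : trajectory d,
         limn_esup (fun n : nat =>
           ((Zdist (X 0%N) (X n))%:R /
            (n%:R `^ beta^-1 * ln (ln n%:R) `^ (1 - beta^-1)))%:E) = C1%:E}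
      /\
      {ae PX w x, forall X : trajectory d,
         limn_einf (fun n : nat =>
           ((\max_(l < n.+1) Zdist (X 0%N) (X l))%:R /
            (n%:R `^ beta^-1 * ln (ln n%:R) `^ (- beta^-1)))%:E) = C2%:E}}].
Proof.
have ball_fin := Zball_finite hc1 hball.
have nbr_fin := nbr_finite hc1 hball.
have [Good [mGood PGood Good0 Good_shift Good_all]] :=
  good_environments halpha hc1 hball mOmega0 POmega0 hc11 A1 B1_invariant B2.
have [Small [mSmall PSmall SmallN]] :=
  N_small_ae hc1 hc2 hball x0 mOmega0 hbeta mN A3.
have b1 : 1 < beta by lra.
have Good_law w : Good w -> forall x, chain_law (transition w) x (PX w x).
  by move=> Gw x; have [cx wx] := Good_all w Gw x; exact: hPX.
(* The lattice is connected because a good environment is. *)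
have conn x y : joined (@adj d) x y.
  have [w Gw] : exists w, Good w.
    apply: contrapT => H; have : pr P Good = pr P set0.
      by congr pr; apply/seteqP; split => w // Gw; apply: H; exists w.
    by rewrite PGood pr0 => /eqP; rewrite oner_eq0.
  have open_joined u v : joined (open_edge w) u v -> joined (@adj d) u v.
    move=> [p [pp pE]]; exists p; split=> //; apply: sub_path pp.
    exact: open_edge_adj.
  have [cx _] := Good_all w Gw x; have [cy _] := Good_all w Gw y.
  by apply: joined_trans (joined_sym (@adj_sym d) (open_joined _ _ cx)) (open_joined _ _ cy).
have nb_dist (x y : lattice d) : y \in nbrs x -> (Zdist x y <= 1)%N.
  by move=> xy; apply: gdist_adj; rewrite -(mem_nbrs nbr_fin).
have t_ge0 (w : env R d) x y := transition_ge0 nbr_fin w x y.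
have t_out (w : env R d) x y := @transition_out _ _ nbr_fin w x y.
have t_sum w : Good w -> forall x, \sum_(y <- nbrs x) transition w x y = 1.
  by move=> Gw x; apply: transition_sum => //; have [] := Good_all w Gw x.
have m_ge0 (w : env R d) x := vertex_weight_ge0 nbr_fin w x.
have A1' w : Good w -> forall x (r : R), 1 <= r -> N x w <= r ->
    c11 * r `^ alpha <= vol (vertex_weight w) x r <= c12 * r `^ alpha.
  move=> Gw x r r1 Nr; have [cx _] := Good_all w Gw x.
  have := A1 w x r (Good0 w Gw) cx r1 Nr.
  rewrite /cluster_vol (_ : cluster_of w x0 = setT) ?setIT; last first.
    by apply/seteqP; split => y // _; have [] := Good_all w Gw y.
  by rewrite fsbig_finite.
have A2u w : Good w -> forall x y (n : nat), (0 < n)%N -> (Zdist x y <= n)%N -> N x w <= n%:R ->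
    q (PX w) n x y <= vertex_weight w y * (c13 / n%:R `^ (alpha / beta) *
      expR (- c14 * ((Zdist x y)%:R / n%:R `^ beta^-1) `^ (beta / (beta - 1)))).
  move=> Gw x y n n0 Dn Nn; have [cx _] := Good_all w Gw x; have [cy wy] := Good_all w Gw y.
  rewrite mulrC -ler_pdivrMr//; apply: A2_upper => //; first exact: Good0.
  by rewrite ge_max ler_nat Dn.
have A2l w : Good w -> forall x y (n : nat), (0 < n)%N ->
    (Zdist x y)%:R `^ (1 + eps) <= n%:R -> N x w <= n%:R ->
    vertex_weight w y * (c15 / n%:R `^ (alpha / beta) *
      expR (- c16 * ((Zdist x y)%:R / n%:R `^ beta^-1) `^ (beta / (beta - 1)))) <=
    q (PX w) n x y + q (PX w) n.+1 x y.
  move=> Gw x y n n0 Dn Nn; have [cx _] := Good_all w Gw x; have [cy wy] := Good_all w Gw y.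
  rewrite mulrC -ler_pdivlMr// mulrDl; apply: A2_lower => //; first exact: Good0.
  by rewrite ge_max Dn.
have zero_one w : Good w -> forall A : set (trajectory d), measurable A ->
    (forall x X, A (tcons x X) <-> A X) ->
    exists2 c : R, c = 0 \/ c = 1 & forall x, pr (PX w x) A = c.
  move=> Gw A mA invA.
  have const x : pr (PX w x) A = pr (PX w x0) A.
    refine (bounded_harmonic_constant halpha heps heps_beta hc11 hc15 hc16
      (Good_law w Gw) (t_ge0 w) (t_out w) (t_sum w Gw) conn ball_fin (m_ge0 w) (A1' w Gw) (A2l w Gw)
      (h := fun x => pr (PX w x) A) _ _ x x0) => y; last by rewrite pr_ge0 pr_le1.
    rewrite [RHS](pr_first_step (Good_law w Gw) (t_ge0 w) (t_out w) (t_sum w Gw))//.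
    apply: eq_bigr => z _; congr (_ * pr _ _).
    by apply/seteqP; split => X /=; rewrite invA.
  exists (pr (PX w x0) A) => //.
  exact: (zero_one_of_constant (Good_law w Gw) (t_ge0 w) (t_out w) (t_sum w Gw) mA invA const).
have pr1_mono (Y : nat -> trajectory d -> R) s w a b : (forall n, 0 <= s n) -> adapted Y ->
    a <= b -> pr (PX w x0) (eventually_le Y s a) = 1 -> pr (PX w x0) (eventually_le Y s b) = 1.
  move=> s0 aY ab H; apply/eqP; rewrite eq_le pr_le1 /=; last exact: measurable_eventually_le.
  by rewrite -[X in X <= _]H; apply: pr_mono; try exact: measurable_eventually_le;
     exact: eventually_le_mono.
have pr0_mono (Y : nat -> trajectory d -> R) s w a b : (forall n, 0 <= s n) -> adapted Y ->
    a <= b -> pr (PX w x0) (eventually_le Y s b) = 0 -> pr (PX w x0) (eventually_le Y s a) = 0.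
  move=> s0 aY ab; apply: pr_eq0_sub; try exact: measurable_eventually_le.
  exact: eventually_le_mono.
have nat_ge (K : R) : exists n : nat, K <= n%:R.
  by exists (Num.truncn `|K|).+1; apply: le_trans (ler_norm K) _; rewrite ltW// truncnS_gt.
have [C1 [[n1 lo1] _ ae1]] : exists C : R, [/\ exists n : nat, n.+1%:R^-1 <= C,
    exists n : nat, C <= n%:R & {ae P, forall w, forall x, {ae PX w x, forall X : trajectory d,
      limn_esup (fun n => (disp n X / phi beta n)%:E) = C%:E}}].
  apply: (limsup_constant nbr_fin mGood PGood Good_shift Good_law B1_ergodic zero_one
    (@adapted_disp R d) (disp_shift_stable conn) (disp_move conn) (phi_regular b1)
    (lo := fun n => n.+1%:R^-1) (hi := fun n => n%:R) mSmall PSmall) => w Sw Gw.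
    have [K HK] := disp_limsup_le halpha heps heps_beta hc12 hc13 hc14
      (Good_law w Gw) (t_ge0 w) (t_out w) (t_sum w Gw) nb_dist conn ball_fin (m_ge0 w)
      (A1' w Gw) (A2u w Gw) (SmallN w Sw (Good0 w Gw)).
    have [n Kn] := nat_ge K; exists n.
    by apply: pr1_mono Kn HK; [exact: phi_ge0|exact: adapted_disp].
  have [k k0 Hk] := disp_limsup_ge halpha heps heps_beta hc11 hc15 hc16
      (Good_law w Gw) (t_ge0 w) (t_out w) (t_sum w Gw) nb_dist conn ball_fin (m_ge0 w)
      (A1' w Gw) (A2l w Gw) (SmallN w Sw (Good0 w Gw)).
  have [n nk] := exists_inv_le k0; exists n.
  by apply: pr0_mono nk Hk; [exact: phi_ge0|exact: adapted_disp].
(* The lower limit of the maximum is treated as an upper limit, with the opposite sign. *)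
have [C2 [_ [n2 hi2] ae2]] : exists C : R, [/\ exists n : nat, - n%:R <= C,
    exists n : nat, C <= - n.+1%:R^-1 & {ae P, forall w, forall x, {ae PX w x, forall X : trajectory d,
      limn_esup (fun n => (- max_disp n X / psi beta n)%:E) = C%:E}}].
  have adapted_max := adapted_opp (@adapted_max_disp R d).
  have move_max (n : nat) (z : lattice d) (X : trajectory d) : - max_disp n (tmove z X) = - max_disp n X :> R.
    by rewrite (max_disp_move conn).
  apply: (limsup_constant nbr_fin mGood PGood Good_shift Good_law B1_ergodic zero_one
    adapted_max (shift_stable_opp (max_disp_shift_stable conn)) move_max (psi_regular b1)
    (lo := fun n => - n%:R) (hi := fun n => - n.+1%:R^-1) mSmall PSmall) => w Sw Gw.
    have [k k0 Hk] := max_disp_liminf_ge halpha heps heps_beta hc12 hc13 hc14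
      (Good_law w Gw) (t_ge0 w) (t_out w) (t_sum w Gw) nb_dist conn ball_fin (m_ge0 w)
      (A1' w Gw) (A2u w Gw) (SmallN w Sw (Good0 w Gw)).
    have [n nk] := exists_inv_le k0; exists n; move: nk; rewrite -lerN2 => nk.
    by apply: pr1_mono nk Hk; [exact: psi_ge0|].
  have [K HK] := max_disp_liminf_le halpha heps heps_beta hc11 hc12 hc13 hc14 hc15 hc16
      (Good_law w Gw) (t_ge0 w) (t_out w) (t_sum w Gw) nb_dist conn ball_fin (m_ge0 w)
      (A1' w Gw) (A2u w Gw) (A2l w Gw) (SmallN w Sw (Good0 w Gw)).
  have [n Kn] := nat_ge K; exists n; move: Kn; rewrite -lerN2 => Kn.
  by apply: pr0_mono Kn HK; [exact: psi_ge0|].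
have C1_gt0 : 0 < C1 by apply: lt_le_trans lo1; rewrite invr_gt0 ltr0n.
have C2_lt0 : C2 < 0 by apply: le_lt_trans hi2 _; rewrite oppr_lt0 invr_gt0 ltr0n.
exists C1, (- C2); split=> //; first by rewrite oppr_gt0.
apply: filterS2 ae1 ae2 => w H1 H2 x _; split; first exact: H1.
apply: filterS (H2 x) => X HX; rewrite /limn_einf.
transitivity (- limn_esup (fun n => (- max_disp n X / psi beta n)%:E))%E; last by rewrite HX.
by congr (- limn_esup _)%E; apply/funext => n; rewrite mulNr EFinN.
Qed.
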